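(* Let $A$ be a self-adjoint operator in a Hilbert space $\mathcal H$ with an orthonormal basis of eigenvectors $\{\psi_n\}_{n\in\mathbb N}$, $A\psi_n=\mu_n\psi_n$, whose eigenvalues are simple and satisfy $\mu_1\ge 1$ and $\mu_{n+1}-\mu_n\ge 1$ for all $n\in\mathbb N$. Let $b$ be a sesquilinear form such that, for some $\alpha>0$ and $M_b>0$, $$|b(\psi_m,\psi_n)|\le \frac{M_b}{m^\alpha n^\alpha}\qquad\text{for all } m,n\in\mathbb N,$$ and let $T$ be the m-sectorial operator associated with the form $t=a+b$ (see context). Let $N\in\mathbb N$ be such that $$M_b\,C(2\alpha)\,\sigma_{2\alpha}(n)\le \tfrac12\qquad\text{for all } n>N,$$ and let $h>1$ be such that $$2M_b\left(\frac1h\sum_{k=1}^{N+2}\frac1{k^{2\alpha}}+D(2\alpha)\,\tau_{2\alpha}(h)\right)\le\frac12 ,$$ where $C(2\alpha),\sigma_{2\alpha},D(2\alpha),\tau_{2\alpha}$ are described in the context. Then the eigenvalues of $T$ are contained in the interior of $\Pi=\Pi_0\cup\bigcup_{j>N+1}\Pi_j$. Moreover, the Riesz projections $$S_{N+1}:=\frac1{2\pi \mathrm i}\int_{\Gamma_0}(z-T)^{-1}\,\mathrm dz,\qquad P_j:=\frac1{2\pi \mathrm i}\int_{\Gamma_j}(z-T)^{-1}\,\mathrm dz\quad (j>N+1)$$ are well-defined, and $\operatorname{Rank}S_{N+1}=N+1$ and $\operatorname{Rank}P_j=1$ for all $j>N+1$.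
   Context: Here $\mathbb N=\{1,2,\dots\}$. The form $a$ is $a(\phi,\psi)=\langle A^{1/2}\phi,A^{1/2}\psi\rangle$ with $\operatorname{Dom}(a)=\operatorname{Dom}(A^{1/2})$. Forms are linear in the first and antilinear in the second argument. The (not necessarily symmetric) form $b$ is defined on $\operatorname{Dom}(a)$ and is determined there by its values on the eigenvectors: for $f=\sum_j f_j\psi_j$ and $g=\sum_k g_k\psi_k$ in $\operatorname{Dom}(a)$ one has $b(f,g)=\sum_{j,k}f_j\overline{g_k}\,b(\psi_j,\psi_k)$. Under the assumption on $b(\psi_m,\psi_n)$, $b$ is form-bounded relative to $a$ with relative bound $0$, so $t:=a+b$ with $\operatorname{Dom}(t)=\operatorname{Dom}(a)$ is a closed sectorial form, and $T$ is the m-sectorial operator associated with $t$ by the first representation theorem; $T$ has compact resolvent. Regions: $\Pi_0:=\{z\in\mathbb C:\ -h<\operatorname{Re}z<N+\tfrac32,\ |\operatorname{Im}z|<h\}$, $\Pi_k:=\{z\in\mathbb C: |z-\mu_k|<\tfrac12\}$ for $k\in\mathbb N$, $\Gamma_k:=\partial\Pi_k$ for $k\ge 0$ (positively oriented). Functions: for $\gamma>0$ and integers $n>1$, $\sigma_\gamma(n):=n^{-\gamma}\log n$ if $\gamma\le1$ and $\sigma_\gamma(n):=n^{-1}$ if $\gamma>1$. For $h>1$, $\tau_\gamma(h):=h^{-\gamma}$ if $\gamma<1$, $\tau_\gamma(h):=h^{-1}\log h$ if $\gamma=1$, $\tau_\gamma(h):=h^{-1}$ if $\gamma>1$. Constants: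 $C(\gamma)$ is a constant, independent of $n$, such that for every integer $n>1$ and every $z\in\mathbb C$ with $\operatorname{Re}z\in[\mu_n-\tfrac12,\mu_{n+1}-\tfrac12]$ and $z\notin\Pi_n$ one has $\sum_{k=1}^\infty \frac{1}{k^\gamma|\mu_k-z|}\le C(\gamma)\sigma_\gamma(n)$. $D(\gamma)$ is a constant, independent of $h$, such that $\sum_{k=1}^\infty\frac1{k^\gamma(k+h)}\le D(\gamma)\tau_\gamma(h)$ for $h>1$.
   Formalization: The right edge of Π_0 (and of Γ_0) is taken as Re z < μ_{N+1}+1/2 instead of Re z < N+3/2; the two agree when μ_{N+1}=N+1, and with N+3/2 the claim fails, e.g. for μ_n=100n, b=0, N=1. *)

(* Defs.v *)
From HB Require Import structures.
From mathcomp Require Import all_boot all_order all_algebra.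
From mathcomp Require Export complex.
From mathcomp Require Import all_classical all_reals all_analysis.
Import Order.TTheory GRing.Theory Num.Theory.
Import numFieldNormedType.Exports.

Set Implicit Arguments.
Unset Strict Implicit.
Unset Printing Implicit Defensive.

Local Open Scope classical_set_scope.
Local Open Scope complex_scope.
Local Open Scope ring_scope.

Local Notation Re := complex.Re.
Local Notation Im := complex.Im.

Section Complex.
Context {R : realType}.

Definition cabs (z : R[i]) : R := Re `|z|.

End Complex.

Section Operators.
Context {R : realType} {H : completeNormedModType R[i]}.
Local Notation C := R[i].

(* The values of [oval] and [fval] are meaningful on [odom] and [fdom] only. *)
Record operator := Operator { odom : set H ; oval :> H -> H }.
Record form := Form { fdom : set H ; fval :> H -> H -> C }.

Definition lin_subspace (D : set H) : Prop :=
  D 0 /\ forall (c : C) u v, D u -> D v -> D (c *: u + v).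

Definition linear_operator (T : operator) : Prop :=
  lin_subspace (odom T) /\
  forall (c : C) u v, odom T u -> odom T v -> T (c *: u + v) = c *: T u + T v.

Definition sesquilinear_on (D : set H) (b : H -> H -> C) : Prop :=
  [/\ lin_subspace D,
      forall (c : C) u v w, D u -> D v -> D w ->
        b (c *: u + v) w = c * b u w + b v w
    & forall (c : C) u v w, D u -> D v -> D w ->
        b w (c *: u + v) = c^* * b w u + b w v].

Definition op_eigenvalue (T : operator) (l : C) : Prop :=
  exists u, [/\ odom T u, u != 0 & T u = l *: u].

Definition resolvent_set (T : operator) : set C := [set z |
  exists B : {linear H -> H}, [/\ continuous B,
    forall x, odom T (B x) /\ z *: B x - T (B x) = x
  & forall u, odom T u -> B (z *: u - T u) = u]].

(* [(z - T)^-1]; meaningful for [z] in [resolvent_set T] only. *)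
Definition resolvent (T : operator) (z : C) (x : H) : H :=
  xget 0 [set u | odom T u /\ z *: u - T u = x].

Definition has_rank (F : H -> H) (n : nat) : Prop :=
  exists e : 'I_n -> H,
    (forall c : 'I_n -> C, \sum_i c i *: e i = 0 -> forall i, c i = 0) /\
    range F = range (fun c : 'I_n -> C => \sum_i c i *: e i).

Section InnerProduct.
Variable ip : H -> H -> C.

(* The graph of [T] is the graph of its adjoint. *)
Definition self_adjoint (T : operator) : Prop :=
  [/\ linear_operator T, dense (odom T)
    & forall v w, (forall u, odom T u -> ip (T u) v = ip u w) <->
                  (odom T v /\ T v = w)].

(* [S] is the nonnegative self-adjoint operator with [S S = A], domains
   included. *)
Definition is_sqrt (A S : operator) : Prop :=
  [/\ self_adjoint S, forall u, odom S u -> 0 <= ip (S u) u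
    & forall u w, (odom A u /\ A u = w) <->
                  [/\ odom S u, odom S (S u) & S (S u) = w]].

(* The sequence is indexed from 1; [psi 0] is irrelevant. *)
Definition orthonormal_basis (psi : nat -> H) : Prop :=
  (forall m n, (0 < m)%N -> (0 < n)%N -> ip (psi m) (psi n) = (m == n)%:R) /\
  (forall x, (fun n => \sum_(1 <= k < n.+1) ip x (psi k) *: psi k) @ \oo --> x).

(* The numerical range of [T] lies in the sector with vertex [g] and half-angle
   [atan K]. *)
Definition sectorial (T : operator) : Prop :=
  exists g K : R, 0 <= K /\ forall u, odom T u ->
    `|Im (ip (T u) u)| <= K * (Re (ip (T u) u) - g * Re (ip u u)).

(* [T - g] is m-accretive. *)
Definition quasi_m_accretive (T : operator) : Prop :=
  exists g : R, forall z : C, Re z < g ->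
    resolvent_set T z /\
    forall x, `|resolvent T z x| <= ((g - Re z)^-1)%:C * `|x|.

Definition m_sectorial (T : operator) : Prop :=
  [/\ linear_operator T, sectorial T & quasi_m_accretive T].

(* The operator given by the first representation theorem. *)
Definition m_sectorial_operator_of (t : form) (T : operator) : Prop :=
  m_sectorial T /\
  forall u w, (odom T u /\ T u = w) <->
              (fdom t u /\ forall v, fdom t v -> t u v = ip w v).

(* [phi, psi |-> <S phi, S psi>] on the domain of [S]. *)
Definition form_of_sqrt (S : operator) : form :=
  Form (odom S) (fun u v => ip (S u) (S v)).

End InnerProduct.

Definition form_add (a : form) (b : H -> H -> C) : form :=
  Form (fdom a) (fun u v => a u v + b u v).

Definition tagged_partition (a b d : R) (n : nat) (t s : nat -> R) : Prop :=
  [/\ t 0%N = a, t n = b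
    & forall i, (i < n)%N -> [/\ t i <= s i, s i <= t i.+1 & t i.+1 - t i < d]].

(* The path [cpath] on [[0, clen]]. *)
Record contour := Contour { clen : R ; cpath :> R -> C }.

Definition contour_trace (g : contour) : set C := [set g t | t in `[0, clen g]].

(* [J] is the integral of [F z dz] along [g]: the Riemann sums
   [sum_i (g t_(i+1) - g t_i) F (g s_i)] tend to [J] in operator norm as the
   mesh tends to 0. *)
Definition contour_integral (F : C -> H -> H) (g : contour) (J : H -> H) : Prop :=
  forall e : R, 0 < e -> exists2 d : R, 0 < d &
    forall (n : nat) (t s : nat -> R), tagged_partition 0 (clen g) d n t s ->
      forall x, `|\sum_(i < n) (g (t i.+1) - g (t i)) *: F (g (s i)) x - J x|
                <= e%:C * `|x|.

Definition riesz_integral (T : operator) (g : contour) (P : H -> H) : Prop :=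
  exists2 J : H -> H, contour_integral (resolvent T) g J &
    forall x, P x = (0 +i* (2 * pi))^-1 *: J x.

Definition riesz_projection_rank (T : operator) (g : contour) (r : nat) : Prop :=
  contour_trace g `<=` resolvent_set T /\
  exists P : {linear H -> H},
    [/\ continuous P, riesz_integral T g P & has_rank P r].

End Operators.

Arguments operator {R} H.
Arguments form {R} H.
Arguments contour : clear implicits.

Section Regions.
Context {R : realType}.
Local Notation C := R[i].

Definition disc (c r : R) : set C := [set z | cabs (z - c%:C) < r].

Definition circle (c r : R) : contour R :=
  Contour (2 * pi) (fun t => (c + r * cos t) +i* (r * sin t)).

Definition rectangle (x0 x1 y0 y1 : R) : set C :=
  [set z | [/\ x0 < Re z, Re z < x1, y0 < Im z & Im z < y1]].

(* Counterclockwise from the lower left corner, one unit of parameter for each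
   side. *)
Definition rectangle_boundary (x0 x1 y0 y1 : R) : contour R :=
  Contour 4 (fun t =>
    if t <= 1 then (x0 + t * (x1 - x0)) +i* y0
    else if t <= 2 then x1 +i* (y0 + (t - 1) * (y1 - y0))
    else if t <= 3 then (x1 - (t - 2) * (x1 - x0)) +i* y1
    else x0 +i* (y1 - (t - 3) * (y1 - y0))).

(* The right edge [mu N.+1 + 1/2] separates the first [N + 1] eigenvalues from
   the others; it is [N + 3/2] when [mu N.+1 = N.+1], but [N + 3/2] would be
   wrong in general, as the gaps [mu k.+1 - mu k] may exceed 1. *)
Definition Pi0 (mu : nat -> R) (N : nat) (h : R) : set C :=
  rectangle (- h) (mu N.+1 + 2^-1) (- h) h.
Definition Gamma0 (mu : nat -> R) (N : nat) (h : R) : contour R :=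
  rectangle_boundary (- h) (mu N.+1 + 2^-1) (- h) h.

Definition Pij (mu : nat -> R) (k : nat) : set C := disc (mu k) 2^-1.
Definition Gammaj (mu : nat -> R) (k : nat) : contour R := circle (mu k) 2^-1.

Definition Pi_region (mu : nat -> R) (N : nat) (h : R) : set C :=
  Pi0 mu N h `|` \bigcup_(j in [set j | (N.+1 < j)%N]) Pij mu j.

Definition sigma (g : R) (n : nat) : R :=
  if g <= 1 then n%:R `^ (- g) * ln n%:R else n%:R^-1.

Definition tau (g h : R) : R :=
  if g < 1 then h `^ (- g) else if g == 1 then h^-1 * ln h else h^-1.

Definition sigma_constant (mu : nat -> R) (g c : R) : Prop :=
  forall (n : nat) (z : C), (1 < n)%N ->
    mu n - 2^-1 <= Re z -> Re z <= mu n.+1 - 2^-1 -> ~ Pij mu n z ->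
    (\sum_(1 <= k <oo) ((k%:R `^ g * cabs ((mu k)%:C - z))^-1)%:E
       <= (c * sigma g n)%:E)%E.

Definition tau_constant (g c : R) : Prop :=
  forall h : R, 1 < h ->
    (\sum_(1 <= k <oo) ((k%:R `^ g * (k%:R + h))^-1)%:E <= (c * tau g h)%:E)%E.

End Regions.

(* Main.v *)
Require Import Defs.
From HB Require Import structures.
From mathcomp Require Import all_boot all_order all_algebra.
From mathcomp Require Import complex.
From mathcomp Require Import all_classical all_reals all_analysis.
From mathcomp Require Import ring lra.
Import Order.TTheory GRing.Theory Num.Theory.
Import numFieldNormedType.Exports.

Set Implicit Arguments.
Unset Strict Implicit.
Unset Printing Implicit Defensive.

Local Open Scope classical_set_scope.
Local Open Scope complex_scope.
Local Open Scope ring_scope.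

(** The theorem is a perturbation argument in the coordinates of the eigenbasis.

    The bound on [b] makes the perturbation dominated by a rank-one matrix, so
    that everything is governed by the sum of [Mb / (k^(2 alpha) |mu k - z|)] over
    [k].  Outside the region this sum is at most [1 / 2] ([outside_psum]), and
    within distance [1 / 6] of such a point at most [3 / 4]
    ([near_outside_good]).  At these good points the operator [z - A - s B], [B]
    the operator of [b] and [s] in [0, 1], has a bounded inverse [res s z]: between
    two factors [A^(-1/2)] it is a bounded operator, and after a diagonal change of
    variables it becomes [1 - s K] with a Hilbert-Schmidt operator [K] of norm at
    most [3 / 4] ([pencil_surj], [pencil_apriori]).

    Testing the definition of [T] with the eigenvectors shows that
    [u = res 1 z (z u - T u)] for [u] in the domain of [T] ([odom_res]).  This
    excludes eigenvalues at good points.  That, conversely, [res 1 z] maps into the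
    domain of [T] is true far to the left, where [T] has a resolvent, and carries
    over to all good points by the resolvent identity ([res_odom]).

    The integrals of [res s] along a contour exist since the integrand is Lipschitz
    continuous ([rsum_compare], [rsum_cvg]).  They are [2 pi i] times projections
    ([integral_idempotent]): the contour is convex, so that it can be shrunk
    slightly towards its centre; by the resolvent identity the product of the
    integral along the shrunk contour and the one along the contour itself is
    [2 pi i] times the former, as the winding number is 1 of the outer contour
    around the inner one and 0 of the inner contour around the outer one; then
    the shrinking factor tends to 1.  The winding numbers come from branches of the
    logarithm ([rect_winding_inside], [circle_winding_inside],
    [winding_halfplane]).

    The projections depend on [s] in a Lipschitz way, and projections at distance
    less than 1 have the same rank ([rank_close]); hence the rank at [s = 1] is the
    rank at [s = 0] ([integral_rank_invariant]).  At [s = 0] the resolvent is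
    diagonal, and the rank is the number of the [mu k] enclosed by the contour. *)

Local Notation Re := complex.Re.
Local Notation Im := complex.Im.

(** * Absolute values and norms as real numbers *)
Section ComplexAbs.
Context {R : realType}.
Implicit Types (z w : R[i]) (r : R).

Lemma ReD z w : Re (z + w) = Re z + Re w.
Proof. by case: z w => ? ? []. Qed.

Lemma ReB z w : Re (z - w) = Re z - Re w.
Proof. by case: z w => ? ? []. Qed.

Lemma ImB z w : Im (z - w) = Im z - Im w.
Proof. by case: z w => ? ? []. Qed.

Lemma ReZ r z : Re (r%:C * z) = r * Re z.
Proof. by case: z => ? ? /=; rewrite mul0r subr0. Qed.

Lemma normc_cabs z : `|z| = (cabs z)%:C.
Proof. by rewrite /cabs normc_def. Qed.

Lemma cabsE z : cabs z = Num.sqrt (Re z ^+ 2 + Im z ^+ 2).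
Proof. by rewrite /cabs normc_def. Qed.

Lemma cabs_sqr z : cabs z ^+ 2 = Re z ^+ 2 + Im z ^+ 2.
Proof. by rewrite cabsE sqr_sqrtr // addr_ge0 ?sqr_ge0. Qed.

Lemma cabs_ge0 z : 0 <= cabs z.
Proof. by rewrite cabsE sqrtr_ge0. Qed.

Lemma cabs_eq0 z : (cabs z == 0) = (z == 0).
Proof. by rewrite -(normr_eq0 z) normc_cabs eq_complex /= eqxx andbT. Qed.

Lemma cabs0 : cabs (0 : R[i]) = 0.
Proof. by apply/eqP; rewrite cabs_eq0. Qed.

Lemma cabs_gt0 z : (0 < cabs z) = (z != 0).
Proof. by rewrite lt_def cabs_ge0 cabs_eq0 andbT. Qed.

Lemma cabsM z w : cabs (z * w) = cabs z * cabs w.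
Proof. by apply: complexI; rewrite -normc_cabs normrM !normc_cabs -rmorphM. Qed.

Lemma cabsV z : cabs z^-1 = (cabs z)^-1.
Proof. by apply: complexI; rewrite -normc_cabs normfV normc_cabs fmorphV. Qed.

Lemma cabsN z : cabs (- z) = cabs z.
Proof. by rewrite /cabs normrN. Qed.

Lemma cabs_distC z w : cabs (z - w) = cabs (w - z).
Proof. by rewrite /cabs distrC. Qed.

Lemma cabsD z w : cabs (z + w) <= cabs z + cabs w.
Proof. by rewrite -lecR rmorphD /= -!normc_cabs ler_normD. Qed.

Lemma cabs_conj z : cabs z^* = cabs z.
Proof. by apply: complexI; rewrite -!normc_cabs norm_conjC. Qed.

Lemma cabs_real r : cabs r%:C = `|r|.
Proof. by rewrite cabsE /= expr0n addr0 sqrtr_sqr. Qed.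

Lemma cabs_imag r : cabs (0 +i* r) = `|r|.
Proof. by rewrite cabsE /= expr0n add0r sqrtr_sqr. Qed.

Lemma cabs_sum (I : Type) (s : seq I) (P : pred I) (F : I -> R[i]) :
  cabs (\sum_(i <- s | P i) F i) <= \sum_(i <- s | P i) cabs (F i).
Proof.
elim/big_ind2 : _ => [|x1 x2 y1 y2 h1 h2|//]; first by rewrite cabs0.
by rewrite (le_trans (cabsD _ _)) // lerD.
Qed.

Lemma Re_le_cabs z : `|Re z| <= cabs z.
Proof. by rewrite -lecR -normc_cabs normc_ge_Re. Qed.

Lemma Im_le_cabs z : `|Im z| <= cabs z.
Proof.
by rewrite -(sqrtr_sqr (Im z)) cabsE ler_sqrt ?addr_ge0 ?sqr_ge0 // lerDr sqr_ge0.
Qed.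

Lemma cabs_le_ReIm z : cabs z <= `|Re z| + `|Im z|.
Proof.
rewrite -(@ler_pXn2r _ 2) ?nnegrE ?cabs_ge0 ?addr_ge0 // cabs_sqr sqrrD !real_normK ?num_real //.
by rewrite addrAC lerDl mulrn_wge0 // mulr_ge0.
Qed.

Lemma cabs_half_ge z : `|Re z| + `|Im z| <= 2 * cabs z.
Proof. by have := Re_le_cabs z; have := Im_le_cabs z; lra. Qed.

End ComplexAbs.

Lemma le0_over_nat (R : realType) (a d : R) : (forall n, (0 < n)%N -> a <= d / n%:R) -> a <= 0.
Proof.
move=> had; apply/ler_addgt0Pl => e e0; rewrite addr0.
apply: (le_trans (had (Num.trunc (`|d| / e)).+1 isT)).
rewrite ler_pdivrMr ?ltr0n // (le_trans (ler_norm d)) // [leRHS]mulrC -ler_pdivrMr //.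
by rewrite ltW // truncnS_gt.
Qed.

Section VectorNorm.
Context {R : realType} {H : completeNormedModType R[i]}.
Implicit Types (x y : H) (c : R[i]).

(** The real-valued norm; inequalities between complex numbers are awkward, as
    the order on them is only partial. *)
Definition nrm x : R := Re `|x|.

Lemma nrmE x : `|x| = (nrm x)%:C.
Proof.
have : 0 <= `|x| by exact: normr_ge0.
by rewrite lecE /nrm => /andP[/eqP /= h _]; case: `|x| h => a b /= ->.
Qed.

Lemma nrm_ge0 x : 0 <= nrm x.
Proof. by rewrite -lecR -nrmE; exact: normr_ge0. Qed.

Lemma nrm_eq0 x : (nrm x == 0) = (x == 0).
Proof. by rewrite -(normr_eq0 x) nrmE eq_complex /= eqxx andbT. Qed.

Lemma nrm0 : nrm (0 : H) = 0.
Proof. by apply/eqP; rewrite nrm_eq0. Qed.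

Lemma nrm_le0 x : nrm x <= 0 -> x = 0.
Proof.
by move=> h; apply/eqP; rewrite -nrm_eq0 eq_le h nrm_ge0.
Qed.

Lemma nrmN x : nrm (- x) = nrm x.
Proof. by rewrite /nrm normrN. Qed.

Lemma nrm_distC x y : nrm (x - y) = nrm (y - x).
Proof. by rewrite /nrm distrC. Qed.

Lemma nrmD x y : nrm (x + y) <= nrm x + nrm y.
Proof. by rewrite -lecR rmorphD /= -!nrmE ler_normD. Qed.

Lemma nrmB x y : nrm (x - y) <= nrm x + nrm y.
Proof. by rewrite -(nrmN y) nrmD. Qed.

Lemma nrmZ c x : nrm (c *: x) = cabs c * nrm x.
Proof. by apply: complexI; rewrite -nrmE normrZ normc_cabs nrmE -rmorphM. Qed.

Lemma nrm_dist_trans y x z : nrm (x - z) <= nrm (x - y) + nrm (y - z).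
Proof. by rewrite (le_trans _ (nrmD _ _)) // addrA subrK. Qed.

Lemma nrm_dist_transC y x z : nrm (x - z) <= nrm (y - x) + nrm (y - z).
Proof. by rewrite (nrm_distC y x) nrm_dist_trans. Qed.

Lemma nrm_sum (I : Type) (s : seq I) (P : pred I) (F : I -> H) :
  nrm (\sum_(i <- s | P i) F i) <= \sum_(i <- s | P i) nrm (F i).
Proof.
elim/big_ind2 : _ => [|x1 x2 y1 y2 h1 h2|//]; first by rewrite nrm0.
by rewrite (le_trans (nrmD _ _)) // lerD.
Qed.

Lemma nrm_small x : (forall e : R, 0 < e -> nrm x <= e) -> x = 0.
Proof.
move=> h; apply: nrm_le0; apply/ler_addgt0Pl => e e0.
by rewrite addr0; exact: h.
Qed.

Lemma cvg_nrm (v : nat -> H) x : v @ \oo --> x ->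
  forall e : R, 0 < e -> exists m, forall n, (m <= n)%N -> nrm (v n - x) <= e.
Proof.
move=> /cvgrPdist_le h e e0.
have /h [m _ hm] : 0 < e%:C by rewrite ltcR.
by exists m => n mn; rewrite -lecR -nrmE distrC; exact: hm.
Qed.

(** Completeness with an explicit modulus [e], which is inherited by the limit. *)
Lemma complete_lim (v : nat -> H) (e : nat -> R) :
  (forall n m, (n <= m)%N -> nrm (v m - v n) <= e n) ->
  (forall d : R, 0 < d -> exists n, e n <= d) ->
  exists x, forall n, nrm (v n - x) <= e n.
Proof.
move=> hv he.
have : cauchy (v @ \oo).
  apply/cauchy_exP => d d0.
  have dR : d = (Re d)%:C.
    by move: d0; rewrite ltcE => /andP[/eqP /= h _]; case: d h => a b /= ->.
  have d1 : 0 < Re d by rewrite -ltcR -dR.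
  have d0' : 0 < Re d / 2 by rewrite divr_gt0.
  have [n hn] := he _ d0'.
  exists (v n); exists n => // m /= nm.
  rewrite -ball_normE /= distrC nrmE dR ltcR.
  by have := hv _ _ nm; lra.
move/cauchy_cvgP/cvg_ex => [x /= hx]; exists x => n.
apply/ler_addgt0Pl => d d0.
have [m hm] := cvg_nrm hx d0.
have := hm (maxn n m) (leq_maxr _ _).
have := hv n (maxn n m) (leq_maxl _ _).
have := nrm_dist_transC (v (maxn n m)) (v n) x.
by move=> h1 h2 h3; lra.
Qed.

End VectorNorm.

(** * Riemann sums along Lipschitz paths *)
Section RiemannSums.
Context {R : realType} {H : completeNormedModType R[i]}.
Implicit Types (g : R -> R[i]) (f : R -> H) (t s : nat -> R).

Definition rsum g f n t s : H :=
  \sum_(i < n) (g (t i.+1) - g (t i)) *: f (s i).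

Definition lipschitz_path g (L B : R) : Prop := forall a b,
  0 <= a <= L -> 0 <= b <= L -> cabs (g a - g b) <= B * `|a - b|.

Definition lipschitz_curve f (L A : R) : Prop := forall a b,
  0 <= a <= L -> 0 <= b <= L -> nrm (f a - f b) <= A * `|a - b|.

Lemma partition_bounds (L d : R) n t s : tagged_partition 0 L d n t s ->
  forall i, (i <= n)%N -> 0 <= t i <= L.
Proof.
case=> t0 tn h.
have mono i : (i < n)%N -> t i <= t i.+1 by case/h => *; lra.
have lo i : (i <= n)%N -> 0 <= t i.
  elim: i => [|i ih] hi; first by rewrite t0.
  by rewrite (le_trans (ih (ltnW hi))) // mono.
have hi k : (k <= n)%N -> t (n - k)%N <= L.
  elim: k => [|k ih] hk; first by rewrite subn0 tn.
  apply: le_trans (ih (ltnW hk)).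
  have -> : (n - k = (n - k.+1).+1)%N by rewrite subnS prednK // subn_gt0.
  by apply: mono; rewrite ltn_subrL (leq_ltn_trans _ hk).
move=> i le_in; rewrite lo //=.
by have := hi (n - i)%N; rewrite subKn //; apply; rewrite leq_subr.
Qed.

Lemma tag_bounds (L d : R) n t s : tagged_partition 0 L d n t s ->
  forall i, (i < n)%N -> 0 <= s i <= L.
Proof.
move=> tp i lt_in; have b1 := partition_bounds tp (ltnW lt_in).
have b2 := partition_bounds tp lt_in; case: tp => _ _ /(_ _ lt_in) [? ? ?].
by apply/andP; split; lra.
Qed.

Section Compare.
Variables (g : R -> R[i]) (f : R -> H) (L A B : R).
Hypothesis (B0 : 0 <= B) (gB : lipschitz_path g L B).
Hypothesis (A0 : 0 <= A) (fA : lipschitz_curve f L A).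

(** Both sums are rewritten over the common refinement without naming it: the
    increment of [g] over the intersection of the [i]-th interval of the first
    partition with the [j]-th interval of the second one is the mixed second
    difference of [g (min (t i) (t' j))], which telescopes in [i] and in [j]
    and vanishes when the intervals do not meet. *)
Lemma rsum_compare (d d' : R) n n' t s t' s' :
  tagged_partition 0 L d n t s -> tagged_partition 0 L d' n' t' s' ->
  nrm (rsum g f n t s - rsum g f n' t' s') <= A * B * L * (d + d').
Proof.
move=> tp tp'.
pose mixed (V : zmodType) (G : R -> V) i j :=
  (G (Num.min (t i.+1) (t' j.+1)) - G (Num.min (t i.+1) (t' j))) -
  (G (Num.min (t i) (t' j.+1)) - G (Num.min (t i) (t' j))).
have [t0 tn tpi] := tp; have [t0' tn' tpj] := tp'.
have tb := partition_bounds tp; have tb' := partition_bounds tp'.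
have sumj (V : zmodType) (G : R -> V) i : (i < n)%N ->
    \sum_(j < n') mixed V G i j = G (t i.+1) - G (t i).
  move=> hi; rewrite /mixed big_split sumrN /=.
  rewrite -!(big_mkord xpredT (fun j => G (Num.min _ (t' j.+1)) - G (Num.min _ (t' j)))) /=.
  rewrite !(@telescope_sumr _ 0 n' (fun j => G (Num.min _ (t' j)))) // tn' t0'.
  have /andP[? ?] := tb _ hi; have /andP[? ?] := tb _ (ltnW hi).
  by rewrite !(@min_l _ _ _ L) // !(@min_r _ _ _ 0) // opprB addrA subrK.
have sumi (V : zmodType) (G : R -> V) j : (j < n')%N ->
    \sum_(i < n) mixed V G i j = G (t' j.+1) - G (t' j).
  move=> hj.
  have swap (x y u w : V) : (x - y) - (u - w) = (x - u) - (y - w).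
    by rewrite !opprB addrACA [RHS]addrACA (addrC (- y)).
  under eq_bigr do rewrite /mixed swap.
  rewrite big_split sumrN /=.
  rewrite -!(big_mkord xpredT (fun i => G (Num.min (t i.+1) _) - G (Num.min (t i) _))) /=.
  rewrite !(@telescope_sumr _ 0 n (fun i => G (Num.min (t i) _))) // tn t0.
  have /andP[? ?] := tb' _ hj; have /andP[? ?] := tb' _ (ltnW hj).
  by rewrite !(@min_r _ _ L) // !(@min_l _ _ 0) // opprB addrA subrK.
have -> : rsum g f n t s - rsum g f n' t' s' =
    \sum_(i < n) \sum_(j < n') mixed _ g i j *: (f (s i) - f (s' j)).
  have -> : rsum g f n t s =
      \sum_(i < n) \sum_(j < n') mixed _ g i j *: f (s i).
    by apply: eq_bigr => i _; rewrite -scaler_suml sumj.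
  have -> : rsum g f n' t' s' =
      \sum_(i < n) \sum_(j < n') mixed _ g i j *: f (s' j).
    rewrite exchange_big /=.
    by apply: eq_bigr => i _; rewrite -scaler_suml sumi.
  rewrite -sumrB; apply: eq_bigr => i _; rewrite -sumrB; apply: eq_bigr => j _.
  by rewrite scalerBr.
have -> : A * B * L * (d + d') =
    \sum_(i < n) \sum_(j < n') A * B * (d + d') * mixed R id i j.
  under eq_bigr => i _.
    by rewrite -mulr_sumr sumj //; over.
  rewrite -mulr_sumr -(big_mkord xpredT (fun i => id (t i.+1) - id (t i))).
  by rewrite telescope_sumr // tn t0 subr0; ring.
apply: (le_trans (nrm_sum _ _ _)); apply: ler_sum => i _.
apply: (le_trans (nrm_sum _ _ _)); apply: ler_sum => j _.
have [ti1 ti2 ti3] := tpi _ (ltn_ord i); have [tj1 tj2 tj3] := tpj _ (ltn_ord j).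
have bi := tb _ (ltn_ord i); have bi' := tb _ (ltnW (ltn_ord i)).
have bj := tb' _ (ltn_ord j); have bj' := tb' _ (ltnW (ltn_ord j)).
clear sumi sumj; rewrite /mixed; clear mixed.
have bsi := tag_bounds tp (ltn_ord i); have bsj := tag_bounds tp' (ltn_ord j).
move: (t i) (t i.+1) (s i) (t' j) (t' j.+1) (s' j) ti1 ti2 ti3 tj1 tj2 tj3
  bi bi' bj bj' bsi bsj => /= a a' p b b' q.
move=> h1 h2 h3 h4 h5 h6 bi bi' bj bj' bsi bsj.
have [h|ba] := leP a' b.
  rewrite !min_l; [|lra..].
  by rewrite !subrr scale0r nrm0 mulr0.
have [h|ab] := leP b' a.
  rewrite !min_r; [|lra..].
  by rewrite !subrr scale0r nrm0 mulr0.
set P := Num.min a' b'.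
have Pab : a <= P /\ b <= P by rewrite /P !le_min; split; apply/andP; split; lra.
have bP : 0 <= P <= L by apply/andP; rewrite /P; case: (leP a' b') => ?; split; lra.
rewrite nrmZ.
have hf : nrm (f p - f q) <= A * (d + d').
  apply: (le_trans (fA bsi bsj)); rewrite ler_wpM2l // ler_norml.
  by apply/andP; split; lra.
have key c : 0 <= c <= L -> c <= P ->
    cabs (g P - g c) * nrm (f p - f q) <= A * B * (d + d') * (P - c).
  move=> bc cP; have := gB bP bc; rewrite ger0_norm ?subr_ge0 // => hg.
  apply: (le_trans (ler_pM (cabs_ge0 _) (nrm_ge0 _) hg hf)).
  by rewrite le_eqVlt; apply/orP; left; apply/eqP; ring.
case: (leP a b) => hab.
  by rewrite !subrr !subr0; apply: key; tauto.
rewrite (_ : g P - _ - _ = g P - g a); last by ring.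
by rewrite (_ : P - b - _ = P - a); [apply: key; tauto | ring].
Qed.

Definition upt n (i : nat) : R := L * i%:R / n%:R.

Lemma upt_partition (d : R) n : 0 <= L -> (0 < n)%N -> L / n%:R < d ->
  tagged_partition 0 L d n (upt n) (upt n).
Proof.
move=> L0 n0 hd; have nR : 0 < n%:R :> R by rewrite ltr0n.
split; rewrite /upt ?mulr0 ?mul0r ?mulfK ?gt_eqF // => i _.
have e : L * i.+1%:R / n%:R = L * i%:R / n%:R + L / n%:R.
  by rewrite -natr1 mulrDr mulr1 mulrDl.
have q0 : 0 <= L / n%:R by rewrite divr_ge0 // ltW.
by rewrite e; split; lra.
Qed.

(** By [rsum_compare] the sums over uniform partitions form a Cauchy sequence, and
    every other sum is close to them. *)
Lemma rsum_cvg : 0 <= L -> exists J, forall (d : R) n t s,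
  tagged_partition 0 L d n t s -> nrm (rsum g f n t s - J) <= A * B * L * d.
Proof.
move=> L0; pose K := A * B * L.
have K0 : 0 <= K by rewrite !mulr_ge0.
pose m k : R := (L + 1) / k.+1%:R.
have mp k : tagged_partition 0 L (m k) k.+1 (upt k.+1) (upt k.+1).
  by apply: upt_partition => //; rewrite ltr_pM2r ?invr_gt0 ?ltr0n //; lra.
have m_small (e : R) : 0 < e -> exists k, m k <= e.
  move=> e0; exists (Num.trunc ((L + 1) / e)).
  rewrite /m ler_pdivrMr ?ltr0n // mulrC -ler_pdivrMr //.
  by rewrite ltW // truncnS_gt.
pose v k := rsum g f k.+1 (upt k.+1) (upt k.+1).
have m_mono j k : (j <= k)%N -> m k <= m j.
  by move=> jk; rewrite /m ler_wpM2l ?lef_pV2 ?posrE ?ltr0n ?ler_nat //; lra.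
have [J hJ] : exists J, forall k, nrm (v k - J) <= K * (2 * m k).
  apply: complete_lim => [j k jk|e e0].
    apply: (le_trans (rsum_compare (mp k) (mp j))); rewrite -/K ler_wpM2l //.
    by have := m_mono _ _ jk; lra.
  have e1 : 0 < e / (2 * (K + 1)) by rewrite divr_gt0 //; lra.
  have [k hk] := m_small _ e1; exists k.
  move: hk; rewrite ler_pdivlMr; last by lra.
  by have : 0 <= m k by [rewrite divr_ge0 //; lra]; nra.
exists J => d n t s tp; apply/ler_addgt0Pl => e e0.
have e1 : 0 < e / (3 * (K + 1)) by rewrite divr_gt0 //; lra.
have [k hk] := m_small _ e1.
have h1 := rsum_compare tp (mp k); have h2 := hJ k.
have h3 := nrm_dist_trans (v k) (rsum g f n t s) J.
have h4 : 3 * (K + 1) * m k <= e.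
  by move: hk; rewrite ler_pdivlMr; [rewrite mulrC | lra].
have m0 : 0 <= m k by rewrite divr_ge0 //; lra.
move: h1; rewrite -/K -/(v k) => h1; nra.
Qed.

End Compare.

End RiemannSums.

(** * Close projections have the same rank *)
Section RankOfProjections.
Context {R : realType} {H : completeNormedModType R[i]}.
Implicit Types (F P Q : H -> H).

Lemma linear_fun0 F : linear F -> F 0 = 0.
Proof. by move=> l; have := l (-1) 0 0; rewrite !scaleN1r oppr0 addr0 addNr. Qed.

Lemma linear_funZ F c x : linear F -> F (c *: x) = c *: F x.
Proof. by move=> l; have := l c x 0; rewrite !addr0 linear_fun0 // addr0. Qed.

Lemma linear_funD F x y : linear F -> F (x + y) = F x + F y.
Proof. by move=> l; have := l 1 x y; rewrite !scale1r. Qed.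

Lemma linear_funB F x y : linear F -> F (x - y) = F x - F y.
Proof.
by move=> l; rewrite -scaleN1r linear_funD // linear_funZ // scaleN1r.
Qed.

Lemma linear_fun_sum F (I : Type) (s : seq I) (p : pred I) (u : I -> H) :
  linear F -> F (\sum_(i <- s | p i) u i) = \sum_(i <- s | p i) F (u i).
Proof.
move=> l; elim/big_rec2 : _ => [|i x y _ <-]; first exact: linear_fun0.
exact: linear_funD.
Qed.

Lemma bounded_continuous (F : H -> H) (K : R) : linear F ->
  (forall x, nrm (F x) <= K * nrm x) -> continuous F.
Proof.
move=> lF bF x; apply/cvgrPdist_le => e e0.
have eR : e = (Re e)%:C.
  by move: e0; rewrite ltcE => /andP[/eqP /= h _]; case: e h => a c /= ->.
have e1 : 0 < Re e by rewrite -ltcR -eR.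
have K0 : 0 < `|K| + 1 by rewrite ltr_wpDl.
have d0 : 0 < Re e / (`|K| + 1) by rewrite divr_gt0.
apply/nbhs_ballP; exists (Re e / (`|K| + 1))%:C; first by rewrite /= ltcR.
move=> y; rewrite -ball_normE /= nrmE ltcR => hy.
rewrite eR nrmE lecR -linear_funB //; apply: (le_trans (bF _)).
move: hy; rewrite ltr_pdivlMr // => hy; apply: le_trans (ltW hy).
rewrite mulrC ler_wpM2l ?nrm_ge0 //; have := ler_norm K; lra.
Qed.

Lemma contraction_eq0 (q : R) (x : H) : q < 1 -> nrm x <= q * nrm x -> x = 0.
Proof. by move=> q1 h; apply: nrm_le0; have := nrm_ge0 x; nra. Qed.

(** [Q] is injective on the range of [P], since [P x = x] and [Q x = 0] give
    [|x| = |P x - Q x| <= q |x|]; in the same way [P] is injective on the range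
    of [Q].  The matrix of [P Q] on a basis of the range of [P] is therefore
    invertible, and [Q] maps that basis to a basis of its own range. *)
Lemma rank_close P Q (q : R) n : linear P -> linear Q ->
  (forall x, P (P x) = P x) -> (forall x, Q (Q x) = Q x) ->
  q < 1 -> (forall x, nrm (P x - Q x) <= q * nrm x) ->
  has_rank P n -> has_rank Q n.
Proof.
move=> lP lQ PP QQ q1 PQ [e [e_free e_range]].
have PfixE x : range P x -> P x = x by case=> u _ <-.
have QfixE x : range Q x -> Q x = x by case=> u _ <-.
have Pinj x : range Q x -> P x = 0 -> x = 0.
  move=> /QfixE Qx Px; apply: (contraction_eq0 q1).
  by have := PQ x; rewrite Px Qx sub0r nrmN.
have Qinj x : range P x -> Q x = 0 -> x = 0.
  move=> /PfixE Px Qx; apply: (contraction_eq0 q1).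
  by have := PQ x; rewrite Px Qx subr0.
have in_rangeP c : range P (\sum_i c i *: e i) by rewrite e_range; exists c.
have sumQ c : \sum_i c i *: Q (e i) = Q (\sum_i c i *: e i).
  by rewrite linear_fun_sum //; apply: eq_bigr => i _; rewrite linear_funZ.
have f_free c : \sum_i c i *: Q (e i) = 0 -> forall i, c i = 0.
  by rewrite sumQ => /Qinj h; apply: e_free; apply: h.
have /boolp.choice [m Em] (i : 'I_n) :
    exists c : 'I_n -> R[i], P (Q (e i)) = \sum_j c j *: e j.
  have : range P (P (Q (e i))) by exists (Q (e i)).
  by rewrite e_range => -[c _ <-]; exists c.
pose M := \matrix_(i, j) m i j.
have sumPQ (c : 'rV_n) :
    P (\sum_i c 0 i *: Q (e i)) = \sum_j (c *m M) 0 j *: e j.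
  rewrite linear_fun_sum //.
  under eq_bigr => i _ do rewrite linear_funZ // Em scaler_sumr.
  rewrite exchange_big /=; apply: eq_bigr => j _.
  by rewrite mxE scaler_suml; apply: eq_bigr => i _; rewrite mxE scalerA.
have Munit : M \in unitmx.
  rewrite -row_free_unit; apply: inj_row_free => v vM.
  have : \sum_i v 0 i *: Q (e i) = 0.
    apply: Pinj; first by rewrite sumQ; eexists.
    by rewrite sumPQ vM big1 // => i _; rewrite mxE scale0r.
  by move=> /f_free v0; apply/rowP => i; rewrite v0 mxE.
exists (fun i => Q (e i)); split => //.
apply/seteqP; split => [y Qy|y [c _ <-]]; last by rewrite sumQ; eexists.
have : range P (P y) by exists y.
rewrite e_range => -[a _ Ea].
pose c := (\row_j a j) *m invmx M.
exists (fun i => c 0 i) => //; apply/esym/eqP; rewrite -subr_eq0; apply/eqP.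
apply: Pinj.
  exists (y - \sum_i c 0 i *: e i) => //.
  by rewrite linear_funB // QfixE // -sumQ.
rewrite linear_funB // sumPQ -Ea mulmxKV // -sumrB big1 // => i _.
by rewrite mxE subrr.
Qed.

End RankOfProjections.

(** * Riemann sums over uniform partitions *)

Section RieszIntegral.
Context {R : realType} {H : completeNormedModType R[i]}.
Implicit Types (F : R[i] -> H -> H) (J : H -> H).

Lemma nrm_over_nat (a : R) (x : H) :
  (forall n, (0 < n)%N -> nrm x <= a / n%:R) -> x = 0.
Proof. by move=> h; apply/nrm_le0/le0_over_nat/h. Qed.

(** Once an integral is known to exist, these sums are enough to compute with it. *)
Definition usum (g : R -> R[i]) (L : R) F n (x : H) : H :=
  rsum g (fun t => F (g t) x) n (upt L n) (upt L n).

Definition usum_cvg g (L : R) F J (K : R) : Prop := forall n x, (0 < n)%N ->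
  nrm (usum g L F n x - J x) <= K / n%:R * nrm x.

(** Quantitative form, along uniform partitions, of the statement that the
    integral of [dz / (z - w)] along [g] is [W]. *)
Definition winding (g : R -> R[i]) (L : R) (w W : R[i]) (K : R) : Prop :=
  forall n, (0 < n)%N ->
  cabs (\sum_(i < n) (g (upt L n i.+1) - g (upt L n i)) /
                     (g (upt L n i) - w) - W) <= K / n%:R.

Lemma upt_bounds (L : R) n i : 0 <= L -> (i <= n)%N -> 0 <= upt L n i <= L.
Proof.
move=> L0; case: n => [|n] hi.
  by rewrite /upt invr0 mulr0 lexx.
rewrite /upt divr_ge0 ?mulr_ge0 //= ler_pdivrMr ?ltr0n //.
by rewrite ler_wpM2l // ler_nat.
Qed.

Section Path.
Variables (g : R -> R[i]) (L B : R).
Hypotheses (L0 : 0 <= L) (B0 : 0 <= B) (gB : lipschitz_path g L B).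

Lemma path_variation n :
  \sum_(i < n) cabs (g (upt L n i.+1) - g (upt L n i)) <= B * L.
Proof.
case: n => [|n]; first by rewrite big_ord0 mulr_ge0.
have -> : B * L = \sum_(i < n.+1) B * (L / n.+1%:R).
  by rewrite sumr_const card_ord -[RHS]mulr_natr -mulrA divfK // pnatr_eq0.
apply: ler_sum => i _.
apply: (le_trans (gB _ _)); rewrite ?upt_bounds // 1?ltnW //.
rewrite ler_wpM2l // /upt -mulrBl -mulrBr -natr1 addrAC subrr add0r mulr1.
by rewrite ger0_norm // divr_ge0.
Qed.

Lemma weighted_sum_le (f : nat -> H) (a : R) n : (0 < n)%N ->
  (forall i, (i < n)%N -> nrm (f i) <= a) ->
  nrm (\sum_(i < n) (g (upt L n i.+1) - g (upt L n i)) *: f i) <= B * L * a.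
Proof.
case: n => // n _ ha; apply: (le_trans (nrm_sum _ _ _)).
have a0 : 0 <= a by apply: le_trans (ha 0%N isT); exact: nrm_ge0.
apply: (@le_trans _ _ (\sum_(i < n.+1) cabs (g (upt L n.+1 i.+1) - g (upt L n.+1 i)) * a)).
  by apply: ler_sum => i _; rewrite nrmZ ler_wpM2l ?cabs_ge0 // ha.
by rewrite -mulr_suml ler_wpM2r // path_variation.
Qed.

End Path.

End RieszIntegral.

(** * Contour integrals of resolvents are multiples of projections *)
Section PseudoResolvents.
Context {R : realType} {H : completeNormedModType R[i]}.
Implicit Types (F : R[i] -> H -> H) (J : H -> H).

(** All that the integration theory needs to know of the resolvent of an operator;
    by the last clause the family is Lipschitz continuous on [Z]. *)
Definition pseudo_resolvent (Z : set R[i]) F (K : R) : Prop :=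
  [/\ forall z, Z z -> linear (F z),
      forall z x, Z z -> nrm (F z x) <= K * nrm x
    & forall z w x, Z z -> Z w -> F z x - F w x = (w - z) *: F z (F w x)].

(** The homothety of centre [c]: for a convex contour around [c] and [r < 1], the
    image lies strictly inside the contour. *)
Definition shrink (c : R[i]) (r : R) (g : R -> R[i]) (t : R) : R[i] :=
  c + r%:C * (g t - c).

Lemma shrink1 c g : shrink c 1 g = g.
Proof. by apply/funext => t; rewrite /shrink mul1r addrC subrK. Qed.

Section OnePath.
Variables (Z : set R[i]) (F : R[i] -> H -> H) (K : R).
Hypotheses (K0 : 0 <= K) (FK : pseudo_resolvent Z F K).
Variables (g : R -> R[i]) (L B : R).
Hypotheses (L0 : 0 <= L) (B0 : 0 <= B) (gB : lipschitz_path g L B).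
Hypothesis (gZ : forall t, 0 <= t <= L -> Z (g t)).

Lemma pseudo_resolvent_lip z w x : Z z -> Z w ->
  nrm (F z x - F w x) <= K ^+ 2 * cabs (w - z) * nrm x.
Proof.
move=> hz hw; have [_ bd id] := FK; rewrite id // nrmZ.
have h1 := bd z (F w x) hz; have h2 := bd w x hw.
have h3 : nrm (F z (F w x)) <= K ^+ 2 * nrm x.
  by rewrite (le_trans h1) // expr2 -mulrA ler_wpM2l.
rewrite mulrAC mulrC; apply: ler_wpM2r h3; exact: cabs_ge0.
Qed.

Lemma resolvent_integral_exists : exists J : H -> H,
  forall (d : R) n t s, tagged_partition 0 L d n t s -> forall x,
  nrm (rsum g (fun t => F (g t) x) n t s - J x) <= B ^+ 2 * K ^+ 2 * L * d * nrm x.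
Proof.
have /boolp.choice [J hJ] x : exists y : H, forall (d : R) n t s,
    tagged_partition 0 L d n t s ->
    nrm (rsum g (fun t => F (g t) x) n t s - y) <= K ^+ 2 * B * nrm x * B * L * d.
  apply: rsum_cvg => //; first by rewrite !mulr_ge0 ?exprn_ge0 ?nrm_ge0.
  move=> a b ha hb; apply: (le_trans (pseudo_resolvent_lip _ (gZ ha) (gZ hb))).
  rewrite [leRHS](_ : _ = K ^+ 2 * (B * `|a - b|) * nrm x); last by ring.
  by rewrite ler_wpM2r ?nrm_ge0 // ler_wpM2l ?exprn_ge0 // distrC; exact: gB.
exists J => d n t s tp x; apply: (le_trans (hJ x d n t s tp)).
by rewrite le_eqVlt; apply/orP; left; apply/eqP; ring.
Qed.

Lemma integral_usum_cvg J (M : R) : (forall (d : R) n t s,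
    tagged_partition 0 L d n t s -> forall x,
    nrm (rsum g (fun t => F (g t) x) n t s - J x) <= M * d * nrm x) ->
  usum_cvg g L F J (M * (L + 1)).
Proof.
move=> h n x n0; have n0R : 0 < n%:R :> R by rewrite ltr0n.
rewrite -[M * _ / _]mulrA; apply: h; apply: upt_partition => //.
by rewrite ltr_pM2r ?invr_gt0 //; lra.
Qed.

Lemma usum_linear n : linear (usum g L F n).
Proof.
move=> c u v; rewrite /usum /rsum scaler_sumr -big_split /=.
apply: eq_bigr => i _; have [lin _ _] := FK.
by rewrite lin ?scalerDr ?scalerA 1?mulrC //; apply/gZ/upt_bounds => //; exact: ltnW.
Qed.

Lemma usum_le n x : (0 < n)%N -> nrm (usum g L F n x) <= B * L * K * nrm x.
Proof.
move=> n0; rewrite -[B * L * K * _]mulrA; apply: (@weighted_sum_le _ _ _ _ _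
  L0 B0 gB (fun i => F (g (upt L n i)) x)) => //.
move=> i hi; have [_ bd _] := FK; apply/bd/gZ/upt_bounds => //; exact: ltnW.
Qed.

Section Limit.
Variables (J : H -> H) (K1 : R).
Hypothesis (FJ : usum_cvg g L F J K1).

Lemma integral_linear : linear J.
Proof.
move=> c u v; apply/eqP; rewrite -subr_eq0; apply/eqP.
apply: (@nrm_over_nat _ _ (K1 * (nrm (c *: u + v) + cabs c * nrm u + nrm v))) => n n0.
have h1 := FJ (c *: u + v) n0; have h2 := FJ u n0; have h3 := FJ v n0.
have h4 := nrmD (c *: (usum g L F n u - J u)) (usum g L F n v - J v).
rewrite nrmZ scalerBr addrACA -opprD -usum_linear in h4.
have h5 := ler_wpM2l (cabs_ge0 c) h2.
have h6 := nrm_dist_transC (usum g L F n (c *: u + v)) (J (c *: u + v)) (c *: J u + J v).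
rewrite (_ : _ / _ = K1 / n%:R * nrm (c *: u + v) +
  cabs c * (K1 / n%:R * nrm u) + K1 / n%:R * nrm v); last by ring.
lra.
Qed.

Lemma integral_le x : nrm (J x) <= B * L * K * nrm x.
Proof.
apply/ler_addgt0Pl => e e0.
pose n := (Num.trunc (K1 * nrm x / e)).+1.
have h1 := FJ x (isT : (0 < n)%N); have h2 := usum_le x (isT : (0 < n)%N).
have h3 : K1 / n%:R * nrm x <= e.
  rewrite mulrAC ler_pdivrMr ?ltr0n // [leRHS]mulrC -ler_pdivrMr //.
  by rewrite ltW // /n truncnS_gt.
have h4 := nrmB (usum g L F n x) (usum g L F n x - J x).
rewrite opprB addrC subrK in h4.
lra.
Qed.
End Limit.

End OnePath.

Section Idempotent.
Variables (Z : set R[i]) (F : R[i] -> H -> H) (K : R).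
Hypotheses (K0 : 0 <= K) (FK : pseudo_resolvent Z F K).
Variables (g : R -> R[i]) (L B : R).
Hypotheses (L0 : 0 <= L) (B0 : 0 <= B) (gB : lipschitz_path g L B).

Lemma lipschitz_shrink c (r : R) : 0 <= r <= 1 -> lipschitz_path (shrink c r g) L B.
Proof.
move=> /andP[r0 r1] a b ha hb.
rewrite /shrink (_ : _ - _ = r%:C * (g a - g b)); last by ring.
rewrite cabsM cabs_real ger0_norm //.
by have := gB ha hb; have := cabs_ge0 (g a - g b); nra.
Qed.

(** The first resolvent identity splits each term [F w (F z x)] of the double
    Riemann sum into [F w x] and [F z x], both divided by [z - w]; the inner
    sums of [1 / (z - w)] then converge to the winding number of the outer
    path around [w], and to that of the inner path around [z]. *)
Lemma integral_nested (g' : R -> R[i]) (W : R[i]) (K' K1 K2 : R) (J J' : H -> H) :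
  lipschitz_path g' L B ->
  (forall t, 0 <= t <= L -> Z (g t)) -> (forall t, 0 <= t <= L -> Z (g' t)) ->
  (forall t t', 0 <= t <= L -> 0 <= t' <= L -> g t != g' t') ->
  (forall t, 0 <= t <= L -> winding g L (g' t) W K') ->
  (forall t, 0 <= t <= L -> winding g' L (g t) 0 K') ->
  usum_cvg g L F J K1 -> usum_cvg g' L F J' K2 ->
  forall x, J' (J x) = W *: J' x.
Proof.
move=> g'B gZ g'Z gg' wg wg' FJ FJ' x.
have [lin bd id] := FK.
have nested n : (0 < n)%N ->
    nrm (usum g' L F n (usum g L F n x) - W *: usum g' L F n x) <=
    2 * (B * L * (K' / n%:R * (K * nrm x))).
  move=> n0.
  pose z i := g (upt L n i); pose w i := g' (upt L n i).
  have bz i : (i < n)%N -> 0 <= upt L n i <= L.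
    by move=> hi; apply: upt_bounds => //; exact: ltnW.
  pose S1 i := \sum_(k < n) (z k.+1 - z k) / (z k - w i).
  pose S2 k := \sum_(i < n) (w i.+1 - w i) / (w i - z k).
  have -> : usum g' L F n (usum g L F n x) - W *: usum g' L F n x =
      \sum_(i < n) (w i.+1 - w i) *: ((S1 i - W) *: F (w i) x) +
      \sum_(k < n) (z k.+1 - z k) *: (S2 k *: F (z k) x).
    have -> : usum g' L F n (usum g L F n x) =
        \sum_(i < n) \sum_(k < n) ((w i.+1 - w i) * (z k.+1 - z k)) *:
           ((z k - w i)^-1 *: (F (w i) x - F (z k) x)).
      apply: eq_bigr => i _; rewrite -/(w i) -/(w i.+1).
      have wZ : Z (w i) by apply/g'Z/bz.
      rewrite linear_fun_sum; last exact: lin.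
      rewrite scaler_sumr; apply: eq_bigr => k _; rewrite -/(z k) -/(z k.+1).
      have zZ : Z (z k) by apply/gZ/bz.
      rewrite linear_funZ; last exact: lin.
      rewrite id // scalerA [X in _ = _ *: X]scalerA mulVf ?scale1r // subr_eq0.
      by apply: gg'; exact: bz.
    have -> : W *: usum g' L F n x = \sum_(i < n) (w i.+1 - w i) *: (W *: F (w i) x).
      rewrite scaler_sumr; apply: eq_bigr => i _.
      by rewrite !scalerA mulrC.
    have -> : \sum_(k < n) (z k.+1 - z k) *: (S2 k *: F (z k) x) =
       - \sum_(i < n) \sum_(k < n) ((w i.+1 - w i) * (z k.+1 - z k)) *:
           ((z k - w i)^-1 *: F (z k) x).
      rewrite exchange_big -sumrN; apply: eq_bigr => k _.
      rewrite /S2 scaler_suml scaler_sumr -sumrN; apply: eq_bigr => i _.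
      rewrite !scalerA -scaleNr; congr (_ *: _).
      by rewrite -(opprB (w i) (z k)) invrN; ring.
    rewrite -!sumrN -!big_split /=; apply: eq_bigr => i _.
    rewrite (scalerBl (S1 i)) [X in _ = X - _]scalerBr [RHS]addrAC; congr (_ - _).
    rewrite /S1 scaler_suml scaler_sumr -sumrB; apply: eq_bigr => k _.
    by rewrite !scalerBr; congr (_ - _); rewrite !scalerA; congr (_ *: _); ring.
  apply: (le_trans (nrmD _ _)); rewrite mulr_natl mulr2n; apply: lerD.
    apply: (@weighted_sum_le _ _ _ _ _ L0 B0 g'B (fun i => (S1 i - W) *: F (w i) x)) => // i hi.
    rewrite nrmZ; apply: ler_pM (cabs_ge0 _) (nrm_ge0 _) _ _.
      exact: (wg _ (bz _ hi)).
    by apply/bd/g'Z/bz.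
  apply: (@weighted_sum_le _ _ _ _ _ L0 B0 gB (fun i => S2 i *: F (z i) x)) => // i hi.
  rewrite nrmZ; apply: ler_pM (cabs_ge0 _) (nrm_ge0 _) _ _.
    by have := wg' _ (bz _ hi) _ n0; rewrite subr0.
  by apply/bd/gZ/bz.
apply/eqP; rewrite -subr_eq0; apply/eqP.
pose BLK := B * L * K.
apply: (@nrm_over_nat _ _ (K2 * nrm (J x) + BLK * (K1 * nrm x) +
    2 * (B * L * (K' * (K * nrm x))) + cabs W * (K2 * nrm x))) => n n0.
pose U := usum g L F n; pose U' := usum g' L F n.
have h1 : nrm (U' (J x) - J' (J x)) <= K2 / n%:R * nrm (J x) by exact: FJ'.
have h2 : nrm (U' (U x) - U' (J x)) <= BLK * (K1 / n%:R * nrm x).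
  rewrite -linear_funB; last exact: (usum_linear FK).
  apply: le_trans (usum_le FK L0 B0 g'B g'Z _ n0) _.
  by apply: ler_wpM2l; [rewrite !mulr_ge0 | exact: FJ].
have h3 := nested _ n0.
have h4 : nrm (W *: U' x - W *: J' x) <= cabs W * (K2 / n%:R * nrm x).
  by rewrite -scalerBr nrmZ ler_wpM2l ?cabs_ge0 //; exact: FJ'.
have t1 := nrm_dist_transC (U' (J x)) (J' (J x)) (W *: J' x).
have t2 := nrm_dist_transC (U' (U x)) (U' (J x)) (W *: J' x).
have t3 := nrm_dist_trans (W *: U' x) (U' (U x)) (W *: J' x).
rewrite (_ : _ / _ = K2 / n%:R * nrm (J x) + BLK * (K1 / n%:R * nrm x) +
    2 * (B * L * (K' / n%:R * (K * nrm x))) + cabs W * (K2 / n%:R * nrm x)); last by ring.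
move: h3; rewrite -/U -/U' => h3; lra.
Qed.

Variables (c : R[i]) (D delta : R).
Hypotheses (gD : forall t, 0 <= t <= L -> cabs (g t - c) <= D).
Hypotheses (delta0 : 0 < delta) (delta1 : delta <= 1).
Hypothesis shrinkZ : forall r t, 1 - delta <= r <= 1 -> 0 <= t <= L ->
  Z (shrink c r g t).

Lemma shrink_integral_le (J J' : H -> H) (r K1 K2 : R) : 1 - delta <= r <= 1 ->
  usum_cvg g L F J K1 -> usum_cvg (shrink c r g) L F J' K2 ->
  forall x, nrm (J x - J' x) <= B * L * (K + K ^+ 2 * D) * (1 - r) * nrm x.
Proof.
move=> r01 FJ FJ' x; apply/ler_addgt0Pl => e e0.
have /andP[r0 r1] := r01.
have [lin bd id] := FK.
have K10 : 0 <= `|K1| + `|K2| by rewrite addr_ge0.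
pose n := (Num.trunc ((`|K1| + `|K2|) * nrm x / e)).+1.
have n0 : (0 < n)%N by [].
have h0 : (`|K1| + `|K2|) / n%:R * nrm x <= e.
  rewrite mulrAC ler_pdivrMr ?ltr0n // [leRHS]mulrC -ler_pdivrMr //.
  by rewrite ltW // /n truncnS_gt.
have h1 := FJ _ x n0; have h2 := FJ' _ x n0.
have h3 : nrm (usum g L F n x - usum (shrink c r g) L F n x) <=
    B * L * ((K + K ^+ 2 * D) * (1 - r) * nrm x).
  rewrite /usum /rsum -sumrB.
  under eq_bigr => i _.
    rewrite (_ : shrink c r g (upt L n i.+1) - _ = (g (upt L n i.+1) - g (upt L n i)) * r%:C).
      rewrite -scalerA -scalerBr; over.
    by rewrite /shrink; ring.
  set f := fun i => F (g (upt L n i)) x - r%:C *: F (shrink c r g (upt L n i)) x.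
  apply: (@weighted_sum_le _ _ _ _ _ L0 B0 gB f) => // i hi.
  have b : 0 <= upt L n i <= L by apply: upt_bounds => //; exact: ltnW.
  have sZ := shrinkZ r01 b.
  have gZ : Z (g (upt L n i)).
    by rewrite -(shrink1 c g); apply: shrinkZ => //; apply/andP; split; lra.
  have e1 : cabs (shrink c r g (upt L n i) - g (upt L n i)) <= (1 - r) * D.
    rewrite /shrink (_ : _ - _ = (r - 1)%:C * (g (upt L n i) - c)); last first.
      by rewrite rmorphB /=; ring.
    rewrite cabsM cabs_real distrC ger0_norm ?subr_ge0 //.
    by rewrite ler_wpM2l ?subr_ge0 // gD.
  have e2 := pseudo_resolvent_lip K0 FK x gZ sZ.
  have e3 := bd _ x sZ.
  have := nrm_dist_trans (F (shrink c r g (upt L n i)) x) (F (g (upt L n i)) x)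
     (r%:C *: F (shrink c r g (upt L n i)) x).
  rewrite -[X in _ + nrm (X - _)]scale1r -scalerBl nrmZ.
  rewrite (_ : 1 - r%:C = (1 - r)%:C); last by rewrite rmorphB.
  rewrite cabs_real ger0_norm ?subr_ge0 // -/(f i) => e4.
  have e5 : K ^+ 2 * cabs (shrink c r g (upt L n i) - g (upt L n i)) * nrm x <=
     K ^+ 2 * ((1 - r) * D) * nrm x.
    by rewrite ler_wpM2r ?nrm_ge0 // ler_wpM2l ?exprn_ge0.
  have e6 : (1 - r) * nrm (F (shrink c r g (upt L n i)) x) <= (1 - r) * (K * nrm x).
    by rewrite ler_wpM2l // subr_ge0.
  lra.
have t1 := nrm_dist_transC (usum g L F n x) (J x) (J' x).
have t2 := nrm_dist_trans (usum (shrink c r g) L F n x) (usum g L F n x) (J' x).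
have k1 : K1 / n%:R * nrm x + K2 / n%:R * nrm x <= (`|K1| + `|K2|) / n%:R * nrm x.
  rewrite -!mulrA -mulrDl ler_wpM2r //; first by rewrite mulr_ge0 ?invr_ge0 ?nrm_ge0.
  by rewrite lerD // ler_norm.
lra.
Qed.

(** [J] is compared with the integrals [J'] over slightly shrunk copies of the
    path, which satisfy [J' (J x) = W *: J' x] and tend to [J]. *)
Lemma integral_idempotent (W : R[i]) (J : H -> H) (K1 : R) :
  (forall r t t', 1 - delta <= r < 1 -> 0 <= t <= L -> 0 <= t' <= L ->
     g t != shrink c r g t') ->
  (forall r, 1 - delta <= r < 1 -> exists K', forall t, 0 <= t <= L ->
     winding g L (shrink c r g t) W K' /\ winding (shrink c r g) L (g t) 0 K') ->
  usum_cvg g L F J K1 -> forall x, J (J x) = W *: J x.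
Proof.
move=> gsg wind FJ x; have d0 := delta0; have d1 := delta1.
apply/eqP; rewrite -subr_eq0; apply/eqP.
have gZ t : 0 <= t <= L -> Z (g t).
  by move=> ht; rewrite -(shrink1 c g); apply: shrinkZ => //; apply/andP; split; lra.
pose M := B * L * (K + K ^+ 2 * D).
apply: (@nrm_over_nat _ _ (M * delta * nrm (J x) + cabs W * (M * delta * nrm x))) => n n0.
have nR : 0 < n%:R :> R by rewrite ltr0n.
have n1 : n%:R^-1 <= 1 :> R by rewrite invf_le1 // ler1n.
have dn : 0 < delta / n%:R by rewrite divr_gt0.
have dn' : delta / n%:R <= delta by rewrite ler_piMr // ltW.
(* The shrinking factor tends to 1 as [n] grows. *)
pose r := 1 - delta / n%:R.
have r01 : 1 - delta <= r < 1 by apply/andP; rewrite /r; split; lra.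
have r01' : 1 - delta <= r <= 1 by apply/andP; rewrite /r; split; lra.
have g'B : lipschitz_path (shrink c r g) L B.
  by apply: lipschitz_shrink; apply/andP; rewrite /r; split; lra.
have g'Z t : 0 <= t <= L -> Z (shrink c r g t) by exact: shrinkZ.
have [J' hJ'] := resolvent_integral_exists K0 FK L0 B0 g'B g'Z.
have FJ' := integral_usum_cvg L0 hJ'.
have [K' wK] := wind _ r01.
have e1 : J' (J x) = W *: J' x.
  apply: (integral_nested g'B gZ g'Z _ _ _ FJ FJ').
  - by move=> t t' ht ht'; apply: gsg.
  - by move=> t /wK[h _]; exact: h.
  - by move=> t /wK[_ h]; exact: h.
have h1 := shrink_integral_le r01' FJ FJ' (J x).
have h2 := shrink_integral_le r01' FJ FJ' x.
have h3 := ler_wpM2l (cabs_ge0 W) h2.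
rewrite -nrmZ scalerBr -e1 nrm_distC in h3.
apply: (le_trans (nrm_dist_trans (J' (J x)) _ _)).
rewrite (_ : _ / _ = M * (1 - r) * nrm (J x) + cabs W * (M * (1 - r) * nrm x)).
  by apply: lerD; [exact: h1 | exact: h3].
by rewrite /r; ring.
Qed.

End Idempotent.

End PseudoResolvents.

(** * Invariance of the rank along a Lipschitz family of resolvents *)
Section RankInvariance.
Context {R : realType} {H : completeNormedModType R[i]}.
Variables (Z : set R[i]) (F : R -> R[i] -> H -> H) (K M : R).
Hypotheses (K0 : 0 <= K) (M0 : 0 <= M).
Hypothesis FK : forall s, 0 <= s <= 1 -> pseudo_resolvent Z (F s) K.
Hypothesis FM : forall s s' z x, 0 <= s <= 1 -> 0 <= s' <= 1 -> Z z ->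
  nrm (F s z x - F s' z x) <= M * `|s - s'| * nrm x.
Variables (g : R -> R[i]) (L B : R).
Hypotheses (L0 : 0 <= L) (B0 : 0 <= B) (gB : lipschitz_path g L B).
Hypothesis gZ : forall t, 0 <= t <= L -> Z (g t).
Variables (J : R -> H -> H) (W : R[i]) (K1 : R).
Hypothesis FJ : forall s, 0 <= s <= 1 -> usum_cvg g L (F s) (J s) K1.
Hypothesis W0 : W != 0.
Hypothesis JJ : forall s x, 0 <= s <= 1 -> J s (J s x) = W *: J s x.

Lemma integral_lip s s' x : 0 <= s <= 1 -> 0 <= s' <= 1 ->
  nrm (J s x - J s' x) <= B * L * (M * `|s - s'| * nrm x).
Proof.
move=> hs hs'; apply/ler_addgt0Pl => e e0.
pose n := (Num.trunc (2 * K1 * nrm x / e)).+1.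
have n0 : (0 < n)%N by [].
have h0 : 2 * K1 / n%:R * nrm x <= e.
  rewrite mulrAC ler_pdivrMr ?ltr0n // [leRHS]mulrC -ler_pdivrMr //.
  by rewrite ltW // /n truncnS_gt.
have h1 := FJ hs x n0; have h2 := FJ hs' x n0.
have h3 : nrm (usum g L (F s) n x - usum g L (F s') n x) <= B * L * (M * `|s - s'| * nrm x).
  rewrite /usum /rsum -sumrB; under eq_bigr do rewrite -scalerBr.
  apply: (@weighted_sum_le _ _ _ _ _ L0 B0 gB
    (fun i => F s (g (upt L n i)) x - F s' (g (upt L n i)) x)) => // i hi.
  by apply: FM => //; apply/gZ/upt_bounds => //; exact: ltnW.
have t1 := nrm_dist_transC (usum g L (F s) n x) (J s x) (J s' x).
have t2 := nrm_dist_trans (usum g L (F s') n x) (usum g L (F s) n x) (J s' x).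
lra.
Qed.

(** The projections [W^-1 *: J s] depend on [s] in a Lipschitz way.  In [m] steps of
    length [1 / m] consecutive projections are at distance less than 1, so that
    [rank_close] applies to each step. *)
Lemma integral_rank_invariant r :
  has_rank (fun x => W^-1 *: J 0 x) r -> has_rank (fun x => W^-1 *: J 1 x) r.
Proof.
move=> rank0; pose a := cabs W^-1 * (B * L * M).
have a0 : 0 <= a by rewrite !mulr_ge0 ?cabs_ge0.
pose m := (Num.trunc (2 * a)).+1.
have mR : 0 < m%:R :> R by rewrite ltr0n.
have am : a / m%:R < 1.
  by rewrite ltr_pdivrMr // mul1r; have := truncnS_gt (2 * a); rewrite -/m; lra.
have lin s : 0 <= s <= 1 -> linear (fun x => W^-1 *: J s x).
  move=> hs c u v; rewrite (integral_linear (FK hs) L0 gZ (FJ hs)).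
  by rewrite scalerDr !scalerA mulrC.
have idem s x : 0 <= s <= 1 -> W^-1 *: J s (W^-1 *: J s x) = W^-1 *: J s x.
  move=> hs; rewrite linear_funZ; last exact: (integral_linear (FK hs) L0 gZ (FJ hs)).
  by rewrite JJ // [X in _ *: X]scalerA mulVf // scale1r.
have step k : (k <= m)%N -> has_rank (fun x => W^-1 *: J (k%:R / m%:R) x) r.
  have pt i : (i <= m)%N -> 0 <= (i%:R / m%:R : R) <= 1.
    by move=> im; rewrite divr_ge0 //= ler_pdivrMr // mul1r ler_nat.
  elim: k => [|k ih] hk; first by rewrite mul0r.
  have hk' := pt _ hk; have hk0 := pt _ (ltnW hk).
  apply: (rank_close (lin _ hk0) (lin _ hk') _ _ am _ (ih (ltnW hk))).
  - by move=> x; exact: idem.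
  - by move=> x; exact: idem.
  move=> x; rewrite -scalerBr nrmZ.
  apply: (le_trans (ler_wpM2l (cabs_ge0 _) (integral_lip x hk0 hk'))).
  rewrite distrC -mulrBl -natr1 addrAC subrr add0r ger0_norm ?divr_ge0 //.
  by rewrite le_eqVlt; apply/orP; left; apply/eqP; rewrite /a; ring.
by have := step m (leqnn _); rewrite divff // gt_eqF.
Qed.

End RankInvariance.

(** * Mean value estimates *)
Section RealEstimates.
Context {R : realType}.

Lemma mvt01 (f df : R -> R) :
  (forall x : R, 0 <= x <= 1 -> is_derive x 1 f (df x)) ->
  exists2 c, 0 <= c <= 1 & f 1 - f 0 = df c.
Proof.
move=> h; have [||c] := @MVT_segment R f df 0 1 ler01.
- by move=> x; rewrite in_itv /= => /andP[x0 x1]; apply: h; rewrite !ltW.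
- apply: derivable_within_continuous => x; rewrite in_itv /= => hx.
  by have [] := h x hx.
by rewrite in_itv /= subr0 mulr1 => hc e; exists c.
Qed.

Lemma mvt_affine (f df : R -> R) (a b : R) :
  (forall x : R, is_derive x 1 f (df x)) ->
  exists2 c, `|c - a| <= `|b - a| & f b - f a = df c * (b - a).
Proof.
move=> h; have [|c c01] := @mvt01 (f \o (fun t => a + t * (b - a)))
  (fun t => df (a + t * (b - a)) * (b - a)).
  move=> t _; apply: is_derive1_comp.
  by apply: is_derive_eq; rewrite scaler0 !add0r mul1r [LHS]mulr1.
rewrite /= mul1r mul0r addr0 [a + (b - a)]addrC subrK => e.
exists (a + c * (b - a)) => //; rewrite [a + _]addrC addrK normrM.
case/andP: c01 => c0 c1.
by rewrite ger0_norm // ler_piMl.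
Qed.

Lemma sin_lip (a b : R) : `|sin b - sin a| <= `|b - a|.
Proof.
have [c _ ->] := mvt_affine a b (@is_derive_sin R).
by rewrite normrM ler_piMl // ler_norml cos_geN1 cos_le1.
Qed.

Lemma cos_lip (a b : R) : `|cos b - cos a| <= `|b - a|.
Proof.
have [c _ ->] := mvt_affine a b (@is_derive_cos R).
by rewrite normrM ler_piMl // normrN ler_norml sin_geN1 sin_le1.
Qed.

(** The quarter turn made at each corner of a rectangle. *)
Lemma atan_inv (x : R) : 0 < x -> atan x + atan x^-1 = pi / 2.
Proof.
move=> x0.
have a1 : 0 < atan x by rewrite -(atan0 R) lt_atan.
have a2 : atan x < pi / 2 by exact: atan_ltpi2.
have -> : x^-1 = tan (pi / 2 - atan x).
  rewrite -[in LHS](atanK x) /tan invf_div -(opprB (atan x)) sinN cosN.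
  by rewrite sinBpihalf cosBpihalf opprK.
rewrite tanK; first by rewrite addrC subrK.
by rewrite in_itv /=; apply/andP; split; lra.
Qed.

End RealEstimates.

(** * The logarithm on the right half-plane *)
Section ComplexLog.
Context {R : realType}.
Implicit Types (u v w : R[i]) (g : R -> R[i]).

(** The principal logarithm, on the right half-plane. *)
Definition clog u : R[i] :=
  (2^-1 * ln (Re u * Re u + Im u * Im u)) +i* atan (Im u / Re u).

Lemma is_derive_line (a b t : R) : is_derive t 1 (fun t => a + t * b) b.
Proof.
by apply: is_derive_eq; rewrite /GRing.scale /=; ring.
Qed.

Lemma is_derive_clog_Re (p a q b t : R) : 0 < p + t * a ->
  is_derive t 1
   (fun t => 2^-1 * ln ((p + t * a) * (p + t * a) + (q + t * b) * (q + t * b)))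
   (((p + t * a) * a + (q + t * b) * b) /
    ((p + t * a) * (p + t * a) + (q + t * b) * (q + t * b))).
Proof.
move=> p0; have dp := is_derive_line p a t; have dq := is_derive_line q b t.
have S0 : 0 < (p + t * a) * (p + t * a) + (q + t * b) * (q + t * b).
  by rewrite ltr_pwDl ?mulr_gt0 // -expr2 sqr_ge0.
have dS : is_derive t 1
    (fun t => (p + t * a) * (p + t * a) + (q + t * b) * (q + t * b))
    (2 * ((p + t * a) * a + (q + t * b) * b)).
  by apply: is_derive_eq; rewrite /GRing.scale /=; ring.
have dl := @is_derive1_comp R (@ln R) (fun t : R => (p + t * a) * (p + t * a) +
  (q + t * b) * (q + t * b)) t _ _ (is_derive1_ln S0) dS.
have := @is_deriveZ _ _ _ _ (2^-1) _ _ _ dl.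
rewrite /GRing.scale /= => h; apply: (@is_derive_eq _ _ _ _ _ _ _ _ h).
by field; rewrite gt_eqF.
Qed.

Lemma is_derive_clog_Im (p a q b t : R) : 0 < p + t * a ->
  is_derive t 1 (fun t => atan ((q + t * b) / (p + t * a)))
   (((p + t * a) * b - (q + t * b) * a) /
    ((p + t * a) * (p + t * a) + (q + t * b) * (q + t * b))).
Proof.
move=> p0; have dp := is_derive_line p a t; have dq := is_derive_line q b t.
have dpV : is_derive t 1 (fun t => (p + t * a)^-1) (- (p + t * a) ^- 2 * a).
  by apply: is_deriveV => //; rewrite gt_eqF.
have dr : is_derive t 1 (fun t => (q + t * b) / (p + t * a))
    ((q + t * b) * (- (p + t * a) ^- 2 * a) + (p + t * a)^-1 * b).
  exact: is_deriveM.
have h := @is_derive1_comp R (@atan R) (fun t : R => (q + t * b) / (p + t * a)) t _ _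
  (@is_derive1_atan _ _) dr.
apply: (@is_derive_eq _ _ _ _ _ _ _ _ h) => /=.
move: (p + t * a) (q + t * b) p0 => P Q p0 {dp dq dpV dr h}.
have P0 : P != 0 by rewrite gt_eqF.
have S0 : P * P + Q * Q != 0.
  by rewrite gt_eqF // ltr_pwDl ?mulr_gt0 // -expr2 sqr_ge0.
have -> : (1 + (Q / P) ^+ 2)^-1 = P ^+ 2 / (P * P + Q * Q).
  by field; rewrite P0 S0.
by field; rewrite P0 S0.
Qed.

(** The mean value theorem on the segment from [u] to [v], applied to the real and
    to the imaginary part, gives [(v - u) / u'] for two points [u'] of the segment;
    these quotients differ from [(v - u) / u] by at most [|v - u|^2 / d^2]. *)
Lemma clog_increment (d : R) u v : 0 < d -> d <= Re u -> d <= Re v ->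
  cabs (clog v - clog u - (v - u) / u) <= 2 / d ^+ 2 * cabs (v - u) ^+ 2.
Proof.
move=> d0 du dv.
pose a := Re v - Re u; pose b := Im v - Im u.
pose U (t : R) := (Re u + t * a) +i* (Im u + t * b).
have Upos t : 0 <= t <= 1 -> d <= Re u + t * a.
  by move=> /andP[t0 t1]; rewrite /a; nra.
have quot (t : R) : 0 <= t <= 1 -> (v - u) / U t =
   (((Re u + t * a) * a + (Im u + t * b) * b) /
    ((Re u + t * a) * (Re u + t * a) + (Im u + t * b) * (Im u + t * b))) +i*
   (((Re u + t * a) * b - (Im u + t * b) * a) /
    ((Re u + t * a) * (Re u + t * a) + (Im u + t * b) * (Im u + t * b))).
  move=> /Upos ht.
  have U0 : U t != 0 by rewrite eq_complex /= negb_and gt_eqF //; lra.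
  apply: (canLR (mulfK U0)).
  have vuE : v - u = a +i* b by rewrite /a /b; case: (u) (v) => ? ? [? ?].
  rewrite vuE /U; apply/eqP; rewrite eq_complex /=.
  set P := Re u + t * a in ht *; set Q := Im u + t * b.
  have S0 : P * P + Q * Q != 0.
    by rewrite gt_eqF // ltr_pwDl -?expr2 ?sqr_ge0 // exprn_gt0 //; lra.
  by apply/andP; split; apply/eqP; field.
have near (t : R) : 0 <= t <= 1 -> cabs ((v - u) / U t - (v - u) / u) <=
    cabs (v - u) ^+ 2 / d ^+ 2.
  move=> ht; have dU := Upos _ ht; have /andP[t0 t1] := ht.
  have lo z : d <= Re z -> d <= cabs z.
    by move=> dz; rewrite (le_trans dz) // (le_trans _ (Re_le_cabs z)) // ler_norm.
  have n0 z : d <= Re z -> z != 0.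
    by move=> /lo dz; rewrite -cabs_gt0; lra.
  have -> : (v - u) / U t - (v - u) / u = (v - u) * (u - U t) / (U t * u).
    by field; rewrite !n0.
  have -> : u - U t = - t%:C * (v - u).
    rewrite /U /a /b; case: (u) (v) => ? ? [? ?] /=; apply/eqP; rewrite eq_complex /=.
    by apply/andP; split; apply/eqP; ring.
  rewrite !cabsM cabsV cabsN cabs_real ger0_norm // cabsM.
  have h1 := lo (U t) dU; have h2 := lo _ du.
  have hd : (cabs (U t) * cabs u)^-1 <= d ^- 2.
    rewrite lef_pV2 ?posrE ?exprn_gt0 //; first by rewrite expr2 ler_pM // ltW.
    by rewrite mulr_gt0 //; lra.
  have hv := cabs_ge0 (v - u).
  apply: ler_pM => //; first by rewrite !mulr_ge0.
    by rewrite invr_ge0 mulr_ge0 ?cabs_ge0.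
  by rewrite expr2 mulrCA ler_piMl // mulr_ge0.
have [c1 hc1 e1] := mvt01 (fun t ht => @is_derive_clog_Re (Re u) a (Im u) b t
    (lt_le_trans d0 (Upos t ht))).
have [c2 hc2 e2] := mvt01 (fun t ht => @is_derive_clog_Im (Re u) a (Im u) b t
    (lt_le_trans d0 (Upos t ht))).
have m1 := near _ hc1; have m2 := near _ hc2.
rewrite (quot _ hc1) in m1; rewrite (quot _ hc2) in m2.
rewrite !mul1r !mul0r !addr0 in e1 e2.
apply: (le_trans (cabs_le_ReIm _)).
have -> : 2 / d ^+ 2 * cabs (v - u) ^+ 2 =
    cabs (v - u) ^+ 2 / d ^+ 2 + cabs (v - u) ^+ 2 / d ^+ 2 by ring.
apply: lerD.
  apply: le_trans m1; apply: le_trans (Re_le_cabs _).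
  rewrite le_eqVlt; apply/orP; left; apply/eqP.
  rewrite !ReB -e1 /= /a /b !subrKC //.
apply: le_trans m2; apply: le_trans (Im_le_cabs _).
rewrite le_eqVlt; apply/orP; left; apply/eqP.
by rewrite !ImB -e2 /= /a /b !subrKC.
Qed.

(** Crossing from one half-plane to the next one through an open quadrant turns
    the branch of the logarithm by a quarter turn. *)
Lemma clog_quarter (x y : R) : 0 < x -> 0 < y ->
  clog (x +i* y) - clog (y -i* x) = 0 +i* (pi / 2).
Proof.
move=> x0 y0; rewrite /clog /=; apply/eqP; rewrite eq_complex /=; apply/andP; split.
  by rewrite mulrNN [y * y + _]addrC subrr.
by rewrite mulNr atanN opprK -[x / y]invf_div atan_inv // divr_gt0.
Qed.

End ComplexLog.

(** * Winding numbers *)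
Section Winding.
Context {R : realType}.
Implicit Types (g : R -> R[i]) (w c : R[i]).

Definition lip_on g (lo hi B : R) : Prop := forall a b,
  lo <= a -> a <= b -> b <= hi -> cabs (g b - g a) <= B * (b - a).

(** A primitive of [1 / (z - w)] along [g], with a quadratic error bound, whose
    total increment is [I]. *)
Definition log_primitive g w (lo hi : R) (I : R[i]) (K : R) : Prop :=
  exists2 G : R -> R[i], forall a b, lo <= a -> a <= b -> b <= hi ->
    cabs (G b - G a - (g b - g a) / (g a - w)) <= K * (b - a) ^+ 2
  & G hi - G lo = I.

Lemma lip_on_path g (L B : R) : lip_on g 0 L B -> lipschitz_path g L B.
Proof.
move=> h a b /andP[a0 aL] /andP[b0 bL]; case: (leP a b) => ab.
  by rewrite cabs_distC distrC ger0_norm ?subr_ge0 // h.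
by rewrite ger0_norm ?subr_ge0 ?h // ltW.
Qed.

Lemma lip_on_concat g (lo m hi B : R) :
  lip_on g lo m B -> lip_on g m hi B -> lip_on g lo hi B.
Proof.
move=> h1 h2 a b la ab bh; have [bm|mb] := leP b m; first exact: h1.
have [ma|am] := leP m a; first by apply: h2.
have e1 := h1 a m la (ltW am) (lexx _); have e2 := h2 m b (lexx _) (ltW mb) bh.
have := cabsD (g b - g m) (g m - g a); rewrite addrA subrK => e3; lra.
Qed.

(** The increments of the two primitives add up.  Across the junction the increment
    of the second part is compared with [1 / (g m - w)] instead of [1 / (g a - w)],
    whence the additional quadratic error. *)
Lemma log_primitive_concat g w (lo m hi B d K : R) (I I' : R[i]) :
  lo <= m <= hi ->
  0 < d -> 0 <= K -> 0 <= B ->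
  (forall t, lo <= t <= hi -> d <= cabs (g t - w)) -> lip_on g lo hi B ->
  log_primitive g w lo m I K -> log_primitive g w m hi I' K ->
  log_primitive g w lo hi (I + I') (K + B ^+ 2 / d ^+ 2).
Proof.
move=> /andP[lom mhi] d0 K0 B0 gd gB [G hG GI] [G' hG' GI'].
have Bd : 0 <= B ^+ 2 / d ^+ 2 by rewrite divr_ge0 ?exprn_ge0 // ltW.
exists (fun t => if t <= m then G t else G m + (G' t - G' m)); last first.
  rewrite lom -GI -GI'; case: (leP hi m) => him.
    have -> : hi = m by apply/eqP; rewrite eq_le him mhi.
    by ring.
  by ring.
move=> a b la ab bh.
have sq : 0 <= (b - a) ^+ 2 by exact: sqr_ge0.
have weak x : x <= K * (b - a) ^+ 2 -> x <= (K + B ^+ 2 / d ^+ 2) * (b - a) ^+ 2.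
  by move=> hx; apply: (le_trans hx); rewrite ler_wpM2r // lerDl.
have [bm|mb] := leP b m.
  by rewrite (le_trans ab bm); apply/weak/hG.
have [am|ma] := leP a m; last first.
  rewrite (_ : G m + _ - _ = G' b - G' a); last by ring.
  by apply/weak/hG' => //; exact: ltW.
have e1 := hG a m la am (lexx _); have e2 := hG' m b (lexx _) (ltW mb) bh.
have da : d <= cabs (g a - w) by apply: gd; apply/andP; split; lra.
have dm : d <= cabs (g m - w) by apply: gd; apply/andP; split; lra.
have a0 : g a - w != 0 by rewrite -cabs_gt0; lra.
have m0 : g m - w != 0 by rewrite -cabs_gt0; lra.
rewrite (_ : G m + _ - _ - _ =
    (G' b - G' m - (g b - g m) / (g m - w)) + (G m - G a - (g m - g a) / (g a - w)) +
    (g b - g m) * (g a - g m) / ((g m - w) * (g a - w))); last first.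
  by field; rewrite a0 m0.
have e3 : cabs ((g b - g m) * (g a - g m) / ((g m - w) * (g a - w))) <=
    B ^+ 2 / d ^+ 2 * (b - a) ^+ 2.
  rewrite !cabsM cabsV (cabs_distC (g a)) cabsM.
  have f1 := gB m b lom (ltW mb) bh; have f2 := gB a m la am mhi.
  have f3 : (cabs (g m - w) * cabs (g a - w))^-1 <= d ^- 2.
    rewrite lef_pV2 ?posrE ?exprn_gt0 //; first by rewrite expr2 ler_pM // ltW.
    by rewrite mulr_gt0 //; lra.
  rewrite [leRHS]mulrAC; apply: ler_pM => //.
  - by rewrite mulr_ge0 ?cabs_ge0.
  - by rewrite invr_ge0 mulr_ge0 ?cabs_ge0.
  apply: (@le_trans _ _ (B * (b - m) * (B * (m - a)))).
    by apply: ler_pM; rewrite ?cabs_ge0.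
  rewrite (_ : B * (b - m) * _ = B ^+ 2 * ((b - m) * (m - a))); last by ring.
  by rewrite ler_wpM2l ?exprn_ge0 //; nra.
have t1 := cabsD (G' b - G' m - (g b - g m) / (g m - w) +
  (G m - G a - (g m - g a) / (g a - w)))
  ((g b - g m) * (g a - g m) / ((g m - w) * (g a - w))).
have t2 := cabsD (G' b - G' m - (g b - g m) / (g m - w))
  (G m - G a - (g m - g a) / (g a - w)).
have f4 : K * (b - m) ^+ 2 + K * (m - a) ^+ 2 <= K * (b - a) ^+ 2.
  by rewrite -mulrDr ler_wpM2l //; nra.
lra.
Qed.

(** The factor [e] rotates the half-plane containing the path into the domain of
    [clog]. *)
Lemma log_primitive_halfplane g w (e : R[i]) (lo hi B d : R) :
  cabs e = 1 -> 0 < d -> 0 <= B -> lip_on g lo hi B ->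
  (forall t, lo <= t <= hi -> d <= Re ((g t - w) * e)) ->
  log_primitive g w lo hi (clog ((g hi - w) * e) - clog ((g lo - w) * e))
    (2 * B ^+ 2 / d ^+ 2).
Proof.
move=> e1 d0 B0 gB hd; exists (fun t => clog ((g t - w) * e)) => // a b la ab bh.
have da : d <= Re ((g a - w) * e) by apply: hd; apply/andP; split; lra.
have db : d <= Re ((g b - w) * e) by apply: hd; apply/andP; split; lra.
have ae0 : (g a - w) * e != 0.
  rewrite -cabs_gt0; apply: lt_le_trans (Re_le_cabs _).
  by rewrite (lt_le_trans d0) // (le_trans da) // ler_norm.
move: (ae0); rewrite mulf_eq0 negb_or => /andP[a0 e0].
have := clog_increment d0 da db.
rewrite -mulrBl opprB addrA subrK -mulf_div divff // mulr1 cabsM e1 mulr1 => h.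
apply: (le_trans h).
have f1 := gB a b la ab bh; have f2 := cabs_ge0 (g b - g a).
rewrite (_ : 2 * B ^+ 2 / _ * _ = 2 / d ^+ 2 * (B * (b - a)) ^+ 2); last by ring.
have c0 : 0 <= 2 / d ^+ 2 by rewrite divr_ge0 // exprn_ge0 // ltW.
rewrite ler_wpM2l //.
by rewrite ler_pXn2r ?nnegrE // (le_trans f2).
Qed.

(** The quadratic errors over [n] intervals of length [L / n] add up to [K L^2 / n]. *)
Lemma log_primitive_winding g w (L K : R) I : 0 <= L ->
  log_primitive g w 0 L I K -> winding g L w I (K * L ^+ 2).
Proof.
move=> L0 [G hG GI] n n0; have nR : 0 < n%:R :> R by rewrite ltr0n.
have -> : I = \sum_(i < n) (G (upt L n i.+1) - G (upt L n i)).
  rewrite -(big_mkord xpredT (fun i => G (upt L n i.+1) - G (upt L n i))).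
  by rewrite telescope_sumr // /upt mulr0 mul0r mulfK ?gt_eqF.
rewrite -sumrB; apply: (le_trans (cabs_sum _ _ _)).
have -> : K * L ^+ 2 / n%:R = \sum_(i < n) K * (L / n%:R) ^+ 2.
  rewrite sumr_const card_ord -[RHS]mulr_natr exprMn exprVn.
  by field; rewrite gt_eqF.
apply: ler_sum => i _; rewrite cabs_distC.
have e : upt L n i.+1 = upt L n i + L / n%:R.
  by rewrite /upt -natr1 mulrDr mulr1 mulrDl.
have /andP[b1 b2] := upt_bounds L0 (ltnW (ltn_ord i)).
have /andP[b3 b4] := upt_bounds L0 (ltn_ord i).
have q : 0 <= L / n%:R by rewrite divr_ge0 // ltW.
have := hG (upt L n i) (upt L n i.+1) b1; rewrite e => h.
have := h; rewrite [_ + L / _ - _]addrAC subrr add0r; apply; last by rewrite -e.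
by rewrite lerDl.
Qed.

Lemma winding_halfplane g w (e : R[i]) (L B d : R) : 0 <= L ->
  cabs e = 1 -> 0 < d -> 0 <= B -> lip_on g 0 L B -> g 0 = g L ->
  (forall t, 0 <= t <= L -> d <= Re ((g t - w) * e)) ->
  winding g L w 0 (2 * B ^+ 2 / d ^+ 2 * L ^+ 2).
Proof.
move=> L0 e1 d0 B0 gB g0L hd; apply: log_primitive_winding => //.
by have := log_primitive_halfplane e1 d0 B0 gB hd; rewrite g0L subrr.
Qed.

(** Convexity of the region bounded by the path, with inner radius [rho] around
    [c], expressed by supporting lines.  This is what separates each point of the
    path from the shrunk copies of the path. *)
Definition supported g (L : R) c (rho : R) : Prop := forall s, 0 <= s <= L ->
  exists e, [/\ cabs e = 1, forall t, 0 <= t <= L -> 0 <= Re ((g t - g s) * e)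
              & rho <= Re ((c - g s) * e)].

(** The point [shrink c r g t] is the convex combination of [g t], which is on the
    right side of the supporting line at [g s], and of [c], which is at distance at
    least [rho] from that line. *)
Lemma supported_shrink g (L : R) c (rho r : R) s : 0 <= r <= 1 ->
  supported g L c rho -> 0 <= s <= L ->
  exists2 e, cabs e = 1 & forall t, 0 <= t <= L ->
    (1 - r) * rho <= Re ((shrink c r g t - g s) * e).
Proof.
move=> /andP[r0 r1] hg hs; have [e [e1 he hc]] := hg _ hs; exists e => // t ht.
have -> : (shrink c r g t - g s) * e =
    r%:C * ((g t - g s) * e) + (1 - r)%:C * ((c - g s) * e).
  by rewrite /shrink rmorphB /=; ring.
rewrite ReD !ReZ; have := he _ ht => h.
have h1 : 0 <= r * Re ((g t - g s) * e) by rewrite mulr_ge0.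
have h2 : (1 - r) * rho <= (1 - r) * Re ((c - g s) * e).
  by rewrite ler_wpM2l // subr_ge0.
lra.
Qed.

Lemma lip_on_shrink g c (r lo hi B : R) : 0 <= r <= 1 -> lip_on g lo hi B ->
  lip_on (shrink c r g) lo hi B.
Proof.
move=> /andP[r0 r1] gB a b la ab bh.
rewrite /shrink (_ : _ - _ = r%:C * (g b - g a)); last by ring.
rewrite cabsM cabs_real ger0_norm //.
by have := gB a b la ab bh; have := cabs_ge0 (g b - g a); nra.
Qed.

Lemma shrink_disjoint g (L : R) c (rho r : R) t t' : 0 < rho -> 0 <= r < 1 ->
  supported g L c rho -> 0 <= t <= L -> 0 <= t' <= L -> g t != shrink c r g t'.
Proof.
move=> rho0 /andP[r0 r1] hg ht ht'.
have r01 : 0 <= r <= 1 by rewrite r0 ltW.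
have [e _ he] := supported_shrink r01 hg ht.
apply/eqP => E; have := he _ ht'; rewrite -E subrr mul0r leNgt.
by rewrite mulr_gt0 // subr_gt0.
Qed.

Lemma winding_shrink g (L B : R) c (rho r : R) s : 0 <= L -> 0 <= B -> 0 < rho ->
  0 <= r < 1 -> supported g L c rho -> lip_on g 0 L B -> g 0 = g L ->
  0 <= s <= L ->
  winding (shrink c r g) L (g s) 0 (2 * B ^+ 2 / ((1 - r) * rho) ^+ 2 * L ^+ 2).
Proof.
move=> L0 B0 rho0 /andP[r0 r1] hg gB g0L hs.
have r01 : 0 <= r <= 1 by rewrite r0 ltW.
have [e e1 he] := supported_shrink r01 hg hs.
apply: (winding_halfplane (e := e)) => //.
- by rewrite mulr_gt0 // subr_gt0.
- exact: lip_on_shrink.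
- by rewrite /shrink g0L.
Qed.

End Winding.

(** * The boundary of a rectangle *)
Section Rectangle.
Context {R : realType}.
Variables (x0 x1 y0 y1 : R).
Hypotheses (x01 : x0 < x1) (y01 : y0 < y1).
Local Notation rect := (cpath (rectangle_boundary x0 x1 y0 y1)).
Local Notation perim := ((x1 - x0) + (y1 - y0)).

Lemma rect_bottom (t : R) : t <= 1 -> rect t = (x0 + t * (x1 - x0)) +i* y0.
Proof. by move=> h; rewrite /= h. Qed.

Lemma rect_right (t : R) : 1 <= t <= 2 -> rect t = x1 +i* (y0 + (t - 1) * (y1 - y0)).
Proof.
move=> /andP[h1 h2] /=; rewrite h2; case: (leP t 1) => // h3.
have -> : t = 1 by apply/eqP; rewrite eq_le h1 h3.
by apply/eqP; rewrite eq_complex /=; apply/andP; split; apply/eqP; ring.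
Qed.

Lemma rect_top (t : R) : 2 <= t <= 3 -> rect t = (x1 - (t - 2) * (x1 - x0)) +i* y1.
Proof.
move=> /andP[h1 h2] /=; rewrite h2; case: (leP t 1) => h3; first by exfalso; lra.
case: (leP t 2) => // h4; have -> : t = 2 by apply/eqP; rewrite eq_le h1 h4.
by apply/eqP; rewrite eq_complex /=; apply/andP; split; apply/eqP; ring.
Qed.

Lemma rect_left (t : R) : 3 <= t -> rect t = x0 +i* (y1 - (t - 3) * (y1 - y0)).
Proof.
move=> h1 /=; case: (leP t 1) => h3; first by exfalso; lra.
case: (leP t 2) => h4; first by exfalso; lra.
case: (leP t 3) => // h5; have -> : t = 3 by apply/eqP; rewrite eq_le h1 h5.
by apply/eqP; rewrite eq_complex /=; apply/andP; split; apply/eqP; ring.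
Qed.

Lemma rect_closed : rect 0 = rect 4.
Proof.
rewrite (@rect_left 4) ?ler_nat // (@rect_bottom 0) //.
by apply/eqP; rewrite eq_complex /=; apply/andP; split; apply/eqP; ring.
Qed.

Lemma rect_edge (t : R) : 0 <= t <= 4 ->
  [/\ x0 <= Re (rect t) <= x1, y0 <= Im (rect t) <= y1
    & [\/ Im (rect t) = y0, Re (rect t) = x1, Im (rect t) = y1 | Re (rect t) = x0]].
Proof.
move=> /andP[t0 t4]; have hx := x01; have hy := y01.
have [t1|t1] := leP t 1.
  rewrite rect_bottom //=; split; [| |by constructor 1]; apply/andP; split; nra.
have [t2|t2] := leP t 2.
  have h : 1 <= t <= 2 by apply/andP; split; lra.
  rewrite rect_right //=; split; [| |by constructor 2]; apply/andP; split; nra.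
have [t3|t3] := leP t 3.
  have h : 2 <= t <= 3 by apply/andP; split; lra.
  rewrite rect_top //=; split; [| |by constructor 3]; apply/andP; split; nra.
have h : 3 <= t by lra.
rewrite rect_left //=; split; [| |by constructor 4]; apply/andP; split; nra.
Qed.

Lemma perim_gt0 : 0 < perim.
Proof. by have := x01; have := y01; lra. Qed.

Lemma rect_lip : lip_on rect 0 4 perim.
Proof.
have hx := x01; have hy := y01.
have step (x : R) z (s : R) : cabs z = 1 -> 0 <= s -> s <= perim -> 0 <= x ->
    cabs ((x * s)%:C * z) <= perim * x.
  move=> z1 s0 sp x0'; rewrite cabsM z1 mulr1 cabs_real ger0_norm ?mulr_ge0 //.
  by rewrite mulrC ler_wpM2r.
have i1 : cabs (0 +i* 1 : R[i]) = 1 by rewrite cabs_imag normr1.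
have r1 : cabs (1 : R[i]) = 1 by rewrite cabs_real normr1.
apply: (@lip_on_concat _ _ _ 1).
  move=> a b a0 ab b1; rewrite !rect_bottom //; last lra.
  rewrite (_ : _ - _ = ((b - a) * (x1 - x0))%:C * 1); first by apply: step => //; lra.
  by apply/eqP; rewrite eq_complex /=; apply/andP; split; apply/eqP; ring.
apply: (@lip_on_concat _ _ _ 2).
  move=> a b a0 ab b1; rewrite !rect_right //; [|apply/andP; split; lra..].
  rewrite (_ : _ - _ = ((b - a) * (y1 - y0))%:C * (0 +i* 1)); first by apply: step => //; lra.
  by apply/eqP; rewrite eq_complex /=; apply/andP; split; apply/eqP; ring.
apply: (@lip_on_concat _ _ _ 3).
  move=> a b a0 ab b1; rewrite !rect_top //; [|apply/andP; split; lra..].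
  rewrite (_ : _ - _ = ((b - a) * (x1 - x0))%:C * (-1)).
    by apply: step; rewrite ?cabsN //; lra.
  by apply/eqP; rewrite eq_complex /=; apply/andP; split; apply/eqP; ring.
move=> a b a0 ab b1; rewrite !rect_left //; last lra.
rewrite (_ : _ - _ = ((b - a) * (y1 - y0))%:C * - (0 +i* 1)).
  by apply: step; rewrite ?cabsN //; lra.
by apply/eqP; rewrite eq_complex /=; apply/andP; split; apply/eqP; ring.
Qed.

Definition rect_center : R[i] := ((x0 + x1) / 2) +i* ((y0 + y1) / 2).

Lemma rect_supported (rho : R) : 2 * rho <= x1 - x0 -> 2 * rho <= y1 - y0 ->
  supported rect 4 rect_center rho.
Proof.
move=> hx hy s hs; have [_ _ he] := rect_edge hs.
have i1 : cabs (0 +i* 1 : R[i]) = 1 by rewrite cabs_imag normr1.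
have r1 : cabs (1 : R[i]) = 1 by rewrite cabs_real normr1.
case: he => e; [exists (- (0 +i* 1)) | exists (-1) | exists (0 +i* 1) | exists 1];
  rewrite ?cabsN; split => //.
all: try (move=> t ht; have [/andP[+ +] /andP[+ +] _] := rect_edge ht).
all: rewrite ?(mulrN1, mulr1, mulrN); move: e; rewrite /rect_center;
  case: (rect s) => a b; try (case: (rect t) => p q); move=> /= *; lra.
Qed.

(** Seen from [w], each edge lies in a half-plane, on which a rotated branch of the
    logarithm is a primitive.  By [clog_quarter] the branches of two consecutive
    edges differ at the common corner by a quarter turn, and the remaining terms
    cancel around the rectangle. *)
Lemma rect_winding_inside (d : R) w : 0 < d ->
  x0 + d <= Re w <= x1 - d -> y0 + d <= Im w <= y1 - d ->
  winding rect 4 w (0 +i* (2 * pi)) (5 * perim ^+ 2 / d ^+ 2 * 4 ^+ 2).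
Proof.
move=> d0 /andP[wx0 wx1] /andP[wy0 wy1]; apply: log_primitive_winding => //.
have pr := perim_gt0; have hx := x01; have hy := y01; have B0 := ltW pr.
have K0 : 0 <= perim ^+ 2 / d ^+ 2 by rewrite divr_ge0 ?exprn_ge0 // ltW.
have i1 : cabs (0 +i* 1 : R[i]) = 1 by rewrite cabs_imag normr1.
have r1 : cabs (1 : R[i]) = 1 by rewrite cabs_real normr1.
have far t : 0 <= t <= 4 -> d <= cabs (rect t - w).
  move=> /rect_edge[_ _ [] e].
  - by rewrite (le_trans _ (Im_le_cabs _)) // ImB e ler_normr; apply/orP; right; lra.
  - by rewrite (le_trans _ (Re_le_cabs _)) // ReB e ler_normr; apply/orP; left; lra.
  - by rewrite (le_trans _ (Im_le_cabs _)) // ImB e ler_normr; apply/orP; left; lra.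
  - by rewrite (le_trans _ (Re_le_cabs _)) // ReB e ler_normr; apply/orP; right; lra.
have sub lo hi : 0 <= lo -> hi <= 4 -> lip_on rect lo hi perim.
  by move=> h1 h2 a b ha ab hb; apply: rect_lip => //; lra.
pose K : R := 2 * perim ^+ 2 / d ^+ 2.
have edge e lo hi : 0 <= lo -> hi <= 4 -> cabs e = 1 ->
    (forall t, lo <= t <= hi -> d <= Re ((rect t - w) * e)) ->
    log_primitive rect w lo hi (clog ((rect hi - w) * e) - clog ((rect lo - w) * e)) K.
  by move=> lo0 hi4 e1 he; apply: log_primitive_halfplane => //; exact: sub.
have E1 : rect 1 = x1 +i* y0.
  by rewrite rect_bottom // mul1r addrC subrK.
have E0 : rect 0 = x0 +i* y0 by rewrite rect_bottom // mul0r addr0.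
have E2 : rect 2 = x1 +i* y1.
  rewrite rect_right ?lexx ?ler1n // (_ : 2 - 1 = 1 :> R); last by ring.
  by rewrite mul1r addrC subrK.
have E3 : rect 3 = x0 +i* y1.
  rewrite rect_top ?lexx ?ler_nat // (_ : 3 - 2 = 1 :> R); last by ring.
  by rewrite mul1r opprB addrC subrK.
have E4 : rect 4 = x0 +i* y0 by rewrite -rect_closed.
move: wx0 wx1 wy0 wy1 far edge; case: w => wr wi.
cbn [complex.Re complex.Im] => wx0 wx1 wy0 wy1 far edge.
(* In edge order, the rotations are by [i], [1], [-i] and [-1]. *)
have P1 := edge (0 +i* 1) 0 1 (lexx _) _ i1 _.
have P2 := edge 1 1 2 ler01 _ r1 _.
have P3 := edge (- (0 +i* 1)) 2 3 _ _ _ _; rewrite cabsN in P3.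
have P4 := edge (- 1) 3 4 _ (lexx _) _ _; rewrite cabsN in P4.
have {}P1 : log_primitive rect (wr +i* wi) 0 1
    (clog ((wi - y0) +i* (x1 - wr)) - clog ((wi - y0) -i* (wr - x0))) K.
  rewrite E1 E0 in P1.
  rewrite (_ : (wi - y0) +i* (x1 - wr) = (x1 +i* y0 - (wr +i* wi)) * (0 +i* 1)).
    rewrite (_ : (wi - y0) -i* (wr - x0) = (x0 +i* y0 - (wr +i* wi)) * (0 +i* 1)).
      apply: P1; first by rewrite ler1n.
      by move=> t /andP[t0 t1]; rewrite rect_bottom //=; lra.
    by apply/eqP; rewrite eq_complex /=; apply/andP; split; apply/eqP; ring.
  by apply/eqP; rewrite eq_complex /=; apply/andP; split; apply/eqP; ring.
have {}P2 : log_primitive rect (wr +i* wi) 1 2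
    (clog ((x1 - wr) +i* (y1 - wi)) - clog ((x1 - wr) -i* (wi - y0))) K.
  rewrite E1 E2 in P2.
  rewrite (_ : (x1 - wr) +i* (y1 - wi) = (x1 +i* y1 - (wr +i* wi)) * 1).
    rewrite (_ : (x1 - wr) -i* (wi - y0) = (x1 +i* y0 - (wr +i* wi)) * 1).
      apply: P2; first by rewrite ler_nat.
      by move=> t ht; rewrite rect_right //=; lra.
    by apply/eqP; rewrite eq_complex /=; apply/andP; split; apply/eqP; ring.
  by apply/eqP; rewrite eq_complex /=; apply/andP; split; apply/eqP; ring.
have {}P3 : log_primitive rect (wr +i* wi) 2 3
    (clog ((y1 - wi) +i* (wr - x0)) - clog ((y1 - wi) -i* (x1 - wr))) K.
  rewrite E2 E3 in P3.
  rewrite (_ : (y1 - wi) +i* (wr - x0) = (x0 +i* y1 - (wr +i* wi)) * - (0 +i* 1)).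
    rewrite (_ : (y1 - wi) -i* (x1 - wr) = (x1 +i* y1 - (wr +i* wi)) * - (0 +i* 1)).
      apply: P3 => //; first by rewrite ler_nat.
      by move=> t ht; rewrite rect_top //=; lra.
    by apply/eqP; rewrite eq_complex /=; apply/andP; split; apply/eqP; ring.
  by apply/eqP; rewrite eq_complex /=; apply/andP; split; apply/eqP; ring.
have {}P4 : log_primitive rect (wr +i* wi) 3 4
    (clog ((wr - x0) +i* (wi - y0)) - clog ((wr - x0) -i* (y1 - wi))) K.
  rewrite E4 E3 in P4.
  rewrite (_ : (wr - x0) +i* (wi - y0) = (x0 +i* y0 - (wr +i* wi)) * - 1).
    rewrite (_ : (wr - x0) -i* (y1 - wi) = (x0 +i* y1 - (wr +i* wi)) * - 1).
      apply: P4 => //.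
      by move=> t /andP[ht _]; rewrite rect_left //=; lra.
    by apply/eqP; rewrite eq_complex /=; apply/andP; split; apply/eqP; ring.
  by apply/eqP; rewrite eq_complex /=; apply/andP; split; apply/eqP; ring.
have weak lo hi I (K1 K2 : R) : K1 <= K2 ->
    log_primitive rect (wr +i* wi) lo hi I K1 ->
    log_primitive rect (wr +i* wi) lo hi I K2.
  move=> K12 [G hG GI]; exists G => // a b ha ab hb.
  by apply: (le_trans (hG _ _ ha ab hb)); rewrite ler_wpM2r ?sqr_ge0.
pose Q : R := perim ^+ 2 / d ^+ 2.
have Q0 : 0 <= Q by [].
have KE : K = 2 * Q by rewrite /K /Q; ring.
have far' lo hi : 0 <= lo -> hi <= 4 ->
    forall t, lo <= t <= hi -> d <= cabs (rect t - (wr +i* wi)).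
  by move=> l0 h4 t /andP[? ?]; apply: far; apply/andP; split; lra.
have K0' : 0 <= K by rewrite KE; lra.
have KQ0 : 0 <= K + Q by rewrite KE; lra.
have m1 : 0 <= (1 : R) <= 2 by rewrite ler01 ler1n.
have m2 : 0 <= (2 : R) <= 4 by rewrite ler0n ler_nat.
have m3 : 2 <= (3 : R) <= 4 by rewrite !ler_nat.
have le24 : (2 : R) <= 4 by rewrite ler_nat.
have P12 := log_primitive_concat m1 d0 K0' B0 (far' _ _ (lexx _) le24)
  (sub _ _ (lexx _) le24) P1 P2.
have P34 := log_primitive_concat m3 d0 K0' B0 (far' _ _ (ler0n _ 2) (lexx _))
  (sub _ _ (ler0n _ 2) (lexx _)) P3 P4.
have P14 := log_primitive_concat m2 d0 KQ0 B0 (far' _ _ (lexx _) (lexx _))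
  (sub _ _ (lexx _) (lexx _)) P12 P34.
move: P14; set I := (X in log_primitive _ _ _ _ X _).
have -> : I = 0 +i* (2 * pi).
  transitivity
   ((clog ((wi - y0) +i* (x1 - wr)) - clog ((x1 - wr) -i* (wi - y0))) +
    (clog ((x1 - wr) +i* (y1 - wi)) - clog ((y1 - wi) -i* (x1 - wr))) +
    (clog ((y1 - wi) +i* (wr - x0)) - clog ((wr - x0) -i* (y1 - wi))) +
    (clog ((wr - x0) +i* (wi - y0)) - clog ((wi - y0) -i* (wr - x0)))).
    by rewrite /I; ring.
  have [a0 b0] : 0 < x1 - wr /\ 0 < wr - x0 by split; lra.
  have [p0 q0] : 0 < wi - y0 /\ 0 < y1 - wi by split; lra.
  rewrite !clog_quarter //.
  by apply/eqP; rewrite eq_complex /=; apply/andP; split; apply/eqP; field.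
by apply: weak; rewrite KE -mulrA -/Q; lra.
Qed.

End Rectangle.

(** * The circle *)
Section Circle.
Context {R : realType}.
Variables (c rho : R).
Hypothesis rho0 : 0 < rho.
Local Notation circ := (cpath (circle c rho)).

Let arm (t : R) : R[i] := (rho * cos t) +i* (rho * sin t).

Let circE t : circ t = c%:C + arm t.
Proof. by apply/eqP; rewrite eq_complex /= add0r !eqxx. Qed.

Let cabs_arm t : cabs (arm t) = rho.
Proof.
rewrite cabsE /= !exprMn -mulrDr cos2Dsin2 mulr1 sqrtr_sqr ger0_norm //.
exact: ltW.
Qed.

Let arm_neq0 t : arm t != 0.
Proof. by rewrite -cabs_gt0 cabs_arm. Qed.

Let arm_lip a b : a <= b -> cabs (arm b - arm a) <= 2 * rho * (b - a).
Proof.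
move=> ab; apply: (le_trans (cabs_le_ReIm _)) => /=.
rewrite -!mulrBr !normrM (ger0_norm (ltW rho0)).
have := cos_lip a b; have := sin_lip a b; rewrite (@ger0_norm _ (b - a)) ?subr_ge0 //.
by have := rho0; nra.
Qed.

(** First-order Taylor estimate of the complex exponential. *)
Let arm_taylor a b : a <= b ->
  cabs (arm b - arm a - (0 +i* (b - a)) * arm a) <= 2 * rho * (b - a) ^+ 2.
Proof.
move=> ab; apply: (le_trans (cabs_le_ReIm _)) => /=.
have h0 := rho0.
have ba : `|b - a| = b - a by rewrite ger0_norm // subr_ge0.
have [x hx ex] := mvt_affine a b (@is_derive_cos R).
have [y hy ey] := mvt_affine a b (@is_derive_sin R).
have sx := le_trans (sin_lip a x) hx; have cy := le_trans (cos_lip a y) hy.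
rewrite ba in sx cy.
have -> : rho * cos b - rho * cos a - (0 * (rho * cos a) - (b - a) * (rho * sin a)) =
    - (rho * (b - a) * (sin x - sin a)).
  rewrite (_ : rho * cos b - rho * cos a = rho * (cos b - cos a)); last by ring.
  by rewrite ex; ring.
have -> : rho * sin b - rho * sin a - (0 * (rho * sin a) + (b - a) * (rho * cos a)) =
    rho * (b - a) * (cos y - cos a).
  rewrite (_ : rho * sin b - rho * sin a = rho * (sin b - sin a)); last by ring.
  by rewrite ey; ring.
have rb : 0 <= rho * (b - a) by rewrite mulr_ge0 ?subr_ge0 // ltW.
rewrite normrN (normrM _ (sin x - _)) (normrM _ (cos y - _)) (ger0_norm rb).
have := ler_wpM2l rb sx; have := ler_wpM2l rb cy; nra.
Qed.

Lemma circle_lip : lip_on circ 0 (2 * pi) (2 * rho).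
Proof.
by move=> a b _ ab _; rewrite !circE opprD addrACA subrr add0r arm_lip.
Qed.

Lemma circle_closed : circ 0 = circ (2 * pi).
Proof. by rewrite !circE /arm mulr_natl cos2pi sin2pi cos0 sin0. Qed.

Lemma circle_supported : supported circ (2 * pi) c%:C rho.
Proof.
move=> s _; have cs := cos2Dsin2 s.
exists (- (cos s -i* sin s)); split => [|t _|].
- by rewrite cabsN cabsE /= sqrrN cos2Dsin2 sqrtr1.
- rewrite (_ : Re _ = rho * (1 - cos (t - s))).
    by rewrite mulr_ge0 ?subr_ge0 ?cos_le1 // ltW.
  by rewrite cosB /= -[1 in RHS]cs; ring.
- rewrite (_ : Re _ = rho * (cos s ^+ 2 + sin s ^+ 2)); first by rewrite cs mulr1.
  by rewrite /=; ring.
Qed.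

(** [1 / (z - w)] is the sum of [1 / (z - c)], whose primitive along the circle
    is [i t], and of the logarithmic derivative of [1 - (w - c) / (z - c)], which
    stays in the right half-plane. *)
Lemma circle_winding_inside (d : R) w : 0 < d -> cabs (w - c%:C) <= rho - d ->
  winding circ (2 * pi) w (0 +i* (2 * pi))
    ((2 + 8 * rho ^+ 2 / d ^+ 2 + 4 * rho / d) * (2 * pi) ^+ 2).
Proof.
move=> d0 wd; have h0 := rho0.
apply: log_primitive_winding; first by rewrite mulr_ge0 // pi_ge0.
set o := w - c%:C in wd.
have o_ge0 := cabs_ge0 o.
pose u t : R[i] := 1 - o / arm t.
have Reu t : d / rho <= Re (u t).
  rewrite /u ReB /=; have := Re_le_cabs (o / arm t).
  rewrite cabsM cabsV cabs_arm => h1; have h2 := le_trans (ler_norm _) h1.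
  have h3 : cabs o / rho <= (rho - d) / rho by rewrite ler_wpM2r ?invr_ge0 // ltW.
  rewrite mulrBl divff ?gt_eqF // in h3; lra.
have dr0 : 0 < d / rho by rewrite divr_gt0.
have u0 t : u t != 0.
  rewrite -cabs_gt0 (lt_le_trans dr0) // (le_trans (Reu t)) //.
  by rewrite (le_trans (ler_norm _)) // Re_le_cabs.
have ao t : d <= cabs (arm t - o).
  have := cabsD (arm t - o) o; rewrite subrK cabs_arm => ?; lra.
have ao0 t : arm t - o != 0 by rewrite -cabs_gt0 (lt_le_trans d0).
exists (fun t => 0 +i* t + clog (u t)); last first.
  rewrite /u /arm mulr_natl cos2pi sin2pi cos0 sin0 opprD addrACA subrr addr0.
  by apply/eqP; rewrite eq_complex /= !subr0 !eqxx.
move=> a b a0 ab b2.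
have sq : 0 <= b - a by rewrite subr_ge0.
have al := arm_lip ab; have al0 := cabs_ge0 (arm b - arm a).
have t1 : cabs (0 +i* (b - a) - (arm b - arm a) / arm a) <= 2 * (b - a) ^+ 2.
  rewrite (_ : _ - _ = - (arm b - arm a - (0 +i* (b - a)) * arm a) / arm a); last first.
    by field.
  rewrite cabsM cabsN cabsV cabs_arm ler_pdivrMr // mulrAC.
  exact: arm_taylor.
have du : u b - u a = o * (arm b - arm a) / (arm a * arm b).
  by rewrite /u; field; rewrite !arm_neq0.
have t2 : cabs (clog (u b) - clog (u a) - (u b - u a) / u a) <=
    8 * rho ^+ 2 / d ^+ 2 * (b - a) ^+ 2.
  apply: (le_trans (clog_increment dr0 (Reu a) (Reu b))).
  have hu : cabs (u b - u a) <= 2 * (b - a).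
    rewrite du cabsM cabsV !cabsM !cabs_arm ler_pdivrMr ?mulr_gt0 //.
    apply: (@le_trans _ _ (rho * (2 * rho * (b - a)))); last by nra.
    by apply: ler_pM => //; lra.
  rewrite (_ : 8 * rho ^+ 2 / d ^+ 2 * (b - a) ^+ 2 =
     2 / (d / rho) ^+ 2 * (2 * (b - a)) ^+ 2); last by field; rewrite !gt_eqF.
  apply: ler_wpM2l; first by rewrite divr_ge0 ?exprn_ge0 // ltW.
  by rewrite ler_pXn2r ?nnegrE ?cabs_ge0 // mulr_ge0.
have t3 : cabs (o * (arm b - arm a) ^+ 2 / ((arm a - o) * (arm a * arm b))) <=
    4 * rho / d * (b - a) ^+ 2.
  rewrite cabsM cabsV !cabsM !cabs_arm.
  rewrite ler_pdivrMr; last by rewrite !mulr_gt0 // (lt_le_trans d0).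
  rewrite (_ : 4 * rho / d * _ * _ =
    rho * (2 * rho * (b - a)) ^+ 2 * (cabs (arm a - o) / d)); last first.
    by field; rewrite gt_eqF.
  have q1 : 1 <= cabs (arm a - o) / d by rewrite ler_pdivlMr // mul1r.
  apply: (@le_trans _ _ (rho * (2 * rho * (b - a)) ^+ 2)).
    apply: ler_pM => //; first by rewrite mulr_ge0.
      lra.
    by rewrite -expr2 ler_pXn2r ?nnegrE // mulr_ge0 // mulr_ge0 // ltW.
  by rewrite ler_peMr // mulr_ge0 ?sqr_ge0 // ltW.
rewrite (_ : _ - _ = (0 +i* (b - a) - (arm b - arm a) / arm a) +
   (clog (u b) - clog (u a) - (u b - u a) / u a) -
   o * (arm b - arm a) ^+ 2 / ((arm a - o) * (arm a * arm b))).
  have := cabsD ((0 +i* (b - a) - (arm b - arm a) / arm a) +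
   (clog (u b) - clog (u a) - (u b - u a) / u a))
   (- (o * (arm b - arm a) ^+ 2 / ((arm a - o) * (arm a * arm b)))).
  have := cabsD (0 +i* (b - a) - (arm b - arm a) / arm a)
   (clog (u b) - clog (u a) - (u b - u a) / u a).
  rewrite cabsN; lra.
have -> : circ b - circ a = arm b - arm a by rewrite !circE opprD addrACA subrr add0r.
have -> : circ a - w = arm a - o.
  by rewrite circE /o; ring.
have -> : (u b - u a) / u a = o * (arm b - arm a) / (arm b * (arm a - o)).
  rewrite du /u; field; rewrite arm_neq0 arm_neq0 ao0 /=.
  by [].
have -> : 0 +i* (b - a) = 0 +i* b - 0 +i* a.
  by apply/eqP; rewrite eq_complex /= subrr !eqxx.
by field; rewrite !arm_neq0 ao0.
Qed.

End Circle.

(** * Coordinates in an orthonormal basis *)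
Section OrthonormalBasis.
Context {R : realType} {H : completeNormedModType R[i]}.
Variable ip : {dot H for (@Num.conj R[i])}.
Hypothesis ip_norm : forall x : H, ip x x = `|x| ^+ 2.
Variable psi : nat -> H.
Hypothesis psi_basis : orthonormal_basis ip psi.
Implicit Types (x y u v : H) (c : nat -> R[i]).

Lemma ipC u v : ip u v = (ip v u)^*.
Proof. by have := hermC ip u v; rewrite /= expr0 mul1r. Qed.

Lemma ipDl u v w : ip (u + v) w = ip u w + ip v w.
Proof. exact: linearDl. Qed.

Lemma ipBl u v w : ip (u - v) w = ip u w - ip v w.
Proof. exact: linearBl. Qed.

Lemma ipBr u v w : ip w (u - v) = ip w u - ip w v.
Proof. exact: linearBr. Qed.

Lemma ipZl (a : R[i]) u w : ip (a *: u) w = a * ip u w.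
Proof. exact: linearZl_LR. Qed.

Lemma ipZr (a : R[i]) u w : ip w (a *: u) = a^* * ip w u.
Proof. by rewrite linearZr_LR. Qed.

Lemma ip_suml (I : Type) (r : seq I) (P : pred I) (F : I -> H) w :
  ip (\sum_(i <- r | P i) F i) w = \sum_(i <- r | P i) ip (F i) w.
Proof.
by elim/big_rec2: _ => [|i a b _ <-]; rewrite ?linear0l // ipDl.
Qed.

Lemma ip_sqr x : ip x x = (nrm x ^+ 2)%:C.
Proof. by rewrite ip_norm nrmE !expr2 rmorphM. Qed.

Lemma mul_conj (z : R[i]) : z * z^* = (cabs z ^+ 2)%:C.
Proof.
have -> : z * z^* = `|z| ^+ 2 by rewrite sqr_normc.
by rewrite normc_cabs !expr2 rmorphM.
Qed.

(** Nonnegativity of [ip (u - a *: v) (u - a *: v)] at the minimizing [a]. *)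
Lemma cauchy_schwarz u v : cabs (ip u v) <= nrm u * nrm v.
Proof.
have [->|v0] := eqVneq v 0; first by rewrite linear0r cabs0 nrm0 mulr0.
have nv : 0 < nrm v by rewrite lt_def nrm_ge0 nrm_eq0 v0.
pose a := ip u v * ((nrm v ^+ 2)^-1)%:C.
have nv0 : nrm v ^+ 2 != 0 by rewrite gt_eqF // exprn_gt0.
have : ip (u - a *: v) (u - a *: v) =
    (nrm u ^+ 2)%:C - ip u v * (ip u v)^* * ((nrm v ^+ 2)^-1)%:C.
  rewrite ipBl !ipBr !ipZl !ipZr (ipC v u) !ip_sqr.
  have aC : a^* = (ip u v)^* * ((nrm v ^+ 2)^-1)%:C.
    by rewrite /a rmorphM; congr (_ * _); exact: conjc_real.
  have VV : ((nrm v ^+ 2)^-1)%:C * (nrm v ^+ 2)%:C = 1 :> R[i].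
    by rewrite -rmorphM mulVf.
  rewrite aC /a; move: (ip u v) ((ip u v)^*) ((nrm v ^+ 2)%:C) VV.
  move: (((nrm v ^+ 2)^-1)%:C) ((nrm u ^+ 2)%:C) => W U p q V VV.
  rewrite (_ : p * W * (q * W * V) = p * W * q * (W * V)); last by ring.
  by rewrite VV; ring.
rewrite ip_sqr mul_conj -rmorphM -rmorphB => /complexI h.
have : 0 <= nrm u ^+ 2 - cabs (ip u v) ^+ 2 / nrm v ^+ 2 by rewrite -h sqr_ge0.
rewrite subr_ge0 ler_pdivrMr ?exprn_gt0 // -exprMn.
by rewrite ler_pXn2r ?nnegrE ?cabs_ge0 // mulr_ge0 ?nrm_ge0.
Qed.

Definition fcoord x n : R[i] := ip x (psi n).

Definition vsum c n : H := \sum_(1 <= k < n.+1) c k *: psi k.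

Lemma co_psi m n : (0 < m)%N -> (0 < n)%N -> fcoord (psi m) n = (m == n)%:R.
Proof. by case: psi_basis => h _; exact: h. Qed.

Lemma sum_delta c m n j : (0 < m)%N -> (0 < j)%N ->
  \sum_(m <= k < n) c k * (k == j)%:R = if (m <= j < n)%N then c j else 0.
Proof.
move=> m0 j0; case: ifP => hj.
  rewrite (bigD1_seq j) ?mem_index_iota ?iota_uniq //= eqxx mulr1 big1 ?addr0 // => k kj.
  by rewrite (negbTE kj) mulr0.
rewrite big_seq big1 // => k; rewrite mem_index_iota => hk.
by case: eqP hk hj => [->->|] //; rewrite mulr0.
Qed.

Lemma co_sum c m n j : (0 < m)%N -> (0 < j)%N ->
  fcoord (\sum_(m <= k < n) c k *: psi k) j = if (m <= j < n)%N then c j else 0.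
Proof.
move=> m0 j0; rewrite -(@sum_delta c) // /fcoord ip_suml.
apply: eq_big_nat => k /andP[mk _].
by rewrite ipZl -/(fcoord _ _) co_psi // (leq_trans m0).
Qed.

Lemma co_vsum c n j : (0 < j)%N -> fcoord (vsum c n) j = if (j <= n)%N then c j else 0.
Proof. by move=> j0; rewrite co_sum // j0 ltnS. Qed.

Lemma ip_sum_r x c m n :
  ip x (\sum_(m <= k < n) c k *: psi k) = \sum_(m <= k < n) (c k)^* * fcoord x k.
Proof.
rewrite ipC ip_suml rmorph_sum /=; apply: eq_bigr => k _.
by rewrite ipZl rmorphM /fcoord (ipC x (psi k)).
Qed.

Lemma nrm_sum_sqr c m n : (0 < m)%N ->
  nrm (\sum_(m <= k < n) c k *: psi k) ^+ 2 = \sum_(m <= k < n) cabs (c k) ^+ 2.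
Proof.
move=> m0; apply: complexI; rewrite -ip_sqr ip_sum_r rmorph_sum /=.
apply: eq_big_nat => k hk; rewrite co_sum //; last first.
  by move: hk => /andP[+ _]; exact: leq_trans.
by rewrite hk mulrC mul_conj.
Qed.

Lemma vsum_cvg x (e : R) : 0 < e ->
  exists m, forall n, (m <= n)%N -> nrm (vsum (fcoord x) n - x) <= e.
Proof. by case: psi_basis => _ h e0; have := cvg_nrm (h x) e0; exact. Qed.

(** [ip x v] equals [nrm v ^+ 2] for the partial sum [v], so that [cauchy_schwarz]
    gives the bound. *)
Lemma nrm_vsum_le x n : nrm (vsum (fcoord x) n) <= nrm x.
Proof.
set v := vsum _ n.
have e : ip x v = (nrm v ^+ 2)%:C.
  rewrite ip_sum_r nrm_sum_sqr // rmorph_sum; apply: eq_bigr => k _.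
  by rewrite mulrC mul_conj.
have := cauchy_schwarz x v; rewrite e cabs_real ger0_norm ?sqr_ge0 //.
have := nrm_ge0 v; rewrite le_eqVlt => /predU1P[<- _|v0]; first exact: nrm_ge0.
by rewrite expr2 ler_pM2r.
Qed.

Lemma bessel x n : \sum_(1 <= k < n.+1) cabs (fcoord x k) ^+ 2 <= nrm x ^+ 2.
Proof.
by rewrite -nrm_sum_sqr // ler_pXn2r ?nnegrE ?nrm_ge0 // nrm_vsum_le.
Qed.

Lemma nrm_le_co x (B : R) : 0 <= B ->
  (forall n, \sum_(1 <= k < n.+1) cabs (fcoord x k) ^+ 2 <= B ^+ 2) -> nrm x <= B.
Proof.
move=> B0 h; apply/ler_addgt0Pl => e e0.
have [m hm] := vsum_cvg x e0; have := hm m (leqnn _) => h1.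
have h2 : nrm (vsum (fcoord x) m) <= B.
  by have := h m; rewrite -nrm_sum_sqr // ler_pXn2r ?nnegrE ?nrm_ge0.
have := nrmB (vsum (fcoord x) m) (vsum (fcoord x) m - x).
rewrite opprB addrC subrK; lra.
Qed.

Lemma co_inj x y : (forall k, (0 < k)%N -> fcoord x k = fcoord y k) -> x = y.
Proof.
move=> h; apply/eqP; rewrite -subr_eq0; apply/eqP/nrm_le0/nrm_le_co => // n.
rewrite expr0n big_seq big1 // => k; rewrite mem_index_iota => /andP[k0 _].
by rewrite /fcoord ipBl -!/(fcoord _ _) h // subrr cabs0 expr0n.
Qed.

(** With [S n] the partial sums of the squares, the distance of the [n]-th and the
    [m]-th partial sums is at most the square root of [sup S - S n]. *)
Lemma riesz_fischer c (B : R) :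
  (forall n, \sum_(1 <= k < n.+1) cabs (c k) ^+ 2 <= B) ->
  exists x, forall k, (0 < k)%N -> fcoord x k = c k.
Proof.
move=> hB; pose S n : R := \sum_(1 <= k < n.+1) cabs (c k) ^+ 2.
have S_split n m : (n <= m)%N -> S m = S n + \sum_(n.+1 <= k < m.+1) cabs (c k) ^+ 2.
  by move=> nm; rewrite /S (@big_cat_nat _ _ _ n.+1).
have S_mono n m : (n <= m)%N -> S n <= S m.
  by move=> /S_split ->; rewrite lerDl sumr_ge0 // => k _; rewrite sqr_ge0.
pose A := [set S n | n in [set: nat]].
have Asup : has_sup A.
  by split; [exists (S 0%N); exists 0%N | exists B => _ [n _ <-]; exact: hB].
have SA n : S n <= sup A by apply: ub_le_sup; [case: Asup | exists n].
have [|d d0|x hx] := @complete_lim _ _ (vsum c) (fun n => Num.sqrt (sup A - S n)).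
- move=> n m nm.
  have -> : vsum c m - vsum c n = \sum_(n.+1 <= k < m.+1) c k *: psi k.
    by rewrite /vsum (@big_cat_nat _ _ _ n.+1 1 m.+1) //= addrAC subrr add0r.
  rewrite -(@ler_pXn2r _ 2) ?nnegrE ?nrm_ge0 ?sqrtr_ge0 // sqr_sqrtr ?subr_ge0 //.
  rewrite nrm_sum_sqr // lerBrDl -S_split //.
- have d2 : 0 < d ^+ 2 by rewrite exprn_gt0.
  have [_ [n _ <-] hn] := sup_adherent d2 Asup; exists n.
  rewrite -(@ler_pXn2r _ 2) ?nnegrE ?sqrtr_ge0 ?(ltW d0) // sqr_sqrtr ?subr_ge0 //.
  by lra.
exists x => k k0; apply/eqP; rewrite -subr_eq0 -cabs_eq0 eq_le cabs_ge0 andbT.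
apply/ler_addgt0Pl => e e0; rewrite addr0.
have e2 : 0 < e ^+ 2 by rewrite exprn_gt0.
have [_ [n _ <-] hn] := sup_adherent e2 Asup.
pose m := maxn n k.
have -> : fcoord x k - c k = ip (x - vsum c m) (psi k).
  by rewrite ipBl -!/(fcoord _ _) co_vsum // leq_maxr.
have p1 : nrm (psi k) = 1.
  apply/eqP; rewrite -(@eqrXn2 _ 2) ?nrm_ge0 // expr1n; apply/eqP/complexI.
  by rewrite -ip_sqr -/(fcoord _ _) co_psi // eqxx.
have := cauchy_schwarz (x - vsum c m) (psi k); rewrite p1 mulr1 nrm_distC => h1.
apply: (le_trans h1); apply: (le_trans (hx m)).
rewrite -(@ler_pXn2r _ 2) ?nnegrE ?sqrtr_ge0 ?(ltW e0) // sqr_sqrtr ?subr_ge0 //.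
have := S_mono n m (leq_maxl _ _); lra.
Qed.

Lemma ip_cvg x y (e : R) : 0 < e -> exists m, forall n, (m <= n)%N ->
  cabs (ip x y - \sum_(1 <= k < n.+1) fcoord x k * (fcoord y k)^*) <= e.
Proof.
move=> e0; have e1 : 0 < e / (nrm x + 1) by rewrite divr_gt0 //; have := nrm_ge0 x; lra.
have [m hm] := vsum_cvg y e1; exists m => n /hm h.
have -> : \sum_(1 <= k < n.+1) fcoord x k * (fcoord y k)^* = ip x (vsum (fcoord y) n).
  by rewrite ip_sum_r; apply: eq_bigr => k _; rewrite mulrC.
rewrite -ipBr; apply: (le_trans (cauchy_schwarz _ _)); rewrite nrm_distC.
apply: (le_trans (ler_wpM2l (nrm_ge0 x) h)).
have := nrm_ge0 x => x0; rewrite mulrA ler_pdivrMr; last by lra.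
nra.
Qed.

(** Parseval: inner products are determined by products of coordinates. *)
Lemma ip_eq x y x' y' :
  (forall k, (0 < k)%N -> fcoord x k * (fcoord y k)^* = fcoord x' k * (fcoord y' k)^*) ->
  ip x y = ip x' y'.
Proof.
move=> h; apply/eqP; rewrite -subr_eq0 -cabs_eq0 eq_le cabs_ge0 andbT.
apply/ler_addgt0Pl => e e0; rewrite addr0.
have e2 : 0 < e / 2 by rewrite divr_gt0.
have [m hm] := ip_cvg x y e2; have [m' hm'] := ip_cvg x' y' e2.
have h1 := hm (maxn m m') (leq_maxl _ _); have h2 := hm' (maxn m m') (leq_maxr _ _).
have E : \sum_(1 <= k < (maxn m m').+1) fcoord x k * (fcoord y k)^* =
    \sum_(1 <= k < (maxn m m').+1) fcoord x' k * (fcoord y' k)^*.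
  by apply: eq_big_nat => k /andP[/h].
rewrite E in h1; rewrite cabs_distC in h2; move: h1 h2; set s := \sum_(1 <= k < _) _ => h1 h2.
have := cabsD (ip x y - s) (s - ip x' y'); rewrite addrA subrK.
lra.
Qed.

(** Meaningful for square-summable [c] only. *)
Definition vec_of_coord c : H := xget 0 [set x | forall k, (0 < k)%N -> fcoord x k = c k].

Lemma co_vec c (B : R) :
  (forall n, \sum_(1 <= k < n.+1) cabs (c k) ^+ 2 <= B) ->
  forall k, (0 < k)%N -> fcoord (vec_of_coord c) k = c k.
Proof.
move=> /riesz_fischer[x hx]; rewrite /vec_of_coord.
have ex : exists y, [set y | forall k, (0 < k)%N -> fcoord y k = c k] y by exists x.
exact: (xgetPex 0 ex).
Qed.

Lemma nrm_vec_le c (B : R) : 0 <= B ->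
  (forall n, \sum_(1 <= k < n.+1) cabs (c k) ^+ 2 <= B ^+ 2) -> nrm (vec_of_coord c) <= B.
Proof.
move=> B0 hB; apply: nrm_le_co => // n.
apply: le_trans (hB n); rewrite le_eqVlt; apply/orP; left; apply/eqP.
apply: eq_big_nat => k /andP[k0 _].
by rewrite (co_vec hB).
Qed.

End OrthonormalBasis.

(** * Bounded perturbations of the identity *)
Section NeumannSeries.
Context {R : realType} {H : completeNormedModType R[i]}.

(** The iteration [v (n + 1) = x + T (v n)], which stays bounded and contracts. *)
Lemma neumann (T : H -> H) (q : R) : linear T -> 0 <= q -> q < 1 ->
  (forall x, nrm (T x) <= q * nrm x) -> forall x, exists y, y - T y = x.
Proof.
move=> lT q0 q1 Tq x.
pose v := fix v n : H := if n is m.+1 then x + T (v m) else 0.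
pose A := nrm x / (1 - q).
have q1' : 0 < 1 - q by lra.
have A0 : 0 <= A by rewrite divr_ge0 ?nrm_ge0 // ltW.
have AE : nrm x + q * A = A by rewrite /A; field; rewrite gt_eqF.
have vA n : nrm (v n) <= A.
  elim: n => [|n ih] /=; first by rewrite nrm0.
  rewrite -AE (le_trans (nrmD _ _)) // lerD2l (le_trans (Tq _)) //.
  by rewrite ler_wpM2l.
have vn n k : nrm (v (n + k)%N - v n) <= q ^+ n * A.
  elim: n => [|n ih] /=; first by rewrite add0n subr0 expr0 mul1r.
  rewrite opprD addrACA subrr add0r -linear_funB // exprS -mulrA.
  by rewrite (le_trans (Tq _)) // ler_wpM2l.
have small (d : R) : 0 < d -> exists n, q ^+ n * A <= d.
  move=> d0; have d1 : 0 < d / (A + 1) by rewrite divr_gt0 //; lra.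
  have /cvgrPdist_le /(_ _ d1)[n _ /(_ n (leqnn _))] : (fun n => q ^+ n) @ \oo --> (0 : R).
    by apply: cvg_expr; rewrite ger0_norm.
  rewrite /= sub0r normrN ger0_norm ?exprn_ge0 // ler_pdivlMr; last by lra.
  by move=> h; exists n; apply: le_trans h; rewrite ler_wpM2l ?exprn_ge0 //; lra.
have [|//|y hy] := @complete_lim _ _ v (fun n => q ^+ n * A).
  by move=> n m /subnKC <-.
exists y; apply/eqP; rewrite -subr_eq0; apply/eqP/nrm_small => e e0.
have [n hn] := small _ (divr_gt0 e0 (ltr0n R 2)).
have -> : y - T y - x = T (v n - y) - (v n.+1 - y).
  rewrite linear_funB //=; move: (T (v n)) (T y) => a b.
  by rewrite opprB (addrC x) opprD !addrA (addrAC (a - b)) (addrAC a) subrr add0r (addrC (- b)).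
apply: (le_trans (nrmB _ _)).
have h1 := hy n; have h2 := hy n.+1; have h3 := Tq (v n - y).
have h4 : q ^+ n.+1 * A <= q ^+ n * A.
  by rewrite exprS ler_wpM2r // ler_piMl ?exprn_ge0 // ltW.
have h5 : q * nrm (v n - y) <= nrm (v n - y) by rewrite ler_piMl ?nrm_ge0 // ltW.
lra.
Qed.

Lemma neumann_le (T : H -> H) (q : R) y : q < 1 ->
  (forall x, nrm (T x) <= q * nrm x) -> nrm y <= nrm (y - T y) / (1 - q).
Proof.
move=> q1 Tq; rewrite ler_pdivlMr ?subr_gt0 //.
have := nrmD (y - T y) (T y); rewrite subrK; have := Tq y; lra.
Qed.

End NeumannSeries.

(** * The resolvent of a perturbed diagonal operator *)

Section PerturbedDiagonal.
Context {R : realType} {H : completeNormedModType R[i]}.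
Variable ip : {dot H for (@Num.conj R[i])}.
Hypothesis ip_norm : forall x : H, ip x x = `|x| ^+ 2.
Variable psi : nat -> H.
Hypothesis psi_basis : orthonormal_basis ip psi.
Local Notation co := (fcoord ip psi).
Local Notation vec := (vec_of_coord ip psi).
Implicit Types (x y u v : H).

Definition diag (d : nat -> R[i]) x : H := vec (fun k => d k * co x k).

Definition bounded_seq (d : nat -> R[i]) (K : R) : Prop :=
  0 <= K /\ forall k, (0 < k)%N -> cabs (d k) <= K.

Lemma diag_sqr_sum d K x : bounded_seq d K ->
  forall n, \sum_(1 <= k < n.+1) cabs (d k * co x k) ^+ 2 <= (K * nrm x) ^+ 2.
Proof.
move=> [K0 dK] n; rewrite exprMn.
apply: (@le_trans _ _ (\sum_(1 <= k < n.+1) K ^+ 2 * cabs (co x k) ^+ 2)).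
  rewrite big_nat [leRHS]big_nat; apply: ler_sum => k /andP[k0 _].
  rewrite cabsM exprMn ler_wpM2r ?sqr_ge0 // ler_pXn2r ?nnegrE ?cabs_ge0 //.
  exact: dK.
by rewrite -mulr_sumr ler_wpM2l ?sqr_ge0 // bessel.
Qed.

Lemma co_diag d K x k : bounded_seq d K -> (0 < k)%N ->
  co (diag d x) k = d k * co x k.
Proof. by move=> dK k0; rewrite (co_vec ip_norm psi_basis (diag_sqr_sum x dK)). Qed.

Lemma nrm_diag d K x : bounded_seq d K -> nrm (diag d x) <= K * nrm x.
Proof.
move=> dK; apply: (nrm_vec_le ip_norm psi_basis); last exact: diag_sqr_sum.
by have [K0 _] := dK; rewrite mulr_ge0 ?nrm_ge0.
Qed.

Lemma coP (a : R[i]) x y k : co (a *: x + y) k = a * co x k + co y k.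
Proof. by rewrite /fcoord ipDl ipZl. Qed.

Lemma diag_linear d K : bounded_seq d K -> linear (diag d).
Proof.
move=> dK a x y; apply: (co_inj ip_norm psi_basis) => k k0.
by rewrite coP !(co_diag _ dK) // coP; ring.
Qed.

Variables (mu p : nat -> R) (Mb c0 : R) (beta : nat -> nat -> R[i]).
Hypothesis mu_ge1 : forall n, (0 < n)%N -> 1 <= mu n.
Hypothesis p_gt0 : forall n, (0 < n)%N -> 0 < p n.
Hypothesis Mb_ge0 : 0 <= Mb.
Hypothesis beta_le : forall m n, (0 < m)%N -> (0 < n)%N ->
  cabs (beta m n) <= Mb / (p m * p n).
Hypothesis c0_le : forall n, \sum_(1 <= k < n.+1) (p k ^+ 2 * mu k)^-1 <= c0.

Let smu k : R := Num.sqrt (mu k).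

Let smu_ge1 k : (0 < k)%N -> 1 <= smu k.
Proof. by move=> k0; rewrite /smu -sqrtr1 ler_wsqrtr // mu_ge1. Qed.

Let smu_sqr k : (0 < k)%N -> smu k ^+ 2 = mu k.
Proof. by move=> k0; rewrite sqr_sqrtr // (le_trans ler01) // mu_ge1. Qed.

Let c0_ge0 : 0 <= c0.
Proof. by have := c0_le 0; rewrite big_geq. Qed.

Let dG k : R[i] := (smu k)^-1%:C.

Let dG_bounded : bounded_seq dG 1.
Proof.
split=> // k k0; have s1 := smu_ge1 k0.
by rewrite cabs_real ger0_norm ?invr_ge0 ?invf_le1 //; lra.
Qed.

(** [A ^ (-1/2)]; the unbounded operators below are studied through the bounded
    ones obtained by putting this factor on both sides. *)
Definition rootinv : H -> H := diag dG.
Local Notation G := rootinv.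

Lemma co_rootinv x k : (0 < k)%N -> co (G x) k = ((Num.sqrt (mu k))^-1)%:C * co x k.
Proof. exact: co_diag dG_bounded. Qed.

Lemma nrm_rootinv x : nrm (G x) <= nrm x.
Proof. by have := nrm_diag x dG_bounded; rewrite mul1r. Qed.

Lemma rootinv_linear : linear G. Proof. exact: diag_linear dG_bounded. Qed.

(** The coordinates of [kvec n] are such that [ip y (kvec n)] is the value of
    the form at [G y] and the [n]-th basis vector. *)
Definition kvec n : H := vec (fun j => (beta j n)^* * dG j).

Let kvec_sum n : (0 < n)%N -> forall m,
  \sum_(1 <= j < m.+1) cabs ((beta j n)^* * dG j) ^+ 2 <= (Mb / p n * Num.sqrt c0) ^+ 2.
Proof.
move=> n0 m; rewrite exprMn sqr_sqrtr //.
apply: (@le_trans _ _ (\sum_(1 <= j < m.+1) (Mb / p n) ^+ 2 * (p j ^+ 2 * mu j)^-1)).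
  rewrite big_nat [leRHS]big_nat; apply: ler_sum => j /andP[j0 _].
  have pj := p_gt0 j0; have pn := p_gt0 n0; have s1 := smu_ge1 j0.
  have -> : (Mb / p n) ^+ 2 * (p j ^+ 2 * mu j)^-1 = (Mb / (p j * p n) * (smu j)^-1) ^+ 2.
    by rewrite -smu_sqr //; field; rewrite !gt_eqF //; lra.
  rewrite cabsM cabs_conj cabs_real ger0_norm ?invr_ge0; last by lra.
  have i0 : 0 <= (smu j)^-1 by rewrite invr_ge0; lra.
  rewrite ler_pXn2r ?nnegrE ?mulr_ge0 ?cabs_ge0 //.
    by rewrite ler_wpM2r // beta_le.
  by rewrite invr_ge0 mulr_ge0 // ltW.
by rewrite -mulr_sumr ler_wpM2l ?sqr_ge0.
Qed.

Lemma co_kvec n j : (0 < n)%N -> (0 < j)%N ->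
  co (kvec n) j = (beta j n)^* * ((Num.sqrt (mu j))^-1)%:C.
Proof. by move=> n0 j0; rewrite (co_vec ip_norm psi_basis (kvec_sum n0)). Qed.

Lemma nrm_kvec n : (0 < n)%N -> nrm (kvec n) <= Mb / p n * Num.sqrt c0.
Proof.
move=> n0; apply: (nrm_vec_le ip_norm psi_basis) (kvec_sum n0).
by rewrite !mulr_ge0 ?invr_ge0 ?sqrtr_ge0 // ltW // p_gt0.
Qed.

(** [G B G] for the operator [B] of the perturbing form. *)
Definition bop y : H := vec (fun n => dG n * ip y (kvec n)).

Let bop_sum y m :
  \sum_(1 <= n < m.+1) cabs (dG n * ip y (kvec n)) ^+ 2 <= (Mb * c0 * nrm y) ^+ 2.
Proof.
apply: (@le_trans _ _ (\sum_(1 <= n < m.+1) Mb ^+ 2 * c0 * nrm y ^+ 2 * (p n ^+ 2 * mu n)^-1)).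
  rewrite big_nat [leRHS]big_nat; apply: ler_sum => n /andP[n0 _].
  have pn := p_gt0 n0; have s1 := smu_ge1 n0.
  have -> : Mb ^+ 2 * c0 * nrm y ^+ 2 * (p n ^+ 2 * mu n)^-1 =
      ((smu n)^-1 * (nrm y * (Mb / p n * Num.sqrt c0))) ^+ 2.
    rewrite -smu_sqr // -[in LHS](sqr_sqrtr c0_ge0); field.
    by rewrite !gt_eqF //; lra.
  have i0 : 0 <= (smu n)^-1 by rewrite invr_ge0; lra.
  have r0 : 0 <= nrm y * (Mb / p n * Num.sqrt c0).
    by rewrite mulr_ge0 ?nrm_ge0 // mulr_ge0 ?sqrtr_ge0 // divr_ge0 // ltW.
  rewrite cabsM cabs_real ger0_norm //.
  have l0 : 0 <= (smu n)^-1 * cabs (ip y (kvec n)) by rewrite mulr_ge0 ?cabs_ge0.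
  have r1 := mulr_ge0 i0 r0.
  rewrite ler_pXn2r ?nnegrE //.
  rewrite ler_wpM2l // (le_trans (cauchy_schwarz ip_norm _ _)) //.
  by rewrite ler_wpM2l ?nrm_ge0 // nrm_kvec.
rewrite -mulr_sumr (_ : (Mb * c0 * nrm y) ^+ 2 = Mb ^+ 2 * c0 * nrm y ^+ 2 * c0); last by ring.
by rewrite ler_wpM2l ?c0_le // mulr_ge0 ?sqr_ge0 // mulr_ge0 ?sqr_ge0.
Qed.

Lemma co_bop y n : (0 < n)%N ->
  co (bop y) n = ((Num.sqrt (mu n))^-1)%:C * ip y (kvec n).
Proof. by move=> n0; rewrite (co_vec ip_norm psi_basis (bop_sum y)). Qed.

Lemma nrm_bop y : nrm (bop y) <= Mb * c0 * nrm y.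
Proof.
by apply: (nrm_vec_le ip_norm psi_basis) (bop_sum y); rewrite !mulr_ge0 ?nrm_ge0.
Qed.

Lemma bop_linear : linear bop.
Proof.
move=> a x y; apply: (co_inj ip_norm psi_basis) => k k0.
by rewrite coP !co_bop // ipDl ipZl; ring.
Qed.

(** [G (z - A - s B) G], a bounded operator. *)
Definition pencil (s : R) (z : R[i]) y : H := z *: G (G y) - y - s%:C *: bop y.

Lemma co_pencil s z y k : (0 < k)%N -> co (pencil s z y) k =
  (z / (mu k)%:C - 1) * co y k - s%:C * (((Num.sqrt (mu k))^-1)%:C * ip y (kvec k)).
Proof.
move=> k0; rewrite /pencil /fcoord !ipBl !ipZl -!/(fcoord _ _ _ _) co_bop //.
rewrite !co_rootinv //.
have e1 : (mu k)%:C = (smu k)%:C * (smu k)%:C :> R[i].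
  by rewrite -rmorphM -expr2 smu_sqr.
have e2 : ((Num.sqrt (mu k))^-1)%:C = (smu k)%:C^-1 :> R[i] by rewrite fmorphV.
have r0 : (smu k)%:C != 0 :> R[i].
  by rewrite eq_complex /= negb_and gt_eqF //; have := smu_ge1 k0; lra.
by rewrite e1 e2; field.
Qed.

(** The points at which the perturbation is a strict contraction relative to
    [z - A]. *)
Definition good (z : R[i]) : Prop :=
  (forall k, (0 < k)%N -> 3^-1 <= cabs ((mu k)%:C - z)) /\
  forall n, Mb * (\sum_(1 <= k < n.+1) (p k ^+ 2 * cabs ((mu k)%:C - z))^-1) <= 3 / 4.

Section Inverse.
Variables (s : R) (z : R[i]).
Hypothesis s01 : 0 <= s <= 1.
Hypothesis gz : good z.

Let r k : R := cabs ((mu k)%:C - z).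
Let rho k : R := Num.sqrt (r k).

Let r_ge k : (0 < k)%N -> 3^-1 <= r k.
Proof. by case: gz => h _; exact: h. Qed.

Let r_gt0 k : (0 < k)%N -> 0 < r k.
Proof. by move=> /r_ge; apply: lt_le_trans; rewrite invr_gt0. Qed.

Let rho_gt0 k : (0 < k)%N -> 0 < rho k.
Proof. by move=> /r_gt0; rewrite sqrtr_gt0. Qed.

Let rho_sqr k : (0 < k)%N -> rho k ^+ 2 = r k.
Proof. by move=> /r_gt0 h; rewrite sqr_sqrtr // ltW. Qed.

Let zmu_neq0 k : (0 < k)%N -> z - (mu k)%:C != 0.
Proof. by move=> /r_gt0; rewrite -cabs_gt0 cabs_distC. Qed.

Let smu_gt0 k : (0 < k)%N -> 0 < smu k.
Proof. by move=> /smu_ge1; apply: lt_le_trans. Qed.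

Let dE k : R[i] := (smu k / rho k)%:C.
Let dE' k : R[i] := (rho k / smu k)%:C.
Let dT k : R[i] := (r k)%:C / (z - (mu k)%:C).

(** A bound for [mu k / |mu k - z|], as [|mu k - z| >= 1 / 3], and for the inverse
    quotient, as [mu k >= 1]. *)
Definition res_const : R := 1 + 3 * cabs z.
Local Notation N := res_const.

Let N_ge1 : 1 <= N.
Proof. by rewrite /N; have := cabs_ge0 z; lra. Qed.

Let dE_bounded : bounded_seq dE N.
Proof.
split=> [|k k0]; first by have := N_ge1; lra.
have r0 := r_gt0 k0; have r3 := r_ge k0; have h0 := rho_gt0 k0; have h1 := smu_gt0 k0.
have N1 := N_ge1.
rewrite cabs_real ger0_norm; last by rewrite divr_ge0 // ltW.
have N0 : 0 <= N by lra.
rewrite -(@ler_pXn2r _ 2) ?nnegrE //; last by rewrite divr_ge0 // ltW.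
rewrite expr_div_n smu_sqr // rho_sqr // ler_pdivrMr //.
have : mu k <= cabs ((mu k)%:C - z) + cabs z.
  have := cabsD ((mu k)%:C - z) z; rewrite subrK cabs_real.
  by move=> h; rewrite (le_trans _ h) // ler_norm.
rewrite -/(r k) => h2; have z0 := cabs_ge0 z.
apply: (le_trans h2); apply: (@le_trans _ _ (N * r k)).
  by rewrite /N mulrDl mul1r lerD2l; nra.
by rewrite ler_wpM2r ?(ltW r0) // expr2 ler_peMr.
Qed.

Let dE'_bounded : bounded_seq dE' N.
Proof.
split=> [|k k0]; first by have := N_ge1; lra.
have r0 := r_gt0 k0; have h0 := rho_gt0 k0; have h1 := smu_gt0 k0.
have N1 := N_ge1; have m1 := mu_ge1 k0.
rewrite cabs_real ger0_norm; last by rewrite divr_ge0 // ltW.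
have N0 : 0 <= N by lra.
rewrite -(@ler_pXn2r _ 2) ?nnegrE //; last by rewrite divr_ge0 // ltW.
rewrite expr_div_n smu_sqr // rho_sqr // ler_pdivrMr; last by lra.
have : r k <= mu k + cabs z.
  have := cabsD (mu k)%:C (- z); rewrite cabsN cabs_real ger0_norm //; lra.
move=> h2; have z0 := cabs_ge0 z.
apply: (le_trans h2); apply: (@le_trans _ _ (N * mu k)).
  by rewrite /N mulrDl mul1r lerD2l; nra.
by rewrite ler_wpM2r ?expr2 ?ler_peMr //; lra.
Qed.

Let dT_bounded : bounded_seq dT 1.
Proof.
split=> // k k0; rewrite cabsM cabsV cabs_real (cabs_distC z) -/(r k).
by rewrite ger0_norm ?divff // ?gt_eqF ?r_gt0 // ltW // r_gt0.
Qed.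

Let E := diag dE.
Let T x := diag dT (E x).

(** After the substitution [y = E y'] and division by the phase of [z - mu k],
    the pencil becomes [1 - s K] with [K] of Hilbert-Schmidt norm at most the
    sum in the definition of [good]. *)
Let K x := T (bop (E x)).

Let co_E x k : (0 < k)%N -> co (E x) k = dE k * co x k.
Proof. exact: co_diag dE_bounded. Qed.

Let co_T x k : (0 < k)%N -> co (T x) k = dT k * (dE k * co x k).
Proof. by move=> k0; rewrite (co_diag _ dT_bounded) // co_E. Qed.

Let nrm_E x : nrm (E x) <= N * nrm x. Proof. exact: nrm_diag dE_bounded. Qed.

Let nrm_T x : nrm (T x) <= N * nrm x.
Proof. by have := nrm_diag (E x) dT_bounded; rewrite mul1r => /le_trans; apply; exact: nrm_E. Qed.

Let E_linear : linear E. Proof. exact: diag_linear dE_bounded. Qed.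

Let T_linear : linear T.
Proof. by move=> a u v; rewrite /T E_linear (diag_linear dT_bounded). Qed.

Let K_linear : linear K.
Proof. by move=> a u v; rewrite /K E_linear bop_linear T_linear. Qed.

Let pencilE x : T (pencil s z (E x)) = x - s%:C *: K x.
Proof.
apply: (co_inj ip_norm psi_basis) => k k0.
rewrite co_T // co_pencil // /fcoord ipBl ipZl -!/(fcoord _ _ _ _).
rewrite co_T // co_bop // -!/(smu k) co_E //.
have e1 : (mu k)%:C = (smu k)%:C * (smu k)%:C :> R[i].
  by rewrite -rmorphM -expr2 smu_sqr.
have e2 : ((smu k)^-1)%:C = (smu k)%:C^-1 :> R[i] by rewrite fmorphV.
have e3 : dE k = (smu k)%:C / (rho k)%:C by rewrite /dE rmorphM fmorphV.
have e4 : (r k)%:C = (rho k)%:C * (rho k)%:C :> R[i].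
  by rewrite -rmorphM -expr2 rho_sqr.
have n1 : (smu k)%:C != 0 :> R[i] by rewrite eq_complex /= negb_and gt_eqF // smu_gt0.
have n2 : (rho k)%:C != 0 :> R[i] by rewrite eq_complex /= negb_and gt_eqF // rho_gt0.
have := zmu_neq0 k0; rewrite /dT e1 e2 e3 e4 => n3.
by field; rewrite n1 n2 n3.
Qed.

Let E_kvec_sum n m : (0 < n)%N -> (0 < m)%N ->
  \sum_(1 <= j < m.+1) cabs (co (E (kvec n)) j) ^+ 2 <= Mb * (3 / 4) / p n ^+ 2.
Proof.
move=> n0 m0; case: gz => _ /(_ m) hg.
apply: (@le_trans _ _ (\sum_(1 <= j < m.+1) Mb ^+ 2 / p n ^+ 2 * (p j ^+ 2 * r j)^-1)).
  rewrite big_nat [leRHS]big_nat; apply: ler_sum => j /andP[j0 _].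
  have pj := p_gt0 j0; have pn := p_gt0 n0; have s1 := smu_gt0 j0; have h1 := rho_gt0 j0.
  have a1 : 0 <= smu j / rho j by rewrite divr_ge0 // ltW.
  have a2 : 0 <= (smu j)^-1 by rewrite invr_ge0 ltW.
  rewrite co_E // co_kvec // -/(smu j) !cabsM cabs_conj !cabs_real.
  rewrite (ger0_norm a1) (ger0_norm a2).
  have -> : smu j / rho j * (cabs (beta j n) * (smu j)^-1) = cabs (beta j n) / rho j.
    by field; rewrite !gt_eqF.
  have -> : Mb ^+ 2 / p n ^+ 2 * (p j ^+ 2 * r j)^-1 = (Mb / (p j * p n) / rho j) ^+ 2.
    by rewrite -rho_sqr //; field; rewrite !gt_eqF.
  have l0 : 0 <= cabs (beta j n) / rho j by rewrite divr_ge0 ?cabs_ge0 // ltW.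
  have l1 : cabs (beta j n) / rho j <= Mb / (p j * p n) / rho j.
    by rewrite ler_wpM2r ?invr_ge0 ?beta_le // ltW.
  by rewrite ler_pXn2r ?nnegrE //; exact: le_trans l1.
rewrite -mulr_sumr (_ : Mb * _ / _ = Mb / p n ^+ 2 * (3 / 4)); last by ring.
rewrite (_ : Mb ^+ 2 / _ * _ = Mb / p n ^+ 2 *
  (Mb * \sum_(1 <= j < m.+1) (p j ^+ 2 * r j)^-1)); last by ring.
by rewrite ler_wpM2l // divr_ge0 // sqr_ge0.
Qed.

Let nrm_E_kvec n : (0 < n)%N -> nrm (E (kvec n)) <= Num.sqrt (Mb * (3 / 4)) / p n.
Proof.
move=> n0; have pn := p_gt0 n0; have q0 : 0 <= Mb * (3 / 4) by rewrite mulr_ge0 // divr_ge0.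
apply: (nrm_le_co ip_norm psi_basis) => [|m].
  by rewrite divr_ge0 ?sqrtr_ge0 // ltW.
rewrite expr_div_n sqr_sqrtr //.
case: m => [|m]; last exact: E_kvec_sum.
by rewrite big_geq // divr_ge0 // sqr_ge0.
Qed.

Let nrm_K x : nrm (K x) <= 3 / 4 * nrm x.
Proof.
apply: (nrm_le_co ip_norm psi_basis) => [|m].
  by rewrite mulr_ge0 ?nrm_ge0 // divr_ge0.
have q0 : 0 <= Mb * (3 / 4) by rewrite mulr_ge0 // divr_ge0.
case: gz => _ /(_ m) hg.
apply: (@le_trans _ _ (\sum_(1 <= n < m.+1) Mb * (3 / 4) * nrm x ^+ 2 * (p n ^+ 2 * r n)^-1)).
  rewrite big_nat [leRHS]big_nat; apply: ler_sum => n /andP[n0 _].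
  have pn := p_gt0 n0; have s1 := smu_gt0 n0; have h1 := rho_gt0 n0.
  have a1 : 0 <= smu n / rho n by rewrite divr_ge0 // ltW.
  have a2 : 0 <= (smu n)^-1 by rewrite invr_ge0 ltW.
  rewrite /K co_T // co_bop // -/(smu n) !(cabsM (dT n)) !(cabsM (dE n)).
  rewrite (cabsM _ (ip _ _)) !cabs_real.
  have [_ /(_ n n0) dT1] := dT_bounded.
  rewrite (ger0_norm a1) (ger0_norm a2).
  have -> : ip (E x) (kvec n) = ip x (E (kvec n)).
    apply: (ip_eq ip_norm psi_basis) => k k0.
    have cE (w : R[i]) : (dE k * w)^* = dE k * w^*.
      by rewrite rmorphM; congr (_ * _); exact: conjc_real.
    by rewrite !co_E // cE; ring.
  have h2 : cabs (ip x (E (kvec n))) <= nrm x * (Num.sqrt (Mb * (3 / 4)) / p n).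
    by rewrite (le_trans (cauchy_schwarz ip_norm _ _)) // ler_wpM2l ?nrm_ge0 ?nrm_E_kvec.
  have h3 := cabs_ge0 (ip x (E (kvec n))).
  have h4 : smu n / rho n * ((smu n)^-1 * cabs (ip x (E (kvec n)))) =
      cabs (ip x (E (kvec n))) / rho n by field; rewrite !gt_eqF.
  rewrite h4.
  have -> : Mb * (3 / 4) * nrm x ^+ 2 * (p n ^+ 2 * r n)^-1 =
      (nrm x * (Num.sqrt (Mb * (3 / 4)) / p n) / rho n) ^+ 2.
    by rewrite -rho_sqr // -[in LHS](sqr_sqrtr q0); field; rewrite !gt_eqF.
  have l0 : 0 <= cabs (ip x (E (kvec n))) / rho n by rewrite divr_ge0 // ltW.
  have l1 : cabs (ip x (E (kvec n))) / rho n <=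
      nrm x * (Num.sqrt (Mb * (3 / 4)) / p n) / rho n.
    by rewrite ler_wpM2r ?invr_ge0 // ltW.
  have l2 : cabs (dT n) * (cabs (ip x (E (kvec n))) / rho n) <=
      nrm x * (Num.sqrt (Mb * (3 / 4)) / p n) / rho n.
    by rewrite (le_trans _ l1) // ler_piMl.
  have l3 : 0 <= cabs (dT n) * (cabs (ip x (E (kvec n))) / rho n).
    by rewrite mulr_ge0 ?cabs_ge0.
  by rewrite ler_pXn2r ?nnegrE //; exact: le_trans l2.
rewrite -mulr_sumr (_ : (3 / 4 * nrm x) ^+ 2 = 3 / 4 * nrm x ^+ 2 * (3 / 4)); last by ring.
rewrite (_ : Mb * _ * _ * _ = 3 / 4 * nrm x ^+ 2 *
  (Mb * \sum_(1 <= j < m.+1) (p j ^+ 2 * r j)^-1)); last by ring.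
by rewrite ler_wpM2l // mulr_ge0 ?sqr_ge0 // divr_ge0.
Qed.

Let sK x := s%:C *: K x.

Let nrm_sK x : nrm (sK x) <= 3 / 4 * nrm x.
Proof.
have /andP[s0 s1] := s01; rewrite nrmZ cabs_real ger0_norm //.
by rewrite (le_trans _ (nrm_K x)) // ler_piMl ?nrm_ge0.
Qed.

Let sK_linear : linear sK.
Proof. by move=> a u v; rewrite /sK K_linear scalerDr !scalerA mulrC. Qed.

Let T_inj x : T x = 0 -> x = 0.
Proof.
move=> Tx; apply: (co_inj ip_norm psi_basis) => k k0.
have := co_T x k0; rewrite Tx /fcoord !linear0l.
have n1 : dT k != 0.
  rewrite /dT mulf_neq0 ?invr_eq0 ?zmu_neq0 //.
  by rewrite eq_complex /= negb_and gt_eqF // r_gt0.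
have n2 : dE k != 0.
  rewrite /dE eq_complex /= negb_and gt_eqF // divr_gt0 ?smu_gt0 ?rho_gt0 //.
by move/esym/eqP; rewrite mulf_eq0 (negbTE n1) mulf_eq0 (negbTE n2) => /eqP ->.
Qed.

Lemma pencil_linear : linear (pencil s z).
Proof.
move=> a u v; apply: (co_inj ip_norm psi_basis) => k k0.
by rewrite coP !co_pencil // coP ipDl ipZl; ring.
Qed.

(** [y = E y'] solves the equation when [y' - s K y' = T x]. *)
Lemma pencil_surj x : exists y, pencil s z y = x.
Proof.
have q0 : 0 <= (3 / 4 : R) by rewrite divr_ge0.
have q1 : 3 / 4 < 1 :> R by lra.
have [y hy] := neumann sK_linear q0 q1 nrm_sK (T x).
exists (E y); apply/eqP; rewrite -subr_eq0; apply/eqP/T_inj.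
by rewrite linear_funB // pencilE -/(sK y) hy subrr.
Qed.

(** [E] is onto, so that [pencilE] applies to every [y]. *)
Lemma pencil_apriori y : nrm y <= 4 * N ^+ 2 * nrm (pencil s z y).
Proof.
have q1 : 3 / 4 < 1 :> R by lra.
pose y' := diag dE' y.
have yE : y = E y'.
  apply: (co_inj ip_norm psi_basis) => k k0.
  rewrite co_E // (co_diag _ dE'_bounded) // mulrA -rmorphM.
  by rewrite mulrA divfK ?divff ?mul1r // gt_eqF // ?smu_gt0 ?rho_gt0.
have h1 := neumann_le y' q1 nrm_sK; rewrite -pencilE -yE in h1.
have h2 := nrm_T (pencil s z y); have h3 := nrm_E y'; rewrite -yE in h3.
have N1 := N_ge1.
have h4 : nrm (T (pencil s z y)) / (1 - 3 / 4) = 4 * nrm (T (pencil s z y)) by field.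
rewrite h4 in h1; apply: (le_trans h3).
rewrite (_ : 4 * N ^+ 2 * _ = N * (4 * (N * nrm (pencil s z y)))); last by ring.
rewrite ler_wpM2l //; lra.
Qed.

End Inverse.

Definition pencil_inv (s : R) (z : R[i]) x : H := xget 0 [set y | pencil s z y = x].

Lemma pencil_invK s z x : 0 <= s <= 1 -> good z -> pencil s z (pencil_inv s z x) = x.
Proof.
move=> s01 gz; have ex : exists y, [set y | pencil s z y = x] y.
  by have [y hy] := pencil_surj s01 gz x; exists y.
exact: (xgetPex 0 ex).
Qed.

Lemma pencil_inv_eq s z y x : 0 <= s <= 1 -> good z ->
  pencil s z y = x -> y = pencil_inv s z x.
Proof.
move=> s01 gz yx; apply/eqP; rewrite -subr_eq0; apply/eqP/nrm_le0.
have := pencil_apriori s01 gz (y - pencil_inv s z x).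
by rewrite (linear_funB _ _ (pencil_linear s z)) yx pencil_invK // subrr nrm0 mulr0.
Qed.

Lemma nrm_pencil_inv s z x : 0 <= s <= 1 -> good z ->
  nrm (pencil_inv s z x) <= 4 * res_const z ^+ 2 * nrm x.
Proof.
by move=> s01 gz; have := pencil_apriori s01 gz (pencil_inv s z x); rewrite pencil_invK.
Qed.

Lemma pencil_inv_linear s z : 0 <= s <= 1 -> good z -> linear (pencil_inv s z).
Proof.
move=> s01 gz a u v; apply/esym/pencil_inv_eq => //.
by rewrite pencil_linear !pencil_invK.
Qed.

(** [(z - A - s B)^-1], with the factor [G] restored on both sides. *)
Definition res (s : R) (z : R[i]) x : H := G (pencil_inv s z (G x)).

Lemma res_linear s z : 0 <= s <= 1 -> good z -> linear (res s z).
Proof.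
move=> s01 gz a u v; rewrite /res rootinv_linear (pencil_inv_linear s01 gz).
exact: rootinv_linear.
Qed.

Lemma nrm_res s z x : 0 <= s <= 1 -> good z ->
  nrm (res s z x) <= 4 * res_const z ^+ 2 * nrm x.
Proof.
move=> s01 gz; apply: (le_trans (nrm_rootinv _)).
apply: (le_trans (nrm_pencil_inv _ s01 gz)); rewrite ler_wpM2l ?nrm_rootinv //.
by rewrite mulr_ge0 ?sqr_ge0.
Qed.

(** [pencil s z] depends on [z] through the term [z *: G (G y)] only. *)
Lemma res_identity s z w x : 0 <= s <= 1 -> good z -> good w ->
  res s z x - res s w x = (w - z) *: res s z (res s w x).
Proof.
move=> s01 gz gw; rewrite -(linear_funB _ _ rootinv_linear).
rewrite -(linear_funZ _ _ rootinv_linear); congr (G _).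
rewrite -(linear_funZ _ _ (pencil_inv_linear s01 gz)).
apply: pencil_inv_eq => //; rewrite (linear_funB _ _ (pencil_linear s z)).
rewrite pencil_invK // -[X in X - _](pencil_invK (G x) s01 gw) -/(res s w x).
set y := pencil_inv s w (G x); rewrite /pencil -/(G y) /res -/y.
rewrite scalerBl; move: (w *: _) (z *: _) (s%:C *: _) => X Y d.
by apply/eqP; rewrite subr_eq !addrA subrK.
Qed.

Lemma res_lip s s' z x : 0 <= s <= 1 -> 0 <= s' <= 1 -> good z ->
  nrm (res s z x - res s' z x) <=
  (4 * res_const z ^+ 2) ^+ 2 * (Mb * c0) * `|s - s'| * nrm x.
Proof.
move=> s01 s01' gz; rewrite -(linear_funB _ _ rootinv_linear).
apply: (le_trans (nrm_rootinv _)); set M := 4 * res_const z ^+ 2.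
have M0 : 0 <= M by rewrite mulr_ge0 ?sqr_ge0.
set y := pencil_inv s z (G x); set y' := pencil_inv s' z (G x).
apply: (le_trans (pencil_apriori s01 gz _)); rewrite -/M.
have -> : pencil s z (y - y') = (s - s')%:C *: bop y'.
  rewrite (linear_funB _ _ (pencil_linear s z)) /y pencil_invK //.
  rewrite -[X in X - _](pencil_invK (G x) s01' gz) -/y' /pencil.
  rewrite rmorphB scalerBl; move: (z *: _ - _) (s%:C *: _) (s'%:C *: _) => X c d.
  by apply/eqP; rewrite subr_eq [X in _ == X]addrC addrA subrK.
rewrite nrmZ cabs_real.
have h1 := nrm_bop y'; have h2 := nrm_pencil_inv (G x) s01' gz.
rewrite -/y' -/M in h2; have h3 := nrm_rootinv x.
have h4 : nrm (bop y') <= Mb * c0 * (M * nrm x).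
  apply: (le_trans h1); rewrite ler_wpM2l ?mulr_ge0 //.
  by apply: (le_trans h2); rewrite ler_wpM2l.
rewrite (_ : M ^+ 2 * _ * _ * _ = M * (`|s - s'| * (Mb * c0 * (M * nrm x)))); last by ring.
by rewrite ler_wpM2l // ler_wpM2l.
Qed.

Lemma co_res0 z x k : good z -> (0 < k)%N ->
  co (res 0 z x) k = co x k / (z - (mu k)%:C).
Proof.
move=> gz k0; rewrite /res co_rootinv // -/(smu k).
set y := pencil_inv 0 z (G x).
have s01 : 0 <= (0 : R) <= 1 by rewrite lexx ler01.
have := congr1 (co^~ k) (pencil_invK (G x) s01 gz); rewrite /= -/y co_pencil // mul0r subr0.
rewrite co_rootinv // -/(smu k).
have e1 : (mu k)%:C = (smu k)%:C * (smu k)%:C :> R[i].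
  by rewrite -rmorphM -expr2 smu_sqr.
have e2 : ((smu k)^-1)%:C = (smu k)%:C^-1 :> R[i] by rewrite fmorphV.
have n1 : (smu k)%:C != 0 :> R[i].
  by rewrite eq_complex /= negb_and gt_eqF //; have := smu_ge1 k0; lra.
have n3 : z - (mu k)%:C != 0.
  rewrite -cabs_gt0 cabs_distC; case: gz => /(_ k k0) h _.
  by apply: lt_le_trans h; rewrite invr_gt0.
rewrite e2; rewrite e1 in n3 *; move: (co y k) (co x k) => a b h.
apply: (canRL (mulfK n3)); move: h n1 n3.
move: ((smu k)%:C) => S h S0 n3.
have : S * ((z / (S * S) - 1) * a) = S * (S^-1 * b) by rewrite h.
rewrite (_ : S * (S^-1 * b) = b); last by field.
by move=> <-; field.
Qed.

(** If [y] represents [u] in the energy space, the equation [(z - T) u = x],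
    tested with the basis vectors, reads [pencil 1 z y = G x]. *)
Lemma res_eq z u x y : good z -> (forall k, (0 < k)%N ->
    co u k = ((Num.sqrt (mu k))^-1)%:C * co y k) ->
  (forall k, (0 < k)%N -> (z - (mu k)%:C) * co u k - ip y (kvec k) = co x k) ->
  u = res 1 z x.
Proof.
move=> gz uy eqn.
have s01 : 0 <= (1 : R) <= 1 by rewrite ler01 lexx.
have -> : u = G y.
  by apply: (co_inj ip_norm psi_basis) => k k0; rewrite co_rootinv // uy.
congr (G _); apply: pencil_inv_eq => //; apply: (co_inj ip_norm psi_basis) => k k0.
rewrite co_pencil // co_rootinv // -eqn // uy // -/(smu k).
have e1 : (mu k)%:C = (smu k)%:C * (smu k)%:C :> R[i].
  by rewrite -rmorphM -expr2 smu_sqr.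
have e2 : ((smu k)^-1)%:C = (smu k)%:C^-1 :> R[i] by rewrite fmorphV.
have n1 : (smu k)%:C != 0 :> R[i].
  by rewrite eq_complex /= negb_and gt_eqF //; have := smu_ge1 k0; lra.
by rewrite e2 e1 mul1r; field.
Qed.

End PerturbedDiagonal.

(** * Estimates outside the spectral region *)
Section SpectralRegions.
Context {R : realType}.
Variables (mu : nat -> R).
Hypotheses (mu1 : 1 <= mu 1%N).
Hypothesis mu_gap : forall n, (0 < n)%N -> 1 <= mu n.+1 - mu n.

Lemma mu_gapD k j : (0 < k)%N -> mu k + j%:R <= mu (k + j)%N.
Proof.
move=> k0; elim: j => [|j ih]; first by rewrite addn0 addr0.
have := mu_gap (n := k + j) _; rewrite addn_gt0 k0 addnS -natr1 => /(_ isT); lra.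
Qed.

Lemma mu_le j k : (0 < j)%N -> (j <= k)%N -> mu j <= mu k.
Proof.
move=> j0 jk; have := mu_gapD (k - j) j0; rewrite subnKC // => h.
by apply: le_trans h; rewrite lerDl.
Qed.

Lemma mu_ge_nat k : (0 < k)%N -> k%:R <= mu k.
Proof.
case: k => // k _; have := mu_gapD k (k := 1) isT; rewrite add1n -natr1; have := mu1; lra.
Qed.

Lemma mu_ge_one k : (0 < k)%N -> 1 <= mu k.
Proof. by move=> k0; apply: le_trans (mu_ge_nat k0); rewrite ler1n. Qed.

Variables (alpha Mb C D : R) (N : nat) (h : R).
Hypotheses (alpha_gt0 : 0 < alpha) (Mb_gt0 : 0 < Mb).
Hypothesis C_def : sigma_constant mu (2 * alpha) C.
Hypothesis D_def : tau_constant (2 * alpha) D.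
Hypothesis N_gt0 : (0 < N)%N.
Hypothesis N_large : forall n, (N < n)%N -> Mb * C * sigma (2 * alpha) n <= 2^-1.
Hypothesis h_gt1 : 1 < h.
Hypothesis h_large :
  2 * Mb * (h^-1 * (\sum_(1 <= k < N.+3) (k%:R `^ (2 * alpha))^-1)
            + D * tau (2 * alpha) h) <= 2^-1.

Definition pw (k : nat) : R := k%:R `^ alpha.

Lemma pw_gt0 k : (0 < k)%N -> 0 < pw k.
Proof. by move=> k0; rewrite /pw powR_gt0 // ltr0n. Qed.

Lemma pw_sqr k : k%:R `^ (2 * alpha) = pw k ^+ 2.
Proof. by rewrite mulrC powRrM powR_mulrn // powR_ge0. Qed.

Lemma pw_le j k : (j <= k)%N -> pw j <= pw k.
Proof. by move=> jk; rewrite /pw ge0_ler_powR ?nnegrE ?ler_nat // ltW. Qed.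

Definition psum (z : R[i]) n : R :=
  \sum_(1 <= k < n.+1) (pw k ^+ 2 * cabs ((mu k)%:C - z))^-1.

Lemma nneseries_le (f : nat -> R) (x : R) : (forall k, 0 <= f k) ->
  (\sum_(1 <= k <oo) (f k)%:E <= x%:E)%E ->
  forall n, \sum_(1 <= k < n.+1) f k <= x.
Proof.
move=> f0 hx n; rewrite -lee_fin; apply: le_trans hx; rewrite -sumEFin.
by apply: nneseries_lim_ge => k _ _; rewrite lee_fin.
Qed.

Lemma psum_sigma n z : (1 < n)%N -> mu n - 2^-1 <= Re z -> Re z <= mu n.+1 - 2^-1 ->
  ~ Pij mu n z -> forall m, psum z m <= C * sigma (2 * alpha) n.
Proof.
move=> n1 h1 h2 h3; have := C_def n1 h1 h2 h3.
under eq_eseriesr do rewrite pw_sqr.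
move=> hs m; rewrite /psum; move: m; apply: nneseries_le hs => k.
by rewrite invr_ge0 mulr_ge0 ?sqr_ge0 ?cabs_ge0.
Qed.

Lemma sum_tau m :
  \sum_(1 <= k < m.+1) (pw k ^+ 2 * (k%:R + h))^-1 <= D * tau (2 * alpha) h.
Proof.
have h0 := h_gt1; have := D_def h_gt1; under eq_eseriesr do rewrite pw_sqr.
move=> hs; move: m; apply: nneseries_le hs => k.
by rewrite invr_ge0 mulr_ge0 ?sqr_ge0 // addr_ge0 //; lra.
Qed.

Lemma h_large_pw :
  2 * Mb * (h^-1 * (\sum_(1 <= k < N.+3) (pw k ^+ 2)^-1) + D * tau (2 * alpha) h) <= 2^-1.
Proof. by have := h_large; under eq_bigr do rewrite pw_sqr. Qed.

Lemma inv_le_inv (a b : R) : 0 < a -> a <= b -> b^-1 <= a^-1.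
Proof. by move=> a0 ab; rewrite lef_pV2 ?posrE // (lt_le_trans a0). Qed.

Let S := \sum_(1 <= k < N.+3) (pw k ^+ 2)^-1.

Let S_ge0 : 0 <= S.
Proof. by apply: sumr_ge0 => k _; rewrite invr_ge0 sqr_ge0. Qed.

Lemma psum_mono z m n : (m <= n)%N -> psum z m <= psum z n.
Proof.
move=> mn; rewrite /psum [leRHS](@big_cat_nat _ _ _ m.+1) //= lerDl sumr_ge0 // => k _.
by rewrite invr_ge0 mulr_ge0 ?sqr_ge0 ?cabs_ge0.
Qed.

(** Far from the real axis: the first terms are bounded with [|mu k - z| >= h],
    the others after the index shift [k = j + N + 2], which only decreases the
    weights and makes [|mu k - z|] at least [(j + h) / 2]. *)
Lemma psum_top z : Re z <= mu N.+1 + 2^-1 -> h <= `|Im z| ->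
  forall m, Mb * psum z m <= 2^-1.
Proof.
move=> hR hI m; have h1 := h_gt1.
apply: (@le_trans _ _ (Mb * (h^-1 * S + 2 * (D * tau (2 * alpha) h)))); last first.
  have := h_large_pw; rewrite -/S; have := S_ge0; have M0 := Mb_gt0 => s0.
  have : 0 <= Mb * (h^-1 * S) by rewrite !mulr_ge0 ?invr_ge0 //; lra.
  by move: (h^-1 * S) (D * _) => ? ?; lra.
rewrite ler_wpM2l //; first exact: ltW.
apply: (le_trans (psum_mono z (leq_addr N.+2 m))).
rewrite /psum (@big_cat_nat _ _ _ N.+3) //=; last by rewrite -addnS leq_addl.
have Ih : h <= cabs z by apply: (le_trans hI); exact: Im_le_cabs.
apply: lerD.
  rewrite /S mulr_sumr big_nat [leRHS]big_nat; apply: ler_sum => k /andP[k0 _].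
  rewrite -invfM mulrC; apply: inv_le_inv; first by rewrite mulr_gt0 ?exprn_gt0 ?pw_gt0 //; lra.
  rewrite ler_wpM2r ?sqr_ge0 // (le_trans hI) // (le_trans _ (Im_le_cabs _)) //.
  by rewrite ImB /= sub0r normrN.
have -> : (m + N.+2).+1 = (m.+1 + N.+2)%N by rewrite addSn.
rewrite -[N.+3]add1n big_addn addnK.
apply: (@le_trans _ _ (\sum_(1 <= j < m.+1) 2 * (pw j ^+ 2 * (j%:R + h))^-1)); last first.
  by rewrite -mulr_sumr ler_wpM2l // sum_tau.
rewrite big_nat [leRHS]big_nat; apply: ler_sum => j /andP[j0 _].
have pj := pw_gt0 j0.
have jh : 0 < j%:R + h by rewrite ltr_wpDl //; lra.
have -> : 2 * (pw j ^+ 2 * (j%:R + h))^-1 = (pw j ^+ 2 * ((j%:R + h) / 2))^-1.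
  by field; rewrite !gt_eqF.
apply: inv_le_inv; first by rewrite mulr_gt0 ?exprn_gt0 // divr_gt0.
apply: ler_pM; [exact: sqr_ge0 | by rewrite divr_ge0 // ltW | |].
  by rewrite ler_pXn2r ?nnegrE ?powR_ge0 // pw_le // leq_addr.
have := cabs_half_ge ((mu (j + N.+2))%:C - z); rewrite ReB ImB /= sub0r normrN.
have := ler_norm (mu (j + N.+2) - Re z).
have := mu_gapD j (k := N.+2) isT; rewrite addnC.
have := mu_gap (n := N.+1) isT; lra.
Qed.

(** Here [|mu k - z| >= k + h]. *)
Lemma psum_left z : Re z <= - h -> forall m, Mb * psum z m <= 2^-1.
Proof.
move=> hR m; have h1 := h_gt1.
apply: (@le_trans _ _ (Mb * (D * tau (2 * alpha) h))); last first.
  have := h_large_pw; rewrite -/S; have := S_ge0; have M0 := Mb_gt0 => s0.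
  have : 0 <= Mb * (h^-1 * S) by rewrite !mulr_ge0 ?invr_ge0 //; lra.
  by move: (h^-1 * S) (D * _) => ? ?; lra.
rewrite ler_wpM2l //; first exact: ltW.
apply: le_trans (sum_tau m); rewrite /psum big_nat [leRHS]big_nat.
apply: ler_sum => k /andP[k0 _]; apply: inv_le_inv.
  by rewrite mulr_gt0 ?exprn_gt0 ?pw_gt0 // ltr_wpDl //; lra.
rewrite ler_wpM2l ?sqr_ge0 // (le_trans _ (Re_le_cabs _)) // ReB /=.
by rewrite (le_trans _ (ler_norm _)) //; have := mu_ge_nat k0; lra.
Qed.

(** There [Re z] falls into one of the strips of [sigma_constant] with [n > N].  The
    first strip is separated from the disc around [mu N.+1] by the right edge of
    the rectangle; the discs of the later ones are excluded by hypothesis. *)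
Lemma psum_right z : mu N.+1 + 2^-1 <= Re z ->
  (forall k, (N.+1 < k)%N -> ~ Pij mu k z) -> forall m, Mb * psum z m <= 2^-1.
Proof.
move=> hR hz m.
have [n [Nn n1 n2 n3]] : exists n, [/\ (N < n)%N, mu n - 2^-1 <= Re z,
    Re z <= mu n.+1 - 2^-1 & ~ Pij mu n z].
  pose P n := (N < n)%N && (Re z <= mu n.+1 - 2^-1).
  have exP : exists n, P n.
    exists (N.+1 + Num.trunc `|Re z|)%N; rewrite /P ltn_addr //=.
    have := mu_ge_nat (k := (N.+1 + Num.trunc `|Re z|).+1) isT.
    have := truncnS_gt `|Re z|; have := ler_norm (Re z).
    rewrite -addnS natrD; have : 1 <= N.+1%:R :> R by rewrite ler1n.
    lra.
  have := ex_minnP exP; case=> n /andP[Nn n2] nmin; exists n.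
  have [nN|nN] := eqVneq n N.+1.
    rewrite nN in n2 *; split => //; first lra.
    rewrite /Pij /disc /= => /lt_geF; have := Re_le_cabs (z - (mu N.+1)%:C).
    rewrite ReB /=; have := ler_norm (Re z - mu N.+1) => h1 h2.
    by rewrite (_ : 2^-1 <= _ = true) //; apply/idP; lra.
  have {}Nn : (N.+1 < n)%N by rewrite ltn_neqAle eq_sym nN.
  clear nN.
  split=> //; [exact: ltnW | | exact: hz].
  rewrite leNgt; apply/negP => hlt; case: n Nn n2 nmin hlt => // n Nn n2 nmin hlt.
  have := nmin n; rewrite /P -ltnS Nn ltW // => /(_ isT).
  by rewrite ltnn.
apply: le_trans (N_large Nn); rewrite -mulrA ler_wpM2l //; first exact: ltW.
by apply: psum_sigma => //; exact: leq_ltn_trans N_gt0 Nn.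
Qed.

Lemma outside_psum z : ~ Pi_region mu N h z -> forall m, Mb * psum z m <= 2^-1.
Proof.
move=> hz; have hd k : (N.+1 < k)%N -> ~ Pij mu k z.
  by move=> Nk hk; apply: hz; right; exists k.
have [hR|hR] := leP (mu N.+1 + 2^-1) (Re z); first exact: psum_right.
have [hl|hl] := leP (Re z) (- h); first exact: psum_left.
have [hI|hI] := leP h `|Im z|; first by apply: psum_top => //; exact: ltW.
by exfalso; apply: hz; left; split => //; move: hI; rewrite ltr_norml => /andP[].
Qed.

Lemma outside_dist z : ~ Pi_region mu N h z ->
  forall k, (0 < k)%N -> 2^-1 <= cabs ((mu k)%:C - z).
Proof.
move=> hz k k0; have h1 := h_gt1; have := mu_ge_one k0 => m1.
have [Nk|kN] := ltnP N.+1 k.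
  rewrite leNgt; apply/negP => hlt; apply: hz; right; exists k => //.
  by rewrite /Pij /disc /= cabs_distC.
have mk : mu k <= mu N.+1 by apply: mu_le.
have := Re_le_cabs ((mu k)%:C - z); rewrite ReB /= => hRe.
have [hR|hR] := leP (mu N.+1 + 2^-1) (Re z).
  by apply: le_trans hRe; rewrite distrC (le_trans _ (ler_norm _)) //; lra.
have [hl|hl] := leP (Re z) (- h).
  by apply: le_trans hRe; rewrite (le_trans _ (ler_norm _)) //; lra.
have := Im_le_cabs ((mu k)%:C - z); rewrite ImB /= sub0r normrN => hIm.
have [hI|hI] := leP h `|Im z|; first lra.
by exfalso; apply: hz; left; split => //; move: hI; rewrite ltr_norml => /andP[].
Qed.

(** All eigenvalues are at distance at least [1 / 2] from [z], so that a shift by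
    [1 / 6] decreases the distances by the factor [2 / 3] at most, and increases
    the bound on the sum from [1 / 2] to [3 / 4]. *)
Lemma near_outside_good z z' : ~ Pi_region mu N h z -> cabs (z' - z) <= 6^-1 ->
  good mu pw Mb z'.
Proof.
move=> hz zz'; have dist k : (0 < k)%N ->
    2 / 3 * cabs ((mu k)%:C - z) <= cabs ((mu k)%:C - z').
  move=> k0; have := outside_dist hz k0.
  have := cabsD ((mu k)%:C - z') (z' - z); rewrite addrA subrK; lra.
split=> [k k0|n].
  by have := dist _ k0; have := outside_dist hz k0; lra.
have := outside_psum hz n; rewrite /psum => hm.
apply: (@le_trans _ _ (Mb * (3 / 2 * psum z n))); last by rewrite /psum; lra.
rewrite ler_wpM2l //; first exact: ltW.
rewrite /psum mulr_sumr big_nat [leRHS]big_nat; apply: ler_sum => k /andP[k0 _].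
have pk := pw_gt0 k0; have ck : 0 < cabs ((mu k)%:C - z).
  by apply: lt_le_trans (outside_dist hz k0); rewrite invr_gt0.
have -> : 3 / 2 * (pw k ^+ 2 * cabs ((mu k)%:C - z))^-1 =
    (pw k ^+ 2 * (2 / 3 * cabs ((mu k)%:C - z)))^-1.
  by field; rewrite !gt_eqF.
apply: inv_le_inv; first by rewrite !mulr_gt0 ?exprn_gt0 ?invr_gt0.
by rewrite ler_wpM2l ?sqr_ge0 // dist.
Qed.

Lemma outside_good z : ~ Pi_region mu N h z -> good mu pw Mb z.
Proof. by move=> hz; apply: near_outside_good hz _; rewrite subrr cabs0 invr_ge0. Qed.

(** The sum at [z = - h] controls this one, as [k + h <= (1 + h) mu k]. *)
Lemma energy_sum_le n : \sum_(1 <= k < n.+1) (pw k ^+ 2 * mu k)^-1 <=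
  (1 + h) * (D * tau (2 * alpha) h).
Proof.
have h1 := h_gt1.
apply: (@le_trans _ _ ((1 + h) * \sum_(1 <= k < n.+1) (pw k ^+ 2 * (k%:R + h))^-1)).
  rewrite mulr_sumr big_nat [leRHS]big_nat; apply: ler_sum => k /andP[k0 _].
  have pk := pw_gt0 k0; have k1 : 1 <= k%:R :> R by rewrite ler1n.
  have -> : (1 + h) * (pw k ^+ 2 * (k%:R + h))^-1 = (pw k ^+ 2 * ((k%:R + h) / (1 + h)))^-1.
    by field; rewrite !gt_eqF //; lra.
  apply: inv_le_inv; first by rewrite mulr_gt0 ?exprn_gt0 // divr_gt0; lra.
  rewrite ler_wpM2l ?sqr_ge0 // ler_pdivrMr; last by lra.
  by have := mu_ge_nat k0; nra.
by rewrite ler_wpM2l ?sum_tau //; lra.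
Qed.

Lemma Pi_region_interior z : Pi_region mu N h z ->
  interior (Pi_region mu N h : set R[i]^o) z.
Proof.
have key (e : R) : 0 < e -> (forall z', cabs (z' - z) < e -> Pi_region mu N h z') ->
    interior (Pi_region mu N h : set R[i]^o) z.
  move=> e0 he; apply/nbhs_ballP; exists e%:C; first by rewrite /= ltcR.
  move=> z'; rewrite -ball_normE /= normc_cabs ltcR cabs_distC; exact: he.
move=> [[r1 r2 r3 r4]|[j Nj hj]].
  pose e := Num.min (Num.min (Re z + h) (mu N.+1 + 2^-1 - Re z))
                    (Num.min (Im z + h) (h - Im z)).
  have [e1 e2 e3 e4] : 
    [/\ e <= Re z + h, e <= mu N.+1 + 2^-1 - Re z, e <= Im z + h & e <= h - Im z].
    by rewrite /e !ge_min !lexx /= ?orbT; split.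
  apply: (key e); first by rewrite /e !lt_min; apply/andP; split; apply/andP; split; lra.
  move=> z' hz'; left.
  have := Re_le_cabs (z' - z); have := Im_le_cabs (z' - z).
  rewrite ReB ImB => /(le_lt_trans)/(_ hz'); rewrite ltr_norml => /andP[i1 i2].
  move=> /(le_lt_trans)/(_ hz'); rewrite ltr_norml => /andP[q1 q2].
  by split; lra.
apply: (key (2^-1 - cabs (z - (mu j)%:C))); first by rewrite subr_gt0.
move=> z' hz'; right; exists j => //; rewrite /Pij /disc /=.
have := cabsD (z' - z) (z - (mu j)%:C); rewrite addrA subrK; lra.
Qed.

End SpectralRegions.

(** * The operator of the perturbed form *)
Section FormOperator.
Context {R : realType} {H : completeNormedModType R[i]}.
Variable ip : {dot H for (@Num.conj R[i])}.
Hypothesis ip_norm : forall x : H, ip x x = `|x| ^+ 2.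
Variables (A : operator H) (psi : nat -> H) (mu : nat -> R).
Hypothesis psi_basis : orthonormal_basis ip psi.
Hypothesis A_eigen : forall n, (0 < n)%N ->
  odom A (psi n) /\ A (psi n) = (mu n)%:C *: psi n.
Variable sqrtA : operator H.
Hypothesis sqrtA_def : is_sqrt ip A sqrtA.
Variable b : H -> H -> R[i].
Hypothesis b_values : forall f g : H, odom sqrtA f -> odom sqrtA g ->
  (fun n : nat => \sum_(1 <= j < n.+1) \sum_(1 <= k < n.+1)
     ip f (psi j) * (ip g (psi k))^* * b (psi j) (psi k)) @ \oo --> (b f g : R[i]^o).
Variable T : operator H.
Hypothesis T_def : m_sectorial_operator_of ip
  (form_add (form_of_sqrt ip sqrtA) b) T.
Variables (p : nat -> R) (Mb c0 : R).
Hypothesis mu_ge1 : forall n, (0 < n)%N -> 1 <= mu n.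
Hypothesis p_gt0 : forall n, (0 < n)%N -> 0 < p n.
Hypothesis Mb_ge0 : 0 <= Mb.
Local Notation beta := (fun m n => b (psi m) (psi n)).
Hypothesis beta_le : forall m n, (0 < m)%N -> (0 < n)%N ->
  cabs (beta m n) <= Mb / (p m * p n).
Hypothesis c0_le : forall n, \sum_(1 <= k < n.+1) (p k ^+ 2 * mu k)^-1 <= c0.
Local Notation co := (fcoord ip psi).
Local Notation kv := (kvec ip psi mu beta).
Local Notation res := (res ip psi mu beta).
Implicit Types (x y u v : H).

Lemma sqrtA_psi k : (0 < k)%N ->
  odom sqrtA (psi k) /\
  forall u, odom sqrtA u -> ip (sqrtA u) (sqrtA (psi k)) = (mu k)%:C * co u k.
Proof.
move=> k0; have [Sadj _ Sq] := sqrtA_def.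
have [S1 S2 S3] := (Sq (psi k) ((mu k)%:C *: psi k)).1 (A_eigen k0).
split=> // u Su; have [_ _ adj] := Sadj.
rewrite ((adj (sqrtA (psi k)) (sqrtA (sqrtA (psi k)))).2 (conj S2 erefl) u Su) S3.
by rewrite ipZr; congr (_ * _); exact: conjc_real.
Qed.

Lemma sqrtA_linear : linear_operator sqrtA.
Proof. by have [[]] := sqrtA_def. Qed.

Lemma sqrtA_vsum (c : nat -> R[i]) n : odom sqrtA (vsum psi c n) /\
  sqrtA (vsum psi c n) = \sum_(1 <= k < n.+1) c k *: sqrtA (psi k).
Proof.
have [[D0 DP] lin] := sqrtA_linear.
have S0 : sqrtA 0 = 0.
  by have := lin (-1) 0 0 D0 D0; rewrite !scaleN1r oppr0 addr0 addNr.
rewrite /vsum; elim: n => [|n [ih1 ih2]]; first by rewrite !big_geq.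
have [Dn _] := sqrtA_psi (k := n.+1) isT.
rewrite !(@big_nat_recr _ _ _ n.+1) //= ![_ + c n.+1 *: _]addrC.
by split; [exact: DP | rewrite lin // ih2].
Qed.

(** With [v] a partial sum of the expansion of [u], both [ip (S u) (S v)] and
    [ip (S v) (S v)] equal the left-hand side, where [S = A^(1/2)]; hence
    [nrm (S v) <= nrm (S u)]. *)
Lemma energy_le u : odom sqrtA u ->
  forall n, \sum_(1 <= k < n.+1) mu k * cabs (co u k) ^+ 2 <= nrm (sqrtA u) ^+ 2.
Proof.
move=> Du n; set e := \sum_(1 <= k < _) _.
have [Dv Sv] := sqrtA_vsum (co u) n; set v := vsum _ _ _ in Dv Sv.
have ipS w : odom sqrtA w -> ip (sqrtA w) (sqrtA v) =
    \sum_(1 <= k < n.+1) (co u k)^* * ((mu k)%:C * co w k).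
  move=> Dw; rewrite Sv ipC ip_suml rmorph_sum /=; apply: eq_big_nat => k /andP[k0 _].
  rewrite ipZl rmorphM; congr (_ * _).
  by rewrite -((sqrtA_psi k0).2 _ Dw) (ipC ip (sqrtA w)).
have sumE w : (forall k, (0 < k <= n)%N -> co w k = co u k) ->
    \sum_(1 <= k < n.+1) (co u k)^* * ((mu k)%:C * co w k) = e%:C.
  move=> hw; rewrite /e rmorph_sum; apply: eq_big_nat => k hk.
  rewrite hw //; transitivity ((mu k)%:C * (cabs (co u k) ^+ 2)%:C); last by rewrite -rmorphM.
  by rewrite -mul_conj; ring.
have e1 : ip (sqrtA u) (sqrtA v) = e%:C by rewrite ipS // sumE.
have e2 : ip (sqrtA v) (sqrtA v) = e%:C.
  by rewrite ipS // sumE // => k /andP[k0 kn]; rewrite co_vsum // kn.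
have e3 : e = nrm (sqrtA v) ^+ 2.
  by apply: complexI; rewrite -e2 (ip_sqr ip_norm).
have := cauchy_schwarz ip_norm (sqrtA u) (sqrtA v).
rewrite e1 cabs_real e3 ger0_norm ?sqr_ge0 // expr2.
have := nrm_ge0 (sqrtA v); rewrite le_eqVlt => /predU1P[<- _|v0].
  by rewrite mul0r sqr_ge0.
by rewrite ler_pM2r // => h; rewrite -expr2 ler_pXn2r ?nnegrE ?nrm_ge0.
Qed.

(** The vector [y] is [A^(1/2) u]. *)
Lemma energy_vector u : odom sqrtA u ->
  exists y, forall k, (0 < k)%N -> co y k = (Num.sqrt (mu k))%:C * co u k.
Proof.
move=> Du; apply: (riesz_fischer ip_norm psi_basis (B := nrm (sqrtA u) ^+ 2)) => n.
apply: le_trans (energy_le Du n); rewrite le_eqVlt; apply/orP; left; apply/eqP.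
apply: eq_big_nat => k /andP[k0 _]; rewrite cabsM exprMn cabs_real real_normK ?num_real //.
by rewrite sqr_sqrtr // (le_trans ler01) // mu_ge1.
Qed.

(** Both sides are limits of the same partial sums. *)
Lemma form_psi u y n : (0 < n)%N -> odom sqrtA u ->
  (forall k, (0 < k)%N -> co y k = (Num.sqrt (mu k))%:C * co u k) ->
  b u (psi n) = ip y (kv n).
Proof.
move=> n0 Du yu; have [Dn _] := sqrtA_psi n0.
have conv := b_values Du Dn.
apply/eqP; rewrite -subr_eq0 -cabs_eq0 eq_le cabs_ge0 andbT.
apply/ler_addgt0Pl => e e0; rewrite addr0.
have e2 : 0 < e / 2 by rewrite divr_gt0.
have [m1 h1] := ip_cvg ip_norm psi_basis y (kv n) e2.
have /cvgrPdist_le/(_ (e / 2)%:C) := conv.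
rewrite ltcR => /(_ e2) [m2 _ h2].
pose m := maxn n (maxn m1 m2).
have l1 : (m1 <= m)%N by rewrite /m !leq_max leqnn orbT.
have l2 : (m2 <= m)%N by rewrite /m !leq_max leqnn !orbT.
have {}h1 := h1 m l1; have {}h2 := h2 m l2.
move: h2; rewrite normc_cabs lecR.
have -> : \sum_(1 <= j < m.+1) \sum_(1 <= k < m.+1)
     ip u (psi j) * (ip (psi n) (psi k))^* * b (psi j) (psi k) =
   \sum_(1 <= k < m.+1) co y k * (co (kv n) k)^*.
  apply: eq_big_nat => j /andP[j0 _].
  have -> : \sum_(1 <= k < m.+1) ip u (psi j) * (ip (psi n) (psi k))^* * b (psi j) (psi k) =
      \sum_(1 <= k < m.+1) (ip u (psi j) * b (psi j) (psi k)) * (k == n)%:R.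
    apply: eq_big_nat => k /andP[k0 _]; rewrite -/(co (psi n) k) (co_psi psi_basis) //.
    by rewrite rmorph_nat eq_sym mulrAC.
  rewrite (sum_delta (fun k => ip u (psi j) * b (psi j) (psi k))) // n0 ltnS leq_maxl /=.
  rewrite yu // (co_kvec ip_norm psi_basis mu_ge1 p_gt0 Mb_ge0 beta_le c0_le) //.
  have -> : ((b (psi j) (psi n))^* * ((Num.sqrt (mu j))^-1)%:C)^* =
      b (psi j) (psi n) * ((Num.sqrt (mu j))^-1)%:C.
    apply: (canLR (@conjCK _)); rewrite [RHS]rmorphM; congr (_ * _).
    by apply/esym; exact: conjc_real.
  have ss : (Num.sqrt (mu j))%:C * ((Num.sqrt (mu j))^-1)%:C = 1 :> R[i].
    rewrite -rmorphM divff // gt_eqF // sqrtr_gt0.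
    by apply: lt_le_trans (mu_ge1 j0).
  rewrite -/(co u j) (_ : _ * co u j * _ = co u j * b (psi j) (psi n) *
    ((Num.sqrt (mu j))%:C * ((Num.sqrt (mu j))^-1)%:C)); last by ring.
  by rewrite ss mulr1.
set s := \sum_(1 <= k < _) _ in h1 *; move=> h2.
rewrite cabs_distC in h1.
have := cabsD (b u (psi n) - s) (s - ip y (kv n)); rewrite addrA subrK; lra.
Qed.

(** The form identity that defines [T], tested with the basis vectors only. *)
Lemma odom_res z u : good mu p Mb z -> odom T u -> u = res 1 z (z *: u - T u).
Proof.
move=> gz Du; have [_ Tf] := T_def.
have [/= Su hT] := (Tf u (T u)).1 (conj Du erefl).
have [y yu] := energy_vector Su.
apply: (res_eq ip_norm psi_basis mu_ge1 p_gt0 Mb_ge0 beta_le c0_le (y := y) gz) => k k0.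
  rewrite yu // mulrA -rmorphM mulVf ?mul1r //.
  by rewrite gt_eqF // sqrtr_gt0; apply: lt_le_trans (mu_ge1 k0).
have [Dk Sk] := sqrtA_psi k0.
rewrite /fcoord ipBl ipZl -(hT (psi k) Dk) Sk // (form_psi k0 Su yu) /fcoord.
by ring.
Qed.

Lemma eigenvalue_not_good l : good mu p Mb l -> ~ op_eigenvalue T l.
Proof.
move=> gl [u [Du u0 Tu]]; move/eqP: u0; apply.
rewrite (odom_res gl Du) Tu subrr; apply: linear_fun0.
by apply: (res_linear ip_norm psi_basis mu_ge1 p_gt0 Mb_ge0 beta_le c0_le) gl; rewrite ler01 lexx.
Qed.

Hypothesis good_left : forall g : R, exists2 z, Re z < g & good mu p Mb z.

(** Far to the left, [T] has a resolvent because it is quasi-m-accretive; there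
    the range of [res 1] is the domain of [T], and by the resolvent identity the
    range of [res 1 z] does not depend on [z]. *)
Lemma res_odom z x : good mu p Mb z ->
  odom T (res 1 z x) /\ z *: res 1 z x - T (res 1 z x) = x.
Proof.
move=> gz; have [[_ _ [g acc]] _] := T_def.
have [z0 z0g gz0] := good_left g; have [[B [_ B1 _]] _] := acc z0 z0g.
have resB y : res 1 z0 y = B y.
  by have [D E] := B1 y; rewrite [RHS](odom_res gz0 D) E.
have s1 : 0 <= (1 : R) <= 1 by rewrite ler01 lexx.
set u := res 1 z x; pose x' := x + (z0 - z) *: u.
have uE : u = B x'.
  rewrite -resB /x'.
  have lin := res_linear ip_norm psi_basis mu_ge1 p_gt0 Mb_ge0 beta_le c0_le s1 gz0.
  rewrite (linear_funD _ _ lin) (linear_funZ _ _ lin).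
  have := res_identity ip_norm psi_basis mu_ge1 p_gt0 Mb_ge0 beta_le c0_le x s1 gz0 gz.
  rewrite -/u => id; rewrite -(opprB z z0) scaleNr -id opprB.
  by rewrite addrC subrK.
have [D E] := B1 x'; rewrite -uE in D E; split=> //.
have -> : T u = z0 *: u - x' by rewrite -E opprB addrC subrK.
rewrite /x' scalerBl; move: (z *: u) (z0 *: u) => a c.
by rewrite opprB addrA (addrCA a x) (addrC a (c - a)) subrK addrK.
Qed.

Lemma resolventE z : good mu p Mb z -> resolvent T z = res 1 z.
Proof.
move=> gz; apply/funext => x; have [D E] := res_odom x gz.
have ex : exists u, [set u | odom T u /\ z *: u - T u = x] u by exists (res 1 z x).
have [/= D' E'] := xgetPex 0 ex.
by rewrite /resolvent; rewrite [LHS](odom_res gz D') E'.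
Qed.

Lemma good_resolvent_set z : good mu p Mb z -> resolvent_set T z.
Proof.
move=> gz; have s1 : 0 <= (1 : R) <= 1 by rewrite ler01 lexx.
have lin := res_linear ip_norm psi_basis mu_ge1 p_gt0 Mb_ge0 beta_le c0_le s1 gz.
pose B : {linear H -> H} := HB.pack (res 1 z) (GRing.isLinear.Build _ _ _ _ (res 1 z) lin).
exists B; split.
- apply: (bounded_continuous lin) => x.
  exact: (nrm_res ip_norm psi_basis mu_ge1 p_gt0 Mb_ge0 beta_le c0_le x s1 gz).
- by move=> x; exact: res_odom.
- by move=> u Du; rewrite [RHS](odom_res gz Du).
Qed.

(** * The Riesz projection of a convex contour *)

Section ContourRank.
Variables (g : contour R) (c : R[i]) (B D0 rho eps : R) (m n : nat).
Local Notation L := (clen g).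
Local Notation W := (0 +i* (2 * pi) : R[i]).
Hypotheses (L0 : 0 <= L) (B0 : 0 <= B) (rho0 : 0 < rho) (D00 : 0 <= D0) (eps0 : 0 < eps).
Hypothesis gB : lip_on g 0 L B.
Hypothesis g_closed : g 0 = g L.
Hypothesis g_supp : supported g L c rho.
Hypothesis gD : forall t, 0 <= t <= L -> cabs (g t - c) <= D0.
Hypothesis g_good : forall t z, 0 <= t <= L -> cabs (z - g t) <= eps -> good mu p Mb z.
Hypothesis g_inside : forall r, 0 <= r < 1 -> exists K, forall t, 0 <= t <= L ->
  winding g L (shrink c r g t) W K.
Hypothesis m0 : (0 < m)%N.
Hypothesis g_mu : forall k, (0 < k)%N -> exists K,
  winding g L (mu k)%:C (if (m <= k < m + n)%N then W else 0) K.

Let W0 : W != 0.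
Proof. by rewrite eq_complex /= negb_and orbC gt_eqF // mulr_gt0 // pi_gt0. Qed.

(** The integral of the unperturbed resolvent is diagonal, with the winding
    numbers around the eigenvalues as its entries. *)
Let integral0_co (J : H -> H) (K1 : R) : usum_cvg g L (res 0) J K1 ->
  forall x k, (0 < k)%N -> co (J x) k = (if (m <= k < m + n)%N then W else 0) * co x k.
Proof.
move=> FJ x k k0; have [K hK] := g_mu k0; set w := (if _ then _ else _) in hK *.
apply/eqP; rewrite -subr_eq0 -cabs_eq0 eq_le cabs_ge0 andbT.
apply: (@le0_over_nat _ _ (K1 * nrm x + K * cabs (co x k))) => N N0.
have h1 := FJ N x N0; have h2 := hK N N0.
set s := \sum_(i < N) _ in h2.
have uE : co (usum g L (res 0) N x) k = s * co x k.
  rewrite /fcoord ip_suml /s mulr_suml; apply: eq_bigr => i _; rewrite ipZl.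
  rewrite -/(fcoord _ _ _ _) (co_res0 ip_norm psi_basis mu_ge1 p_gt0 Mb_ge0 beta_le c0_le) //.
    by rewrite mulrAC mulrA.
  apply: (g_good (upt_bounds L0 (ltnW (ltn_ord i)))).
  by rewrite subrr cabs0 ltW.
have p1 : nrm (psi k) = 1.
  apply/eqP; rewrite -(@eqrXn2 _ 2) ?nrm_ge0 // expr1n; apply/eqP/complexI.
  by rewrite -(ip_sqr ip_norm) -/(fcoord ip psi _ _) (co_psi psi_basis) // eqxx.
have h3 : cabs (co (usum g L (res 0) N x - J x) k) <= K1 / N%:R * nrm x.
  by apply: le_trans h1; have := cauchy_schwarz ip_norm (usum g L (res 0) N x - J x) (psi k);
    rewrite p1 mulr1.
rewrite /fcoord ipBl -!/(fcoord _ _ _ _) uE in h3.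
have h4 := ler_wpM2r (cabs_ge0 (co x k)) h2; rewrite -cabsM mulrBl in h4.
have := cabsD (co (J x) k - s * co x k) (s * co x k - w * co x k).
rewrite addrA subrK cabs_distC in h3 *.
rewrite (_ : _ / N%:R = K1 / N%:R * nrm x + K / N%:R * cabs (co x k)); last by ring.
lra.
Qed.

Let rank0 (J : H -> H) (K1 : R) : usum_cvg g L (res 0) J K1 ->
  has_rank (fun x => W^-1 *: J x) n.
Proof.
move=> FJ; have coJ := integral0_co FJ.
have coP0 x k : (0 < k)%N ->
    co (W^-1 *: J x) k = if (m <= k < m + n)%N then co x k else 0.
  move=> k0; rewrite /fcoord ipZl -!/(fcoord _ _ _ _) coJ //.
  by case: ifP => _; rewrite ?mul0r ?mulr0 // mulrA mulVf // mul1r.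
have sumE (a : nat -> R[i]) : \sum_(i < n) a (m + i)%N *: psi (m + i)%N =
    \sum_(m <= k < m + n) a k *: psi k.
  transitivity (\sum_(0 + m <= k < m + n) a k *: psi k); last by rewrite add0n.
  rewrite big_addn addKn big_mkord.
  by apply: eq_bigr => i _; rewrite addnC.
have co_comb (a : 'I_n -> R[i]) (j : 'I_n) : co (\sum_i a i *: psi (m + i)%N) (m + j)%N = a j.
  rewrite /fcoord ip_suml (bigD1 j) //= ipZl -/(fcoord _ _ _ _).
  rewrite (co_psi psi_basis) ?addn_gt0 ?m0 // eqxx mulr1 big1 ?addr0 // => i ij.
  rewrite ipZl -/(fcoord _ _ _ _) (co_psi psi_basis) ?addn_gt0 ?m0 // eqn_add2l.
  by rewrite -val_eqE /= in ij; rewrite (negbTE ij) mulr0.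
exists (fun i => psi (m + i)%N); split.
  by move=> a a0 j; rewrite -(co_comb a) a0 /fcoord linear0l.
have P0E x : W^-1 *: J x = \sum_(i < n) co x (m + i)%N *: psi (m + i)%N.
  apply: (co_inj ip_norm psi_basis) => k k0; rewrite coP0 //.
  by rewrite sumE (co_sum psi_basis).
apply/seteqP; split => [_ [x _ <-]|_ [a _ <-]].
  by exists (fun i => co x (m + i)%N).
exists (\sum_i a i *: psi (m + i)%N) => //.
by rewrite P0E; apply: eq_bigr => i _; rewrite co_comb.
Qed.

Lemma riesz_rank : riesz_projection_rank T g n.
Proof.
have s1 : 0 <= (1 : R) <= 1 by rewrite ler01 lexx.
have c00 : 0 <= c0 by have := c0_le 0; rewrite big_geq.
have gt_good t : 0 <= t <= L -> good mu p Mb (g t).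
  by move=> ht; apply: (g_good ht); rewrite subrr cabs0 ltW.
have gL := lip_on_path gB.
(* Shrinking by a factor between [1 - delta] and [1] moves the points of the
   contour by at most [eps], hence inside the set of good points. *)
pose delta := Num.min 1 (eps / (D0 + 1)).
have D1 : 0 < D0 + 1 by have := D00; lra.
have delta0 : 0 < delta by rewrite /delta lt_min ltr01 divr_gt0.
have delta1 : delta <= 1 by rewrite /delta ge_min lexx.
have deltaD : delta * D0 <= eps.
  apply: (@le_trans _ _ (eps / (D0 + 1) * (D0 + 1))); last by rewrite divfK // gt_eqF.
  apply: ler_pM => //; [exact: ltW | by rewrite /delta ge_min lexx orbT | by rewrite lerDl].
have near r t : 1 - delta <= r <= 1 -> 0 <= t <= L -> cabs (shrink c r g t - g t) <= eps.
  move=> /andP[r0 r1] ht; rewrite (_ : _ - _ = (r - 1)%:C * (g t - c)); last first.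
    by rewrite /shrink rmorphB /=; ring.
  rewrite cabsM cabs_real distrC ger0_norm ?subr_ge0 //; apply: le_trans deltaD.
  apply: ler_pM; rewrite ?subr_ge0 ?cabs_ge0 ?gD //; lra.
pose Z : set R[i] :=
  [set z | exists r t, [/\ 1 - delta <= r <= 1, 0 <= t <= L & z = shrink c r g t]].
have shrinkZ r t : 1 - delta <= r <= 1 -> 0 <= t <= L -> Z (shrink c r g t).
  by move=> hr ht; exists r, t.
have Zgood z : Z z -> good mu p Mb z.
  by move=> [r [t [hr ht ->]]]; apply: (g_good ht); exact: near.
have gZ t : 0 <= t <= L -> Z (g t).
  move=> ht; rewrite -(shrink1 c g); apply: shrinkZ => //.
  by apply/andP; split; lra.
(* The shrunk contours are bounded, so that [res_const] is bounded on [Z]. *)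
pose rad := cabs c + D0.
have Zrad z : Z z -> cabs z <= rad.
  move=> [r [t [/andP[r0 r1] ht ->]]]; rewrite /shrink; apply: (le_trans (cabsD _ _)).
  rewrite lerD2l cabsM cabs_real ger0_norm; last by lra.
  by apply: le_trans (gD ht); rewrite ler_piMl ?cabs_ge0.
pose K := 4 * (1 + 3 * rad) ^+ 2.
have rad0 : 0 <= rad by rewrite addr_ge0 ?cabs_ge0.
have K0 : 0 <= K by rewrite mulr_ge0 ?sqr_ge0.
have ZK z : Z z -> 4 * res_const z ^+ 2 <= K.
  move=> /Zrad hz; rewrite /K ler_wpM2l // /res_const.
  have z0 := cabs_ge0 z; rewrite ler_pXn2r ?nnegrE //; lra.
have FK s : 0 <= s <= 1 -> pseudo_resolvent Z (res s) K.
  move=> s01; split.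
  - move=> z /Zgood gz.
    by exact: (res_linear ip_norm psi_basis mu_ge1 p_gt0 Mb_ge0 beta_le c0_le).
  - move=> z x Zz; have gz := Zgood _ Zz.
    apply: (le_trans (nrm_res ip_norm psi_basis mu_ge1 p_gt0 Mb_ge0 beta_le c0_le x s01 gz)).
    by rewrite ler_wpM2r ?nrm_ge0 // ZK.
  - move=> z w x /Zgood gz /Zgood gw.
    exact: (res_identity ip_norm psi_basis mu_ge1 p_gt0 Mb_ge0 beta_le c0_le).
have FM s s' z x : 0 <= s <= 1 -> 0 <= s' <= 1 -> Z z ->
    nrm (res s z x - res s' z x) <= K ^+ 2 * (Mb * c0) * `|s - s'| * nrm x.
  move=> s01 s01' Zz; have gz := Zgood _ Zz.
  apply: (le_trans (res_lip ip_norm psi_basis mu_ge1 p_gt0 Mb_ge0 beta_le c0_le x s01 s01' gz)).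
  rewrite !ler_wpM2r ?nrm_ge0 ?mulr_ge0 // ler_pXn2r ?nnegrE ?ZK //.
  by rewrite mulr_ge0 ?sqr_ge0.
have /boolp.choice [J hJ] (s : R) : exists J : H -> H, 0 <= s <= 1 ->
    forall (d : R) N t tg, tagged_partition 0 L d N t tg -> forall x,
    nrm (rsum g (fun t => res s (g t) x) N t tg - J x) <= B ^+ 2 * K ^+ 2 * L * d * nrm x.
  have [s01|_] := boolP (0 <= s <= 1); last by exists id.
  by have [J hJ] := resolvent_integral_exists K0 (FK s s01) L0 B0 gL gZ; exists J => _.
have FJ s (s01 : 0 <= s <= 1) := integral_usum_cvg L0 (hJ s s01).
have JJ s x : 0 <= s <= 1 -> J s (J s x) = W *: J s x.
  move=> s01; apply: (integral_idempotent K0 (FK s s01) L0 B0 gL gD delta0 delta1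
    shrinkZ (W := W) _ _ (FJ s s01)).
    move=> r t t' /andP[r0 r1] ht ht'; apply: (shrink_disjoint rho0 _ g_supp ht ht').
    by apply/andP; split; lra.
  move=> r /andP[r0 r1]; have r01 : 0 <= r < 1 by apply/andP; split; lra.
  have [K2 hK2] := g_inside r01.
  pose K3 := 2 * B ^+ 2 / ((1 - r) * rho) ^+ 2 * L ^+ 2.
  exists (Num.max K2 K3) => t ht.
  have mono (f : R -> R[i]) (w v : R[i]) (k k' : R) : k <= k' ->
      winding f L w v k -> winding f L w v k'.
    move=> kk' hw N N0; apply: (le_trans (hw N N0)); rewrite ler_wpM2r //.
  split; first by apply: (mono _ _ _ K2); [rewrite le_max lexx | exact: hK2].
  apply: (mono _ _ _ K3); first by rewrite le_max lexx orbT.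
  exact: winding_shrink.
have s0 : 0 <= (0 : R) <= 1 by rewrite ler01 lexx.
have M0 : 0 <= K ^+ 2 * (Mb * c0) by rewrite mulr_ge0 ?sqr_ge0 // mulr_ge0.
have rank1 := integral_rank_invariant M0 FK FM L0 B0 gL gZ FJ W0 JJ (rank0 (FJ 0 s0)).
have linJ := integral_linear (FK 1 s1) L0 gZ (FJ 1 s1).
have linP : linear (fun x => W^-1 *: J 1 x).
  by move=> a u v; rewrite linJ scalerDr !scalerA mulrC.
split.
  move=> _ [t ht <-]; apply/good_resolvent_set/gt_good.
  by move: ht; rewrite /= in_itv.
pose P : {linear H -> H} := HB.pack (fun x => W^-1 *: J 1 x)
  (GRing.isLinear.Build _ _ _ _ (fun x => W^-1 *: J 1 x) linP).
exists P.
split => //.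
- apply: (bounded_continuous linP (K := cabs W^-1 * (B * L * K))) => x.
  rewrite nrmZ -mulrA ler_wpM2l ?cabs_ge0 //.
  exact: (integral_le (FK 1 s1) L0 B0 gL gZ (FJ 1 s1)).
- exists (J 1) => // e e0.
  pose M := B ^+ 2 * K ^+ 2 * L.
  have M1 : 0 < M + 1 by rewrite ltr_wpDl // mulr_ge0 // mulr_ge0 ?sqr_ge0.
  exists (e / (M + 1)); first by rewrite divr_gt0.
  move=> N t tg tp x; rewrite nrmE nrmE -rmorphM lecR.
  have -> : \sum_(i < N) (g (t i.+1) - g (t i)) *: resolvent T (g (tg i)) x =
      rsum g (fun t => res 1 (g t) x) N t tg.
    apply: eq_bigr => i _; rewrite resolventE //; apply: gt_good.
    exact: (tag_bounds tp).
  apply: (le_trans (hJ 1 s1 _ _ _ _ tp x)); rewrite -/M ler_wpM2r ?nrm_ge0 //.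
  by rewrite mulrA ler_pdivrMr // mulrC ler_pM2l // lerDl.
Qed.

End ContourRank.

End FormOperator.

(** * The contours of the theorem *)
Section Contours.
Context {R : realType}.
Variables (mu : nat -> R) (N : nat) (h : R).
Hypothesis mu1 : 1 <= mu 1%N.
Hypothesis mu_gap : forall n, (0 < n)%N -> 1 <= mu n.+1 - mu n.
Hypothesis h_gt1 : 1 < h.

Lemma mu_sep j k : (0 < j)%N -> (j < k)%N -> mu j + 1 <= mu k.
Proof.
move=> j0 jk; have := mu_gap j0; have := mu_le mu_gap (j := j.+1) isT jk; lra.
Qed.

Lemma left_outside (z : R[i]) : Re z <= - h -> ~ Pi_region mu N h z.
Proof.
move=> hz; have h1 := h_gt1; case=> [[r1 _ _ _]|[j Nj]]; first by lra.
rewrite /Pij /disc /=; have := Re_le_cabs (z - (mu j)%:C); rewrite ReB /=.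
have := mu_ge_one mu1 mu_gap (leq_trans (ltn0Sn _) (ltnW Nj)).
have := ler_norm (- (Re z - mu j)); rewrite normrN; lra.
Qed.

(** The right edge is at distance at least [1 / 2] from the next eigenvalue, and the
    discs are open. *)
Lemma Gamma0_outside (t : R) : 0 <= t <= 4 -> ~ Pi_region mu N h (Gamma0 mu N h t).
Proof.
have h1 := h_gt1; have m1 := mu_ge_one mu1 mu_gap (isT : (0 < N.+1)%N).
have hx : - h < mu N.+1 + 2^-1 by lra.
have hy : - h < h by lra.
move=> /(rect_edge hx hy); rewrite -/(Gamma0 mu N h); move: (Gamma0 _ _ _ t) => z.
move=> [/andP[x0 x1] _ e]; case=> [[r1 r2 r3 r4]|[j Nj]].
  by case: e => e; lra.
rewrite /Pij /disc /=; have := Re_le_cabs (z - (mu j)%:C); rewrite ReB /=.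
have := mu_sep (isT : (0 < N.+1)%N) Nj.
have := ler_norm (- (Re z - mu j)); rewrite normrN; lra.
Qed.

Lemma Gammaj_dist j (t : R) : cabs (Gammaj mu j t - (mu j)%:C) = 2^-1.
Proof.
rewrite /Gammaj /= cabsE /= subr0 addrAC subrr add0r !exprMn -mulrDr cos2Dsin2 mulr1.
by rewrite sqrtr_sqr ger0_norm // invr_ge0.
Qed.

Lemma Gammaj_Re j (t : R) : mu j - 2^-1 <= Re (Gammaj mu j t) <= mu j + 2^-1.
Proof.
have := Re_le_cabs (Gammaj mu j t - (mu j)%:C); rewrite Gammaj_dist ReB.
cbn [complex.Re real_complex_def].
by rewrite ler_norml => /andP[? ?]; apply/andP; split; lra.
Qed.

Lemma Gammaj_outside j (t : R) : (N.+1 < j)%N -> ~ Pi_region mu N h (Gammaj mu j t).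
Proof.
move=> Nj; have j0 : (0 < j)%N by exact: leq_ltn_trans Nj.
have zj := Gammaj_dist j t; have := Gammaj_Re j t.
move: (Gammaj mu j t) zj => z zj /andP[z1 z2].
have m1 := mu_sep (isT : (0 < N.+1)%N) Nj.
case=> [[_ r2 _ _]|[k Nk]]; first by lra.
have k0 : (0 < k)%N by exact: leq_ltn_trans Nk.
rewrite /Pij /disc /=; have := Re_le_cabs (z - (mu k)%:C); rewrite ReB /=.
have [jk|kj|jk] := ltngtP j k; last by rewrite -jk zj; lra.
- have := mu_sep j0 jk; have := ler_norm (- (Re z - mu k)); rewrite normrN; lra.
- have := mu_sep k0 kj; have := ler_norm (Re z - mu k); lra.
Qed.

Let cabs1 : cabs (1 : R[i]) = 1. Proof. by rewrite cabs_real normr1. Qed.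

Lemma Gamma0_winding k : (0 < k)%N -> exists K,
  winding (Gamma0 mu N h) 4 (mu k)%:C (if (1 <= k < 1 + N.+1)%N then 0 +i* (2 * pi) else 0) K.
Proof.
move=> k0; have h1 := h_gt1; have m1 := mu_ge_one mu1 mu_gap (isT : (0 < N.+1)%N).
have mk := mu_ge_one mu1 mu_gap k0.
have hx : - h < mu N.+1 + 2^-1 by lra.
have hy : - h < h by lra.
rewrite k0 add1n ltnS; case: ltnP => [Nk|kN].
  eexists; apply: (winding_halfplane (e := - 1) (d := 2^-1)
    (B := mu N.+1 + 2^-1 - - h + (h - - h))).
  - by [].
  - by rewrite cabsN.
  - by rewrite invr_gt0.
  - lra.
  - exact: rect_lip.
  - exact: rect_closed.
  move=> t /(rect_edge hx hy) [/andP[_ x1] _ _]; rewrite mulrN1.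
  have := mu_sep (isT : (0 < N.+1)%N) Nk; move: x1.
  by rewrite -/(Gamma0 mu N h); move: (Gamma0 mu N h t) => [a b] /=; lra.
eexists; apply: (rect_winding_inside hx hy (d := 2^-1)); first by rewrite invr_gt0.
- have : mu k <= mu N.+1 by apply: (mu_le mu_gap).
  by move=> ?; apply/andP; split => /=; lra.
- by apply/andP; split => /=; lra.
Qed.

Lemma Gamma0_inside (r : R) : 0 <= r < 1 -> exists K, forall t, 0 <= t <= 4 ->
  winding (Gamma0 mu N h) 4
    (shrink (rect_center (- h) (mu N.+1 + 2^-1) (- h) h) r (Gamma0 mu N h) t)
    (0 +i* (2 * pi)) K.
Proof.
move=> /andP[r0 r1]; have h1 := h_gt1.
have m1 := mu_ge_one mu1 mu_gap (isT : (0 < N.+1)%N).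
have hx : - h < mu N.+1 + 2^-1 by lra.
have hy : - h < h by lra.
eexists=> t ht; apply: (rect_winding_inside hx hy (d := 1 - r)); first by lra.
all: have [] := rect_edge hx hy ht; rewrite -/(Gamma0 mu N h);
  rewrite /shrink /rect_center; case: (Gamma0 mu N h t) => a b /=.
- by move=> /andP[? ?] _ _; apply/andP; split; nra.
- by move=> _ /andP[? ?] _; apply/andP; split; nra.
Qed.

Lemma Gammaj_winding j k : (0 < j)%N -> (0 < k)%N -> exists K,
  winding (Gammaj mu j) (2 * pi) (mu k)%:C
    (if (j <= k < j + 1)%N then 0 +i* (2 * pi) else 0) K.
Proof.
move=> j0 k0; have r0 : 0 < 2^-1 :> R by rewrite invr_gt0.
have p0 : 0 <= 2 * pi :> R by rewrite mulr_ge0 ?pi_ge0.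
rewrite addn1 ltnS -eqn_leq; case: eqP => [<-|/eqP jk].
  eexists; apply: (circle_winding_inside r0 (d := 2^-1)) => //.
  by rewrite subrr cabs0 subrr.
have half e : cabs e = 1 ->
    (forall t, 0 <= t <= 2 * pi -> 2^-1 <= Re ((Gammaj mu j t - (mu k)%:C) * e)) ->
    exists K, winding (Gammaj mu j) (2 * pi) (mu k)%:C 0 K.
  move=> e1 he; eexists; apply: (winding_halfplane (e := e) (d := 2^-1) (B := 2 * 2^-1)) => //.
  - exact: circle_lip.
  - exact: circle_closed.
move: jk; rewrite neq_ltn => /orP[jk|kj].
  apply: (half (-1)); first by rewrite cabsN.
  move=> t _; rewrite mulrN1; have := mu_sep j0 jk; have := Gammaj_Re j t.
  by move: (Gammaj mu j t) => [a b] /= /andP[? ?]; lra.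
apply: (half 1) => // t _; rewrite mulr1; have := mu_sep k0 kj; have := Gammaj_Re j t.
by move: (Gammaj mu j t) => [a b] /= /andP[? ?]; lra.
Qed.

Lemma Gammaj_inside j (r : R) : 0 <= r < 1 -> exists K, forall t, 0 <= t <= 2 * pi ->
  winding (Gammaj mu j) (2 * pi) (shrink (mu j)%:C r (Gammaj mu j) t) (0 +i* (2 * pi)) K.
Proof.
move=> /andP[r0 r1]; have rho0 : 0 < 2^-1 :> R by rewrite invr_gt0.
eexists=> t ht; apply: (circle_winding_inside rho0 (d := (1 - r) / 2)).
  by rewrite divr_gt0 // subr_gt0.
rewrite /shrink addrAC subrr add0r cabsM cabs_real ger0_norm // Gammaj_dist.
lra.
Qed.

End Contours.

Theorem proposition2
  (R : realType)
  (H : completeNormedModType R[i]) (ip : {dot H for (@Num.conj R[i])})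
  (ip_norm : forall x : H, ip x x = `|x| ^+ 2)
  (A : operator H) (psi : nat -> H) (mu : nat -> R)
  (A_sa : self_adjoint ip A)
  (psi_basis : orthonormal_basis ip psi)
  (A_eigen : forall n, (0 < n)%N ->
     odom A (psi n) /\ A (psi n) = (mu n)%:C *: psi n)
  (A_simple : forall n, (0 < n)%N -> forall u : H, odom A u ->
     A u = (mu n)%:C *: u -> exists c : R[i], u = c *: psi n)
  (mu_ge1 : 1 <= mu 1%N)
  (mu_gap : forall n, (0 < n)%N -> 1 <= mu n.+1 - mu n)
  (sqrtA : operator H) (sqrtA_def : is_sqrt ip A sqrtA)
  (alpha Mb : R) (alpha_gt0 : 0 < alpha) (Mb_gt0 : 0 < Mb)
  (b : H -> H -> R[i])
  (b_sesqui : sesquilinear_on (odom sqrtA) b)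
  (b_values : forall f g : H, odom sqrtA f -> odom sqrtA g ->
     (fun n : nat => \sum_(1 <= j < n.+1) \sum_(1 <= k < n.+1)
        ip f (psi j) * (ip g (psi k))^* * b (psi j) (psi k)) @ \oo
       --> (b f g : R[i]^o))
  (b_bound : forall m n, (0 < m)%N -> (0 < n)%N ->
     cabs (b (psi m) (psi n)) <= Mb / (m%:R `^ alpha * n%:R `^ alpha))
  (T : operator H)
  (T_def : m_sectorial_operator_of ip
     (form_add (form_of_sqrt ip sqrtA) b) T)
  (C D : R)
  (C_def : sigma_constant mu (2 * alpha) C)
  (D_def : tau_constant (2 * alpha) D)
  (N : nat) (N_gt0 : (0 < N)%N)
  (N_large : forall n, (N < n)%N -> Mb * C * sigma (2 * alpha) n <= 2^-1)
  (h : R) (h_gt1 : 1 < h)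
  (h_large : 2 * Mb * (h^-1 * (\sum_(1 <= k < N.+3) (k%:R `^ (2 * alpha))^-1)
                       + D * tau (2 * alpha) h) <= 2^-1) :
  [/\ forall l : R[i], op_eigenvalue T l ->
        interior (Pi_region mu N h : set R[i]^o) l,
      riesz_projection_rank T (Gamma0 mu N h) N.+1
    & forall j, (N.+1 < j)%N -> riesz_projection_rank T (Gammaj mu j) 1].
Proof.
have mu_one := mu_ge_one mu_ge1 mu_gap.
have p_gt0 := @pw_gt0 _ alpha.
have Mb_ge0 := ltW Mb_gt0.
have c0_le := energy_sum_le mu_ge1 mu_gap D_def h_gt1.
have outside z := @outside_good _ _ mu_ge1 mu_gap _ _ _ _ _ _ alpha_gt0 Mb_gt0 C_def
  D_def N_gt0 N_large h_gt1 h_large z.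
have near z z' := @near_outside_good _ _ mu_ge1 mu_gap _ _ _ _ _ _ alpha_gt0 Mb_gt0 C_def
  D_def N_gt0 N_large h_gt1 h_large z z'.
have good_left (g : R) : exists2 z, Re z < g & good mu (pw alpha) Mb z.
  exists (Num.min (- h) (g - 1))%:C => /=; first by rewrite gt_min; apply/orP; right; lra.
  by apply/outside/(left_outside mu_ge1 mu_gap h_gt1); rewrite /= ge_min lexx.
have m1 := mu_one N.+1 isT.
have eps0 : 0 < 6^-1 :> R by rewrite invr_gt0.
split.
- move=> l Tl; apply: Pi_region_interior; apply: contrapT => /outside gl.
  exact: (eigenvalue_not_good ip_norm psi_basis A_eigen sqrtA_def b_values T_def
    mu_one p_gt0 Mb_ge0 b_bound c0_le gl Tl).
- have hx : - h < mu N.+1 + 2^-1 by lra.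
  have hy : - h < h by lra.
  apply: (riesz_rank ip_norm psi_basis A_eigen sqrtA_def b_values T_def
    mu_one p_gt0 Mb_ge0 b_bound c0_le good_left (m := 1)
    (c := rect_center (- h) (mu N.+1 + 2^-1) (- h) h)
    (B := mu N.+1 + 2^-1 - - h + (h - - h)) (D0 := mu N.+1 + 2^-1 - - h + (h - - h))
    (rho := 1) (eps := 6^-1)) => //; rewrite -?[clen _]/(4 : R).
  + lra.
  + lra.
  + exact: rect_lip.
  + exact: rect_closed.
  + by apply: rect_supported => //; lra.
  + move=> t /(rect_edge hx hy); rewrite /rect_center -/(Gamma0 mu N h).
    case: (Gamma0 mu N h t) => a c /= [/andP[? ?] /andP[? ?] _].
    apply: (le_trans (cabs_le_ReIm _)) => /=.
    by apply: lerD; rewrite ler_norml; apply/andP; split; lra.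
  + by move=> t z ht; apply: near; apply: Gamma0_outside.
  + exact: Gamma0_inside.
  + exact: Gamma0_winding.
- move=> j Nj; have j0 : (0 < j)%N by exact: leq_ltn_trans Nj.
  have r0 : 0 < 2^-1 :> R by rewrite invr_gt0.
  apply: (riesz_rank ip_norm psi_basis A_eigen sqrtA_def b_values T_def
    mu_one p_gt0 Mb_ge0 b_bound c0_le good_left (m := j) (c := (mu j)%:C)
    (B := 2 * 2^-1) (D0 := 2^-1) (rho := 2^-1) (eps := 6^-1)) => //;
    rewrite -?[clen _]/(2 * pi : R).
  + by rewrite mulr_ge0 ?pi_ge0.
  + exact: circle_lip.
  + exact: circle_closed.
  + exact: circle_supported.
  + by move=> t _; rewrite Gammaj_dist.
  + by move=> t z _; apply: near; apply: Gammaj_outside.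
  + by move=> r; exact: Gammaj_inside.
  + by move=> k; exact: Gammaj_winding.
Qed.
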